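(* Let $\mathbb K\in\{\mathbb R,\mathbb C\}$, let $E$ and $F$ be locally convex $\mathbb K$-vector spaces and $f\colon U\to F$ be a $C^r_{\mathbb K}$-map on an open subset $U\subseteq E$, where $r\in\mathbb N\cup\{\infty,\omega\}$. Then the following holds: (a) The map $f^{(k)}\colon U\to L^k_{\mathbb K}(E,F)_c$, $x\mapsto f^{(k)}(x)=d^kf(x,\cdot)$ is $C^{r-k}_{\mathbb K}$, for each $k\in\mathbb N$ such that $k\le r$. (b) The map $f^{(k)}\colon U\to L^k_{\mathbb K}(E,F)_b$ is $C^{r-k-1}_{\mathbb K}$, for each $k\in\mathbb N$ such that $k\le r-1$. Furthermore, $d^j(f^{(k)})(x,y_1,\ldots,y_j)=d^{j+k}f(x,\cdot,y_1,\ldots,y_j)$ for all $j\in\mathbb N$ with $j+k\le r$ in the situation of (a) (resp., $j+k\le r-1$ in the situation of (b)), all $x\in U$, and $y_1,\ldots,y_j\in E$.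
   Context: All locally convex spaces are Hausdorff. $\mathbb N=\{1,2,\ldots\}$; $n<\infty<\omega$ for $n\in\mathbb N_0$, and $\infty\pm k:=\infty$, $\omega\pm k:=\omega$ for $k\in\mathbb N$. Differential calculus (Keller's $C^r_c$-theory): Let $E,F$ be locally convex $\mathbb K$-vector spaces, $U\subseteq E$ open. For $r\in\mathbb N_0\cup\{\infty\}$, a map $f\colon U\to F$ is $C^r_{\mathbb K}$ if it is continuous and, for all $j\in\mathbb N$ with $j\le r$, the iterated directional derivatives $d^jf(x,y_1,\ldots,y_j):=(D_{y_j}\cdots D_{y_1}f)(x)$ exist for all $(x,y_1,\ldots,y_j)\in U\times E^j$ and $d^jf\colon U\times E^j\to F$ is continuous; here $(D_yf)(x)=\lim_{t\to0}\frac{f(x+ty)-f(x)}{t}$ with $t\in\mathbb K\setminus\{0\}$. A map $f$ is $C^\omega_{\mathbb C}$ (complex analytic) if it is continuous and for each $x\in U$ there is a $0$-neighbourhood $Y\subseteq E$ with $x+Y\subseteq U$ and $f(x+y)=\sum_{n=0}^\infty\beta_n(y)$ pointwise for $y\in Y$, with continuous complex homogeneous polynomials $\beta_n\colon E\to F$ of degree $n$ (equivalent to $C^\infty_{\mathbb C}$). A map $f$ is $C^\omega_{\mathbb R}$ if it extends to a complex analytic map to $F_{\mathbb C}$ on an open neighbourhood of $U$ in the complexification $E_{\mathbb C}$. $L^k_{\mathbb K}(E,F)$ is the space of continuous $k$-linear maps $E^k\to F$; the subscript $c$ (resp. $b$) denotes the topology of uniform convergence on compact (resp. bounded) subsets of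 $E^k$. *)

(* Defs.v *)
From HB Require Import structures.
From mathcomp Require Import all_boot all_order all_algebra.
From mathcomp Require Import complex.
From mathcomp Require Import boolp classical_sets functions convex reals
  interval_inference topology num_normedtype pseudometric_normed_Zmodule tvs
  sequences.

Set Implicit Arguments.
Unset Strict Implicit.
Unset Printing Implicit Defensive.

Import Order.TTheory GRing.Theory Num.Theory.
Import numFieldTopology.Exports.

Local Open Scope classical_set_scope.
Local Open Scope ring_scope.
Local Open Scope complex_scope.

(* [tpow k E] is E^k with the product topology and the componentwise linear
   structure; the arrow type itself carries no canonical topology. *)
Definition tpow (k : nat) (E : Type) : Type := 'I_k -> E.

HB.instance Definition _ (k : nat) (E : topologicalType) :=
  Topological.copy (tpow k E) (prod_topology (fun _ : 'I_k => E)).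

HB.instance Definition _ (K : numFieldType) (k : nat) (E : tvsType K) :=
  GRing.Lmodule.copy (tpow k E) ('I_k -> E).

Definition tcat (E : Type) (m n : nat) (v : tpow m E) (w : tpow n E) :
    tpow (m + n)%N E :=
  fun i => match fintype.split i with inl a => v a | inr b => w b end.

Definition tset (k : nat) (E : Type) (y : tpow k E) (i : 'I_k) (u : E) :
    tpow k E :=
  fun j => if j == i then u else y j.

Definition multilinear (K : numFieldType) (k : nat) (E F : lmodType K)
    (g : tpow k E -> F) : Prop :=
  forall (i : 'I_k) (y : tpow k E) (a : K) (u v : E),
    g (tset y i (a *: u + v)) = a *: g (tset y i u) + g (tset y i v).

(* von Neumann boundedness *)
Definition tvs_bounded (K : numFieldType) (M : preTopologicalLmodType K)
    (B : set M) : Prop :=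
  forall V : set M, nbhs 0 V ->
    exists2 r : K, 0 < r &
      forall t : K, r <= `|t| -> B `<=` [set t *: x | x in V].

Variant bornology := OnCompact | OnBounded.

Definition in_bornology (b : bornology) (K : numFieldType)
    (M : preTopologicalLmodType K) (B : set M) : Prop :=
  match b with OnCompact => compact B | OnBounded => tvs_bounded B end.

Lemma convex_setP (K : numDomainType) (M : lmodType K) (A : set M) :
  convex_set A <->
  forall (x y : M) (l : {i01 K}), A x -> A y ->
    A (l%:num *: x + (1 - l%:num) *: y).
Proof.
split=> cA x y l; first by move=> Ax Ay; apply/set_mem/cA; exact/mem_set.
by move=> /set_mem Ax /set_mem Ay; apply/mem_set; exact: cA.
Qed.

Section TvsFacts.
Context (K : numFieldType) (F : tvsType K).
Implicit Types (V : set F).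

Lemma nbhs0_add V : nbhs 0 V ->
  exists2 W, nbhs 0 W & forall a b, W a -> W b -> V (a + b).
Proof.
move=> V0; have /= := @add_continuous F (0, 0) V; rewrite addr0 => /(_ V0).
move=> [[A B] /= [A0 B0] AB]; exists (A `&` B); first exact: filterI.
by move=> a b [Aa _] [_ Bb]; exact: (AB (a, b)).
Qed.

Lemma nbhs0_scale V (a : K) : nbhs 0 V ->
  exists2 W, nbhs 0 W & \forall t \near (a : K^o), forall w, W w -> V (t *: w).
Proof.
move=> V0; have /= := @scale_continuous K F (a, 0) V; rewrite scaler0.
move=> /(_ V0) [[A B] /= [Aa B0] AB]; exists B => //.
by apply: filterS Aa => t At w Bw; exact: (AB (t, w)).
Qed.

Lemma nbhs0_convex V : nbhs 0 V ->
  exists2 W, nbhs 0 W & convex_set W /\ W `<=` V.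
Proof.
move=> V0; have [B Bc [Bo Bb]] := @locally_convex K F.
have [W [BW W0] WV] := Bb 0 V V0.
exists W; first by apply: open_nbhs_nbhs; split=> //; exact: Bo.
by split=> //; apply: Bc; rewrite inE.
Qed.

Lemma compact_absorbed (C : set F) V : compact C -> nbhs 0 V ->
  \forall t \near (0 : K^o), forall c, C c -> V (t *: c).
Proof.
move=> /compact_near_coveringP cC V0.
apply: (cC K^o (nbhs (0 : K^o)) (fun t c => V (t *: c))) => x Cx.
have /= := @scale_continuous K F (0, x) V; rewrite scale0r => /(_ V0).
move=> [[A B] /= [A0 Bx] AB]; exists (B, A) => //= -[c t] /= [Bc At].
exact: (AB (t, c)).
Qed.

End TvsFacts.

(* Continuous k-linear maps; [b] selects the topology that the type carries. *)
Definition clin_pred (K : numFieldType) (k : nat) (E F : tvsType K) :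
    {pred tpow k E -> F} :=
  fun g => `[< continuous g /\ multilinear g >].

Record clin (b : bornology) (K : numFieldType) (k : nat) (E F : tvsType K) :=
  Clin { clin_val :> tpow k E -> F ; _ : clin_val \in @clin_pred K k E F }.

HB.instance Definition _ b K k E F := [isSub for @clin_val b K k E F].
HB.instance Definition _ b K k E F := [Choice of @clin b K k E F by <:].

Section ClinModule.
Context (K : numFieldType) (k : nat) (E F : tvsType K).

Lemma clin_pred_submod : submod_closed (@clin_pred K k E F).
Proof.
split.
  apply/asboolP; split; first exact: (@cst_continuous (tpow k E) F 0).
  by move=> i y a u v; rewrite scaler0 addr0.
move=> a f g /asboolP[cf mf] /asboolP[cg mg]; apply/asboolP; split.
  move=> x; apply: (@continuous2_cvg _ F F F (nbhs x) _ (fun z => a *: f z) g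
     (fun u v => u + v)) => //.
  - exact: (@add_continuous F (a *: f x, g x)).
  - apply: (@continuous2_cvg _ K^o F F (nbhs x) _ (fun=> a) f
      (fun u v => u *: v)) => //.
    + exact: (@scale_continuous K F (a, f x)).
    + exact: cvg_cst.
    + exact: cf.
  - exact: cg.
move=> i y c u v; rewrite /= !fctE mf mg !scalerDr !scalerA addrACA.
by rewrite (mulrC a c).
Qed.

HB.instance Definition _ :=
  GRing.isSubmodClosed.Build K _ (@clin_pred K k E F) clin_pred_submod.

End ClinModule.

HB.instance Definition _ b K k E F :=
  [SubChoice_isSubLmodule of @clin b K k E F by <:].

Section ClinTheory.
Context (K : numFieldType) (k : nat) (E F : tvsType K).

Lemma clin_continuous b (g : @clin b K k E F) : continuous g.
Proof. by case: g => f /= /asboolP[]. Qed.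

Lemma clin_multilinear b (g : @clin b K k E F) : multilinear g.
Proof. by case: g => f /= /asboolP[]. Qed.

Lemma multilinear_scale (f : tpow k E -> F) (c : K) (y : tpow k E) :
  multilinear f -> f (c *: y) = c ^+ k *: f y.
Proof.
move=> mf; pose z m : tpow k E := fun i => if (i < m)%N then c *: y i else y i.
have fZ m : (m <= k)%N -> f (z m) = c ^+ m *: f y.
  elim: m => [_|m IH mk].
    by rewrite expr0 scale1r; congr f; apply/funext => i; rewrite /z ltn0.
  rewrite exprS -scalerA -IH 1?ltnW//.
  have -> : z m.+1 = tset (z m) (Ordinal mk) (c *: y (Ordinal mk) + 0).
    apply/funext => i; rewrite addr0 /tset /z ltnS leq_eqVlt.
    by rewrite -val_eqE /=; case: eqP => [im|//]; congr (_ *: y _); exact/val_inj.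
  rewrite mf; have -> : f (tset (z m) (Ordinal mk) 0) = 0.
    have := mf (Ordinal mk) (z m) (-1) 0 0.
    by rewrite scaler0 addr0 scaleN1r addNr.
  rewrite addr0; congr (_ *: f _); apply/funext => i; rewrite /tset /z.
  by case: eqP => [->|//]; rewrite ltnn.
by rewrite -fZ//; congr f; apply/funext => i; rewrite /z ltn_ord.
Qed.

End ClinTheory.

Section ClinTopology.
Context (b : bornology) (K : numFieldType) (k : nat) (E F : tvsType K).
Local Notation L := (@clin b K k E F).
Implicit Types (g h : L) (B : set (tpow k E)) (V : set F) (A : set L).

(* Uniform convergence on the compact (bounded) subsets of E^k, through the
   0-neighbourhoods of F. The uniform structure of a tvsType only has to induce
   its topology and need not be translation invariant, so that the topology of
   [{family _, _ -> _}] could be a different one. *)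
Definition clin_nbhs g : set_system L :=
  [set A : set L | exists B V, [/\ in_bornology b B, nbhs 0 V &
    [set h : L | forall y, B y -> V (h y - g y)] `<=` A]].

HB.instance Definition _ := hasNbhs.Build L clin_nbhs.

Lemma in_bornology0 : in_bornology b (set0 : set (tpow k E)).
Proof. case: b => /= [|V _]; first exact: compact0.
by exists 1 => // t _ x. Qed.

Lemma in_bornologyU (B B' : set (tpow k E)) :
  in_bornology b B -> in_bornology b B' -> in_bornology b (B `|` B').
Proof.
case: b => /= [|cB cB' V V0]; first exact: compactU.
have [r r0 Br] := cB V V0; have [s s0 Bs] := cB' V V0.
exists (r + s) => [|t rst]; first exact: addr_gt0.
move=> x [/Br|/Bs]; apply.
  by apply: le_trans rst; rewrite lerDl ltW.
by apply: le_trans rst; rewrite lerDr ltW.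
Qed.

Lemma clin_absorbed g B V : in_bornology b B -> nbhs 0 V ->
  \forall t \near (0 : K^o), forall y, B y -> V (t *: g y).
Proof.
case: b g => /= g Bb V0.
  have cgB : compact (g @` B).
    apply: continuous_compact => //; apply: continuous_subspaceT.
    exact: clin_continuous.
  by apply: filterS (compact_absorbed cgB V0) => t + y By; apply; exists y.
have /= := @scale_continuous K F (0, g 0) V; rewrite scale0r => /(_ V0).
move=> [[A N] /= [A0 Ng] AN].
have [r r0 /(_ r)] := Bb (g @^-1` N) (@clin_continuous _ _ _ _ _ g 0 N Ng).
rewrite (ger0_norm (ltW r0)) => /(_ (lexx r)) rB.
have : \forall t \near (0 : K^o), A (t * r ^+ k).
  have /= := @scale_continuous K K^o (0, r ^+ k) A; rewrite scale0r => /(_ A0).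
  move=> [[A1 A2] /= [A10 A2r] A12].
  by apply: filterS A10 => t A1t; apply: (A12 (t, _)); split=> //; exact: nbhs_singleton.
apply: filterS => t At y /rB[x Nx <-].
rewrite multilinear_scale; last exact: clin_multilinear.
by rewrite scalerA; exact: (AN (_, _)).
Qed.

Lemma clin_nbhs_filter g : ProperFilter (nbhs g).
Proof.
split.
  move=> [B [V [_ V0 /(_ g)]]] /=; apply => y _.
  by rewrite subrr; exact: nbhs_singleton.
split.
- exists set0, setT; split=> //; first exact: in_bornology0.
  exact: filterT.
- move=> P Q [B [V [bB V0 BP]]] [B' [V' [bB' V'0 BQ]]].
  exists (B `|` B'), (V `&` V'); split; first exact: in_bornologyU.
    exact: filterI.
  by move=> h hV; split; [apply: BP|apply: BQ] => y By; apply hV; [left|right].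
- move=> P Q PQ [B [V [bB V0 BP]]]; exists B, V; split=> //.
  exact: subset_trans PQ.
Qed.

Lemma clin_nbhs_singleton g A : nbhs g A -> A g.
Proof.
move=> [B [V [_ V0]]]; apply => y _.
by rewrite subrr; exact: nbhs_singleton.
Qed.

Lemma clin_nbhs_nbhs g A : nbhs g A -> nbhs g (nbhs^~ A).
Proof.
move=> [B [V [bB V0 BA]]]; have [W W0 WV] := nbhs0_add V0.
exists B, W; split=> // h hW; exists B, W; split=> // h' h'W.
apply: BA => y By; rewrite -(subrK (h y) (h' y)) -addrA.
by apply: WV; [exact: h'W|exact: hW].
Qed.

HB.instance Definition _ := Nbhs_isNbhsTopological.Build L
  clin_nbhs_filter clin_nbhs_singleton clin_nbhs_nbhs.

Lemma clin_add_continuous : continuous (fun x : L * L => x.1 + x.2).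
Proof.
move=> [g h] A [B [V [bB V0 BA]]]; have [W W0 WV] := nbhs0_add V0.
exists ([set g' : L | forall y, B y -> W (g' y - g y)],
        [set h' : L | forall y, B y -> W (h' y - h y)]).
  by split; exists B, W; split.
move=> [g' h'] [/= g'W h'W]; apply: BA => y By.
rewrite /= opprD addrACA.
by apply: WV; [exact: g'W|exact: h'W].
Qed.

Lemma clin_scale_continuous : continuous (fun z : K^o * L => z.1 *: z.2).
Proof.
move=> [a g] A [B [V [bB V0 BA]]]; have [W W0 WV] := nbhs0_add V0.
have [W' W'0 W'W] := nbhs0_scale a W0.
have gW := clin_absorbed g bB W0.
have {}gW : \forall t \near (a : K^o), forall y, B y -> W ((t - a) *: g y).
  have /= := @add_continuous K^o (a, - a)
    [set t | forall y, B y -> W (t *: g y)].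
  rewrite subrr => /(_ gW)[[A1 A2] /= [A1a A2a] A12].
  apply: filterS A1a => t A1t; apply: (A12 (t, - a)); split=> //.
  exact: nbhs_singleton.
exists ([set t : K^o | (forall w, W' w -> W (t *: w)) /\
                       (forall y, B y -> W ((t - a) *: g y))],
        [set h : L | forall y, B y -> W' (h y - g y)]).
  split; first by apply: filterS2 W'W gW => t ? ?; split.
  by exists B, W'; split.
move=> [t h] [/= [tW' tW] hW']; apply: BA => y By.
have -> : (t *: h) y - (a *: g) y = t *: (h y - g y) + (t - a) *: g y.
  by rewrite scalerBr scalerBl addrA subrK.
by apply: WV; [apply: tW'; exact: hW'|exact: tW].
Qed.

Lemma clin_locally_convex : exists2 B : set_system L,
  (forall A, A \in B -> convex_set A) & basis B.
Proof.
exists [set A | open A /\ convex_set A]; first by move=> A /set_mem[].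
split; first by move=> A [].
move=> g A [B [V [bB V0 BA]]]; have [W W0 [Wc WV]] := nbhs0_convex V0.
move/convex_setP in Wc.
pose A0 := [set h : L | forall y, B y -> W (h y - g y)].
have A0c (h h' : L) (l : {i01 K}) : A0 h -> A0 h' ->
    A0 (l%:num *: h + (1 - l%:num) *: h').
  move=> hA h'A y By; have := Wc _ _ l (hA y By) (h'A y By).
  rewrite !scalerBr addrACA -opprD -scalerDl.
  by rewrite [_ + (1 - _)]addrC subrK scale1r.
exists [set h | nbhs h A0]; last first.
  move=> h /clin_nbhs_singleton hA; apply: BA => y By.
  by apply: WV; exact: hA.
split; last by exists B, W; split.
split; first by rewrite openE => h; exact: clin_nbhs_nbhs.
apply/convex_setP => h h' l [B1 [V1 [bB1 V10 BA1]]] [B2 [V2 [bB2 V20 BA2]]].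
exists (B1 `|` B2), (V1 `&` V2); split; first exact: in_bornologyU.
  exact: filterI.
set m := l%:num *: h + (1 - l%:num) *: h' => n nV.
have -> : n = l%:num *: (h + (n - m)) + (1 - l%:num) *: (h' + (n - m)).
  rewrite -[LHS](subrK m); move: (n - m) => d.
  rewrite !(scalerDr _ _ d) addrACA -scalerDl -/m.
  by rewrite [_ + (1 - _)]addrC subrK scale1r addrC.
have dE (u : L) y : (u + (n - m)) y - u y = n y - m y.
  have -> : (u + (n - m)) y = u y + (n y - m y) by [].
  by rewrite addrAC subrr add0r.
apply: A0c; [apply: BA1 => y By|apply: BA2 => y By].
  by rewrite /= dE; have [] := nV y (or_introl By).
by rewrite /= dE; have [] := nV y (or_intror By).
Qed.

(* Despite its name, this factory only builds the uniform structure. *)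
HB.instance Definition _ := PreTopologicalLmod_isTvs.Build K L
  clin_add_continuous clin_scale_continuous clin_locally_convex.
HB.instance Definition _ := PreTopologicalNmodule_isTopologicalNmodule.Build L
  clin_add_continuous.
HB.instance Definition _ := TopologicalNmodule_isTopologicalLmodule.Build K L
  clin_scale_continuous.
HB.instance Definition _ := Uniform_isTvs.Build K L clin_locally_convex.

End ClinTopology.

(* E_C, as pairs (x, y) = x + iy with the product topology *)
Definition complexification (R : realType) (E : tvsType R) : Type :=
  (E * E)%type.

HB.instance Definition _ (R : realType) (E : tvsType R) :=
  GRing.Zmodule.copy (complexification E) (E * E)%type.

HB.instance Definition _ (R : realType) (E : tvsType R) :=
  Topological.copy (complexification E) (E * E)%type.

Section Complexification.
Context (R : realType) (E : tvsType R).
Local Notation EC := (complexification E).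

Definition cscale (z : R[i]) (w : EC) : EC :=
  (complex.Re z *: w.1 - complex.Im z *: w.2,
   complex.Im z *: w.1 + complex.Re z *: w.2).

Lemma cscaleA a b v : cscale a (cscale b v) = cscale (a * b) v.
Proof.
have h1 (A B C D : E) : A - B - (C + D) = A - C - (B + D).
  by rewrite !opprD addrACA.
have h2 (A B C D : E) : A - B + (C + D) = C + A + (D - B).
  by rewrite addrC addrACA.
case: a b v => [a a'] [b b'] [x y]; rewrite /cscale /=.
rewrite !scalerDr !scalerN !scalerBl !scalerDl !scalerA; congr (_, _).
  exact: h1.
exact: h2.
Qed.

Lemma cscale1 : left_id 1 cscale.
Proof. by move=> [x y]; rewrite /cscale /= !scale1r !scale0r subr0 add0r. Qed.

Lemma cscaleDr : right_distributive cscale +%R.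
Proof.
move=> a [x y] [x' y']; rewrite /cscale /= !scalerDr opprD.
by rewrite addrACA [X in (_, X)]addrACA.
Qed.

Lemma cscaleDl v : {morph cscale^~ v : a b / a + b}.
Proof.
move: v => [x y] [a a'] [b b']; rewrite /cscale /= !scalerDl opprD.
by rewrite addrACA [X in (_, X)]addrACA.
Qed.

HB.instance Definition _ := GRing.Zmodule_isLmodule.Build R[i] EC
  cscaleA cscale1 cscaleDr cscaleDl.

Lemma normc_ge_Im (x : R[i]) : `|complex.Im x|%:C <= `|x|.
Proof.
by case: x => a b; simpc; rewrite -sqrtr_sqr ler_wsqrtr // lerDr sqr_ge0.
Qed.

Lemma Re_continuous : continuous (fun z : R[i]^o => complex.Re z : R^o).
Proof.
move=> z A /nbhs_ballP[e /= e0 eA]; apply/nbhs_ballP.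
exists e%:C => /=; first by rewrite ltcR.
move=> t; rewrite -ball_normE /= => zt; apply: eA; rewrite -ball_normE /=.
rewrite -ltcR; apply: le_lt_trans zt.
by have := normc_ge_Re (z - t); case: z t => ? ? [].
Qed.

Lemma Im_continuous : continuous (fun z : R[i]^o => complex.Im z : R^o).
Proof.
move=> z A /nbhs_ballP[e /= e0 eA]; apply/nbhs_ballP.
exists e%:C => /=; first by rewrite ltcR.
move=> t; rewrite -ball_normE /= => zt; apply: eA; rewrite -ball_normE /=.
rewrite -ltcR; apply: le_lt_trans zt.
by have := normc_ge_Im (z - t); case: z t => ? ? [].
Qed.

Lemma complexification_add_continuous :
  continuous (fun x : EC * EC => x.1 + x.2).
Proof. exact: (@add_continuous (E * E)%type). Qed.

Lemma complexification_scale_continuous :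
  continuous (fun z : R[i]^o * EC => z.1 *: z.2).
Proof.
pose T := (R[i]^o * EC)%type.
have cZ (f : R[i]^o -> R^o) (g : EC -> E) : continuous f -> continuous g ->
    continuous (fun z : T => f z.1 *: g z.2).
  move=> cf cg z; apply: (@continuous2_cvg _ R^o E E (nbhs z) _
    (fun z => f z.1) (fun z => g z.2) (fun u v => u *: v)).
  - exact: (@scale_continuous R E (f z.1, g z.2)).
  - by apply: (cvg_comp _ _ (@cvg_fst _ _ _ _ _)); exact: cf.
  - by apply: (cvg_comp _ _ (@cvg_snd _ _ _ _ _)); exact: cg.
have c1 : continuous (fun w : EC => w.1 : E) by move=> w; exact: cvg_fst.
have c2 : continuous (fun w : EC => w.2 : E) by move=> w; exact: cvg_snd.
move=> z.
have cl : (fun z : T => complex.Re z.1 *: z.2.1 - complex.Im z.1 *: z.2.2) @ z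
    --> complex.Re z.1 *: z.2.1 - complex.Im z.1 *: z.2.2.
  apply: (@continuous2_cvg _ E E E (nbhs z) _ (fun z : T => _ *: _)
    (fun z : T => _ *: _) (fun u v => u - v)).
  - exact: (@sub_continuous E (_, _)).
  - exact: (cZ _ _ Re_continuous c1).
  - exact: (cZ _ _ Im_continuous c2).
have cr : (fun z : T => complex.Im z.1 *: z.2.1 + complex.Re z.1 *: z.2.2) @ z
    --> complex.Im z.1 *: z.2.1 + complex.Re z.1 *: z.2.2.
  apply: (@continuous2_cvg _ E E E (nbhs z) _ (fun z : T => _ *: _)
    (fun z : T => _ *: _) (fun u v => u + v)).
  - exact: (@add_continuous E (_, _)).
  - exact: (cZ _ _ Im_continuous c1).
  - exact: (cZ _ _ Re_continuous c2).
exact: (cvg_pair cl cr).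
Qed.

Lemma complexification_locally_convex : exists2 B : set_system EC,
  (forall A, A \in B -> convex_set A) & basis B.
Proof.
have [B Bc Bb] := @locally_convex R (E * E)%type.
exists B => // A /Bc /convex_setP cA; apply/convex_setP => x y l Ax Ay.
have : (0 <= l%:num :> R[i]) && (l%:num <= 1 :> R[i]) by rewrite ge0 le1.
case: (l%:num) => r s; rewrite !lecE /=.
move=> /andP[/andP[/eqP s0 r0] /andP[_ r1]].
have := cA x y (Itv01 r0 r1) Ax Ay; congr (A _).
case: x y {Ax Ay} => [x x'] [y y'].
rewrite [RHS]/GRing.add /= /GRing.scale /= /cscale /=.
by rewrite s0 !(subr0, scale0r, add0r).
Qed.

HB.instance Definition _ := PreTopologicalLmod_isTvs.Build R[i] EC
  complexification_add_continuous complexification_scale_continuous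
  complexification_locally_convex.
HB.instance Definition _ := PreTopologicalNmodule_isTopologicalNmodule.Build EC
  complexification_add_continuous.
HB.instance Definition _ := TopologicalNmodule_isTopologicalLmodule.Build R[i]
  EC complexification_scale_continuous.
HB.instance Definition _ := Uniform_isTvs.Build R[i] EC
  complexification_locally_convex.

End Complexification.

(* A map U -> F on an open set U is represented by a total function E -> F, of
   which only the values on U matter. *)
Section DirectionalDerivatives.
Context (K : numFieldType) (E F : tvsType K).
Implicit Types (f : E -> F) (U : set E) (x v : E).

Definition has_ddir f x v (l : F) : Prop :=
  (fun t : K^o => t^-1 *: (f (x + t *: v) - f x)) @ (0 : K^o)^' --> l.

(* D_v f; the value is 0 where the limit does not exist *)
Definition ddir v f : E -> F := fun x => xget 0 [set l | has_ddir f x v l].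

(* foldl turns [:: y1; ...; yj] into D_{yj} (... (D_{y1} f)) *)
Definition dmap (j : nat) f (x : E) (y : tpow j E) : F :=
  foldl (fun g v => ddir v g) f [seq y i | i <- enum 'I_j] x.

Fixpoint ddir_exist U f (ys : seq E) : Prop :=
  if ys is v :: ys' then
    (forall x, U x -> exists l, has_ddir f x v l) /\
    ddir_exist U (ddir v f) ys'
  else True.

Definition dmap_exists U (j : nat) f (y : tpow j E) : Prop :=
  ddir_exist U f [seq y i | i <- enum 'I_j].

(* f^(k)(x) = d^k f (x, .); the value is 0 where d^k f (x, .) is not
   continuous and k-linear *)
Definition fder (b : bornology) (k : nat) f (x : E) : clin b k E F :=
  insubd (0 : clin b k E F) (@dmap k f x).

End DirectionalDerivatives.

Variant smoothness := Finite of nat | Smooth | Analytic.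

Definition leS (n : nat) (r : smoothness) : bool :=
  if r is Finite m then (n <= m)%N else true.

Definition subS (r : smoothness) (n : nat) : smoothness :=
  if r is Finite m then Finite (m - n) else r.

Definition homogeneous_poly (K : numFieldType) (E F : tvsType K) (n : nat)
    (p : E -> F) : Prop :=
  exists2 g : tpow n E -> F, multilinear g & forall y, p y = g (fun=> y).

Definition complex_analytic (R : realType) (E F : tvsType R[i]) (U : set E)
    (f : E -> F) : Prop :=
  {within U, continuous f} /\
  forall x, U x -> exists Y : set E,
    [/\ nbhs 0 Y, (forall y, Y y -> U (x + y)) &
      exists beta : nat -> E -> F,
        (forall n, continuous (beta n) /\ homogeneous_poly n (beta n)) /\
        (forall y, Y y -> series (fun n => beta n y) @ \oo --> f (x + y))].

Definition real_analytic (R : realType) (E F : tvsType R) (U : set E)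
    (f : E -> F) : Prop :=
  exists (W : set (complexification E))
         (g : complexification E -> complexification F),
    [/\ open W, (forall x, U x -> W (x, 0)), complex_analytic W g &
      forall x, U x -> g (x, 0) = (f x, 0)].

(* [scalar_field R K] says that K is the field R or the field R[i]; the notion
   of analyticity depends on which. *)
Variant scalar_field (R : realType) : numFieldType -> Type :=
  | RealScalars : scalar_field R R
  | ComplexScalars : scalar_field R R[i].

Definition analytic (R : realType) (K : numFieldType) (s : scalar_field R K) :
    forall E F : tvsType K, set E -> (E -> F) -> Prop :=
  match s in scalar_field _ K0
    return forall E F : tvsType K0, set E -> (E -> F) -> Prop with
  | RealScalars => @real_analytic R
  | ComplexScalars => @complex_analytic R
  end.

Definition Cmap (R : realType) (K : numFieldType) (s : scalar_field R K)
    (r : smoothness) (E F : tvsType K) (U : set E) (f : E -> F) : Prop :=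
  if r is Analytic then analytic s U f else
    {within U, continuous f} /\
    forall j : nat, (0 < j)%N -> leS j r ->
      (forall y : tpow j E, dmap_exists U f y) /\
      {within U `*` setT,
        continuous (fun p : E * tpow j E => dmap f p.1 p.2)}.

(* Main.v *)
(* The finite-order part rests on the mean value inequality with respect to a
   continuous seminorm. As d^(n+1)f is jointly continuous, the difference
   quotients of x |-> d^n f(x, .) converge uniformly on compact sets. On a
   bounded set B, joint continuity only bounds d^(n+1)f near (x, 0), hence, by
   homogeneity, on neighbourhoods of x times B; the mean value inequality turns
   this bound into continuity of x |-> d^n f(x, .) uniformly on B, at the price
   of one order of differentiability.

   For complex analytic f the same scheme works once f is known to be smooth.
   In a possibly incomplete F no integral is available, so Cauchy's estimate
   for the homogeneous parts of f is obtained by averaging over roots of unity.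
   It shows that the series of f at x can be differentiated termwise on a ball
   that does not depend on the direction v, so that D_v f is again analytic, and
   that the Taylor series of f^(k) converges uniformly on B. A real analytic f
   is the restriction of a complex analytic g, and f^(k) is then the restriction
   of g^(k), composed with the continuous linear map that restricts complex
   k-linear maps on the complexifications to the real spaces. *)

(* Real and complex scalars are treated together through real-valued continuous seminorms ([csn]),
   so that estimates become inequalities in [R]. The two topologies on k-linear maps are separated
   only by [unif_cont_derivs]; once it holds, the derivatives of f^(k) are computed without looking
   at the bornology. For analytic maps the obstacle is the order of quantifiers. The ball on which a
   series converges must serve every seminorm [p] of the target and every [v] in a bounded set,
   while a neighbourhood on which [p] of f is bounded depends on [p]. The ball is therefore taken
   from the seminorm [q] of the given expansion alone, shrunk by 16 for each derivative, and the
   bounds for [p] come from compact complex discs through the points of that ball. In an incomplete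
   F the termwise differentiated series is not known to converge beforehand. The existence of D_v f
   at x + u comes from the expansion centred at x + u; the series centred at x is then shown to
   converge to this value. *)
Require Import Defs.
From mathcomp Require Import all_boot all_order all_algebra.
From mathcomp Require Import separable cyclotomic cyclic.
From mathcomp Require Import ring lra zify complex.
From mathcomp Require Import boolp classical_sets functions reals
  interval_inference topology pseudometric_normed_Zmodule tvs
  sequences normed_module.

Set Implicit Arguments.
Unset Strict Implicit.
Unset Printing Implicit Defensive.

Import Order.TTheory GRing.Theory Num.Theory.
Import numFieldTopology.Exports.

Local Open Scope classical_set_scope.
Local Open Scope ring_scope.

(** * Linear identities *)

(* [module] decides linear identities over a module by comparing, with [ring],
   the coefficients of each vector. *)
Section ModuleTactic.
Context (K : comPzRingType) (V : lmodType K).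

Inductive mexp : Type :=
  MVar of nat | MZero | MAdd of mexp & mexp | MOpp of mexp
| MScale of K & mexp.

Fixpoint meval (env : seq V) (e : mexp) : V :=
  match e with
  | MVar i => nth 0 env i
  | MZero => 0
  | MAdd e1 e2 => meval env e1 + meval env e2
  | MOpp e1 => - meval env e1
  | MScale a e1 => a *: meval env e1
  end.

Fixpoint mcoef (i : nat) (e : mexp) : K :=
  match e with
  | MVar j => if i == j then 1 else 0
  | MZero => 0
  | MAdd e1 e2 => mcoef i e1 + mcoef i e2
  | MOpp e1 => - mcoef i e1
  | MScale a e1 => a * mcoef i e1
  end.

Fixpoint mcoef_eq (n : nat) (e1 e2 : mexp) : Prop :=
  if n is m.+1 then mcoef m e1 = mcoef m e2 /\ mcoef_eq m e1 e2 else True.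

Lemma mevalE env e :
  meval env e = \sum_(i < size env) mcoef i e *: nth 0 env i.
Proof.
elim: e => [j||e1 IH1 e2 IH2|e1 IH1|a e1 IH1] /=.
- have [js|sj] := ltnP j (size env).
    rewrite (bigD1 (Ordinal js)) //= eqxx scale1r big1 ?addr0// => i.
    by rewrite -val_eqE /= => /negPf ->; rewrite scale0r.
  rewrite nth_default// big1// => i _; case: eqP => [ij|]; last by rewrite scale0r.
  by move: sj; rewrite -ij leqNgt ltn_ord.
- by rewrite big1// => i _; rewrite scale0r.
- by rewrite IH1 IH2 -big_split; apply: eq_bigr => i _; rewrite scalerDl.
- by rewrite IH1 -sumrN; apply: eq_bigr => i _; rewrite scaleNr.
- by rewrite IH1 scaler_sumr; apply: eq_bigr => i _; rewrite scalerA.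
Qed.

Lemma meval_eq env e1 e2 : mcoef_eq (size env) e1 e2 ->
  meval env e1 = meval env e2.
Proof.
rewrite !mevalE => h; apply: eq_bigr => -[i /= ie] _; congr (_ *: _).
elim: (size env) h ie => [//|n IH] /= [hn h].
by rewrite ltnS leq_eqVlt => /predU1P[->//|]; exact: IH.
Qed.

End ModuleTactic.

(** The nested [match goal] runs [unify] while the index is being computed; a failure selects the
    next branch. Atoms are thus identified up to unification, not only syntactically. *)
Ltac mfind env x :=
  match env with
  | ?y :: ?env' =>
      match goal with
      | _ => let _ := match goal with _ => unify x y end in constr:(0%N)
      | _ => let n := mfind env' x in constr:(n.+1)
      end
  end.

Ltac matoms env t :=
  match t with
  | (?x + ?y)%R => let e := matoms env x in matoms e y
  | (- ?x)%R => matoms env x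
  | (_ *: ?x)%R => matoms env x
  | 0%R => env
  | _ => match goal with
         | _ => let n := mfind env t in env
         | _ => constr:(t :: env)
         end
  end.

Ltac mreify K env t :=
  match t with
  | (?x + ?y)%R => let a := mreify K env x in let b := mreify K env y in
                   constr:(@MAdd K a b)
  | (- ?x)%R => let a := mreify K env x in constr:(@MOpp K a)
  | (?c *: ?x)%R => let a := mreify K env x in constr:(@MScale K c a)
  | 0%R => constr:(@MZero K)
  | _ => let n := mfind env t in constr:(@MVar K n)
  end.

Ltac module_goals K :=
  match goal with
  | |- @eq ?T ?l ?r =>
      let e0 := matoms (@nil T) l in
      let env := matoms e0 r in
      let a := mreify K env l in
      let b := mreify K env r in
      apply: (@meval_eq K _ env a b); rewrite /=; repeat split
  end.

Ltac module K := module_goals K; try by [|ring|field].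

(** * Continuous seminorms *)

(* What the real and the complex scalars share: a copy of R inside K and an
   R-valued absolute value. *)
Record real_scalars (R : realType) (K : numFieldType) := RealScalarsOf {
  emb : {rmorphism R -> K};
  nm : K -> R;
  emb_le : forall a b, (emb a <= emb b) = (a <= b);
  emb_nm : forall a, emb (nm a) = `|a| }.
Arguments nm : simpl never.
Arguments emb : simpl never.

Section Scalars.
Context (R : realType) (K : numFieldType) (S : real_scalars R K).
Local Notation nm := (nm S).
Local Notation emb := (emb S).

Lemma emb_lt a b : (emb a < emb b) = (a < b).
Proof. by rewrite !lt_neqAle emb_le fmorph_eq. Qed.

Lemma emb_ge0 a : (0 <= emb a) = (0 <= a).
Proof. by rewrite -(rmorph0 emb) emb_le. Qed.

Lemma emb_gt0 a : (0 < emb a) = (0 < a).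
Proof. by rewrite -(rmorph0 emb) emb_lt. Qed.

Lemma emb_inj : injective emb. Proof. exact: fmorph_inj. Qed.

Lemma nm_ge0 a : 0 <= nm a.
Proof. by rewrite -emb_ge0 emb_nm. Qed.

Lemma nmM a b : nm (a * b) = nm a * nm b.
Proof. by apply: emb_inj; rewrite rmorphM !emb_nm normrM. Qed.

Lemma nm1 : nm 1 = 1.
Proof. by apply: emb_inj; rewrite rmorph1 emb_nm normr1. Qed.

Lemma nm0 : nm 0 = 0.
Proof. by apply: emb_inj; rewrite rmorph0 emb_nm normr0. Qed.

Lemma nmN a : nm (- a) = nm a.
Proof. by apply: emb_inj; rewrite !emb_nm normrN. Qed.

Lemma nmX a n : nm (a ^+ n) = nm a ^+ n.
Proof. by apply: emb_inj; rewrite rmorphXn !emb_nm normrX. Qed.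

Lemma nmV a : nm a^-1 = (nm a)^-1.
Proof. by apply: emb_inj; rewrite fmorphV !emb_nm normfV. Qed.

Lemma nmD a b : nm (a + b) <= nm a + nm b.
Proof. by rewrite -(emb_le S) rmorphD !emb_nm ler_normD. Qed.

Lemma nm_gt0 a : (0 < nm a) = (a != 0).
Proof. by rewrite -emb_gt0 emb_nm normr_gt0. Qed.

Lemma emb_pos (e : K) : 0 < e -> exists2 d : R, 0 < d & emb d = e.
Proof.
move=> e0; exists (nm e); first by rewrite -emb_gt0 emb_nm gtr0_norm.
by rewrite emb_nm gtr0_norm.
Qed.

Lemma nm_emb a : nm (emb a) = `|a|.
Proof.
apply: emb_inj; rewrite emb_nm.
have [a0|/ltW a0] := leP 0 a; first by rewrite ger0_norm ?emb_ge0// ger0_norm.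
rewrite -normrN -rmorphN ger0_norm; first by rewrite ler0_norm.
by rewrite emb_ge0 oppr_ge0.
Qed.

Lemma emb_natr n : emb n%:R = n%:R. Proof. exact: rmorph_nat. Qed.

Lemma nm_nat n : nm n%:R = n%:R.
Proof. by rewrite -emb_natr nm_emb ger0_norm. Qed.

Lemma nbhs_nmP (c : K) (P : set K) :
  nbhs (c : K^o) P <-> exists2 d, 0 < d & forall t, nm (t - c) < d -> P t.
Proof.
split=> [/nbhs_ballP[e /= e0 eP]|[d d0 dP]].
  have [d d0 de] := emb_pos e0; exists d => // t td; apply: eP.
  by rewrite -ball_normE /= distrC -(emb_nm S) -de emb_lt.
apply/nbhs_ballP; exists (emb d) => /=; first by rewrite emb_gt0.
by move=> t; rewrite -ball_normE /= distrC -(emb_nm S) emb_lt => /dP.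
Qed.

Lemma dnbhs0_nmP (P : set K) : nbhs (0 : K^o)^' P <->
  exists2 d, 0 < d & forall t, t != 0 -> nm t < d -> P t.
Proof.
split=> [/nbhs_nmP[d d0 dP]|[d d0 dP]].
  by exists d => // t t0 td; apply: dP => //; rewrite subr0.
by apply/nbhs_nmP; exists d => // t; rewrite subr0 => td t0; exact: dP.
Qed.

End Scalars.

(** Continuity is encoded by the open unit ball being a 0-neighbourhood; scaling ([sn_ball0]) and
    translation ([sn_ball]) give all other balls. The values lie in [R] even for complex scalars. *)
Record csn (R : realType) (K : numFieldType) (S : real_scalars R K)
    (E : tvsType K) := Csn {
  sn :> E -> R;
  snD : forall x y, sn (x + y) <= sn x + sn y;
  snZ : forall a x, sn (a *: x) = nm S a * sn x;
  sn_nbhs : nbhs 0 [set x | sn x < 1] }.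

Section Seminorms.
Context (R : realType) (K : numFieldType) (S : real_scalars R K)
  (E : tvsType K).
Local Notation nm := (nm S).
Local Notation emb := (emb S).
Local Notation csn := (csn S E).
Implicit Types (p q : csn) (x y : E).

Lemma sn0 p : p 0 = 0.
Proof. by rewrite -(scale0r 0) snZ nm0 mul0r. Qed.

Lemma snN p x : p (- x) = p x.
Proof. by rewrite -scaleN1r snZ nmN nm1 mul1r. Qed.

Lemma sn_ge0 p x : 0 <= p x.
Proof. by have := snD p x (- x); rewrite subrr sn0 snN; lra. Qed.

Lemma snB p x y : p (x - y) <= p x + p y.
Proof. by rewrite -(snN p y) snD. Qed.

Lemma snBC p x y : p (x - y) = p (y - x).
Proof. by rewrite -snN opprB. Qed.

Lemma sn_tri p x y z : p (x - z) <= p (x - y) + p (y - z).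
Proof. by rewrite -{1}(subrK y x) -addrA snD. Qed.

Lemma sn_leD p x y : p x <= p (x - y) + p y.
Proof. by rewrite -{1}(subrK y x) snD. Qed.

Lemma sn_sum p (I : Type) (r : seq I) (P : pred I) (f : I -> E) :
  p (\sum_(i <- r | P i) f i) <= \sum_(i <- r | P i) p (f i).
Proof.
elim/big_ind2: _ => [|a b c d ab cd|//]; first by rewrite sn0.
by apply: le_trans (snD _ _ _) _; exact: lerD.
Qed.

Lemma csn_scale p (c : R) : 0 < c -> exists q, forall x, q x = c * p x.
Proof.
move=> c0; unshelve eexists (@Csn _ _ S E (fun x => c * p x) _ _ _) => //.
- by move=> x y; rewrite -mulrDr ler_pM2l ?snD.
- by move=> a x /=; rewrite snZ mulrCA.
- have := @scale_continuous K E (emb c, 0) [set x | p x < 1].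
  rewrite /= scaler0 => /(_ (sn_nbhs p))[[A B] /= [Ac B0] AB].
  apply: filterS B0 => x Bx; have := AB (emb c, x); rewrite /= snZ nm_emb gtr0_norm//.
  by apply; split => //; exact: nbhs_singleton.
Qed.

Lemma csn_add p q : exists s : csn, forall x, s x = p x + q x.
Proof.
have [p2 p2E] := csn_scale p (ltr0Sn R 1).
have [q2 q2E] := csn_scale q (ltr0Sn R 1).
unshelve eexists (@Csn _ _ S E (fun x => p x + q x) _ _ _) => //.
- by move=> x y; rewrite addrACA lerD ?snD.
- by move=> a x /=; rewrite !snZ mulrDr.
- apply: filterS2 (sn_nbhs p2) (sn_nbhs q2) => x /=.
  by rewrite p2E q2E; lra.
Qed.

Lemma csn_max p q : exists s : csn, forall x, p x <= s x /\ q x <= s x.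
Proof.
have [s sE] := csn_add p q; exists s => x; rewrite sE.
by have := sn_ge0 p x; have := sn_ge0 q x; lra.
Qed.

Lemma sn_ball0 p (e : R) : 0 < e -> nbhs 0 [set x | p x < e].
Proof.
move=> e0; have [q qE] := csn_scale p (etrans (invr_gt0 e) e0).
by apply: filterS (sn_nbhs q) => x /=; rewrite qE mulrC ltr_pdivrMr// mul1r.
Qed.

Lemma sn_ball p (e : R) x : 0 < e -> nbhs x [set y | p (y - x) < e].
Proof.
move=> e0; have := nbhsT x (sn_ball0 p e0); apply: filterS => _ [y py <-] /=.
by rewrite addrAC subrr add0r.
Qed.

(** The balanced core of a convex 0-neighbourhood inside [V] works. Continuity of scalar
    multiplication at [(0, 0)] makes the core a 0-neighbourhood, and convexity survives because a
    scalar commutes with convex combinations. *)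
Lemma balanced_convex_nbhs (V : set E) : nbhs 0 V ->
  exists W : set E, [/\ nbhs 0 W, W `<=` V,
    (forall t w, nm t <= 1 -> W w -> W (t *: w)) &
    forall (l : R) x y, 0 <= l <= 1 -> W x -> W y ->
      W (emb l *: x + emb (1 - l) *: y)].
Proof.
move=> V0; have [W W0 [/convex_setP cW WV]] := nbhs0_convex V0.
exists [set w | forall t, nm t <= 1 -> W (t *: w)]; split.
- have := @scale_continuous K E (0, 0) W.
  rewrite /= scaler0 => /(_ W0)[[A B] /= [/(nbhs_nmP S)[d d0 dA] B0] AB].
  have d2 : 0 < d / 2 by lra.
  have B0' := nbhs0Z (r := emb (d / 2)) _ B0; apply: filterS (B0' _).
    move=> _ [b Bb <-] t t1; rewrite scalerA; apply: (AB (_, _)); split => //=.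
    apply: dA; rewrite subr0 nmM nm_emb ger0_norm; last by lra.
    apply: le_lt_trans (_ : 1 * (d / 2) < _); last by lra.
    by rewrite ler_pM2r.
  by rewrite gt_eqF// emb_gt0.
- by move=> w /(_ 1); rewrite scale1r nm1 => /(_ (lexx _)) /WV.
- move=> t w t1 Ww u u1; rewrite scalerA; apply: Ww; rewrite nmM.
  by apply: mulr_ile1 => //; exact: nm_ge0.
- move=> l x y /andP[l0 l1] Wx Wy t t1; rewrite scalerDr !scalerA ![t * _]mulrC.
  rewrite -!scalerA rmorphB rmorph1.
  have el0 : 0 <= emb l by rewrite emb_ge0.
  have el1 : emb l <= 1 by rewrite -(rmorph1 emb) emb_le.
  exact: (cW _ _ (Itv01 el0 el1) (Wx _ t1) (Wy _ t1)).
Qed.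

(* The Minkowski functional of a convex balanced 0-neighbourhood. *)
Lemma gauge (V : set E) : nbhs 0 V -> exists p, forall x, p x < 1 -> V x.
Proof.
move=> /balanced_convex_nbhs[W [W0 WV bW cW]].
pose A x := [set r : R | 0 < r /\ W (emb r^-1 *: x)].
have Aup x r s : A x r -> r <= s -> A x s.
  move=> [r0 Wr] rs; split; first exact: lt_le_trans rs.
  have s0 : 0 < s by apply: lt_le_trans rs.
  have -> : emb s^-1 *: x = emb (r / s) *: (emb r^-1 *: x).
    by rewrite scalerA -rmorphM mulrAC divff ?mul1r// gt_eqF.
  apply: bW Wr; rewrite nm_emb ger0_norm ?ler_pdivrMr ?mul1r//.
  by rewrite divr_ge0 // ltW.
have Ane x : A x !=set0.
  have := @scale_continuous K E (0, x) W.
  rewrite /= scale0r => /(_ W0)[[B C] /= [/(nbhs_nmP S)[d d0 dB] Cx] BC].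
  exists (2 / d); split; first by rewrite divr_gt0.
  apply: (BC (_, _)); split => /=; last exact: nbhs_singleton.
  by apply: dB; rewrite subr0 nm_emb invf_div ger0_norm; lra.
have lbA x : lbound (A x) 0 by move=> r [/ltW].
have infA x : has_inf (A x) by split=> //; exists 0; exact: lbA.
pose p x := inf (A x).
have p0 x : 0 <= p x by apply: lb_le_inf.
have ltA x r : p x < r -> A x r.
  by move=> /(inf_lt (Ane x))[s As /ltW]; exact: Aup.
have geA x r : A x r -> p x <= r.
  by move=> Ar; apply: ge_inf => //; exists 0; exact: lbA.
have pD x y : p (x + y) <= p x + p y.
  apply/ler_addgt0Pr => e e0.
  have [r0 Wr] := ltA x (p x + e / 2) ltac:(lra).
  have [s0 Ws] := ltA y (p y + e / 2) ltac:(lra).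
  set r := p x + e / 2 in r0 Wr; set s := p y + e / 2 in s0 Ws.
  have -> : p x + p y + e = r + s by rewrite /r /s; lra.
  apply: geA; split; first by lra.
  have -> : emb (r + s)^-1 *: (x + y) =
      emb (r / (r + s)) *: (emb r^-1 *: x)
      + emb (1 - r / (r + s)) *: (emb s^-1 *: y).
    rewrite !scalerA -!rmorphM scalerDr; congr (emb _ *: _ + emb _ *: _).
      by field; rewrite !gt_eqF //; lra.
    by field; rewrite !gt_eqF //; lra.
  apply: cW => //; apply/andP; split; first by rewrite divr_ge0; lra.
  by rewrite ler_pdivrMr; lra.
(* One inequality is enough: applied to [a^-1] and [a *: x], it gives the reverse one. *)
have pZle a x : a != 0 -> p (a *: x) <= nm a * p x.
  move=> a0; have na : 0 < nm a by rewrite nm_gt0.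
  apply/ler_addgt0Pr => e e0.
  have ena : 0 < e / nm a by rewrite divr_gt0.
  have [r0 Wr] := ltA x (p x + e / nm a) ltac:(lra).
  have -> : nm a * p x + e = nm a * (p x + e / nm a).
    by field; rewrite gt_eqF.
  apply: geA; split; first exact: mulr_gt0.
  move: (p x + e / nm a) r0 Wr => r r0 Wr.
  have -> : emb (nm a * r)^-1 *: (a *: x) =
      (emb (nm a)^-1 * a) *: (emb r^-1 *: x).
    by rewrite invfM rmorphM !scalerA; congr (_ *: _); rewrite mulrAC.
  by apply: bW Wr; rewrite nmM nm_emb ger0_norm ?mulVf// ?gt_eqF// invr_ge0 ltW.
have pZ a x : p (a *: x) = nm a * p x.
  have [->|a0] := eqVneq a 0.
    rewrite scale0r nm0 mul0r; apply/le_anti; rewrite p0 andbT.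
    apply/ler_addgt0Pr => e e0; rewrite add0r; apply: geA; split=> //.
    by rewrite scaler0; exact: nbhs_singleton.
  apply/le_anti; rewrite pZle//=.
  have := @pZle a^-1 (a *: x); rewrite invr_eq0 => /(_ a0).
  rewrite scalerA mulVf// scale1r nmV => h.
  have na : 0 < nm a by rewrite nm_gt0.
  by rewrite -ler_pdivlMl.
unshelve eexists (@Csn _ _ S E p pD pZ _).
  have := nbhs0Z (r := emb 2^-1) _ W0.
  rewrite gt_eqF ?emb_gt0 ?invr_gt0// => /(_ isT); apply: filterS => _ [w Ww <-].
  apply: le_lt_trans (_ : 2^-1 < _); last by lra.
  apply: geA; split; first by lra.
  by rewrite scalerA -rmorphM invrK divff ?gt_eqF// rmorph1 scale1r.
move=> x /= px; apply: WV; have := ltA x 1 px.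
by case; rewrite invr1 rmorph1 scale1r.
Qed.

(** A single seminorm and radius 1 suffice because seminorms can be rescaled ([csn_scale]) and
    dominated in pairs ([csn_max]). For this reason the later estimates ask for one [q] and the
    condition [< 1]. *)
Lemma nbhs_snP x (A : set E) :
  nbhs x A <-> exists p, forall y, p (y - x) < 1 -> A y.
Proof.
split=> [xA|[p pA]]; last by apply: filterS (sn_ball p x ltr01) => y /pA.
have := nbhsB (- x) xA; rewrite addNr => A0.
have [p pA] := gauge A0; exists p => y /pA[z Az].
by rewrite addrC => /addIr <-.
Qed.

Lemma cvg_snP (T : Type) (G : set_system T) (FG : Filter G) (f : T -> E) l :
  f @ G --> l <-> forall p (e : R), 0 < e -> \forall t \near G, p (f t - l) < e.
Proof.
split=> [fl p e e0|fl A /nbhs_snP[p pA]]; first exact: fl (sn_ball p l e0).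
by apply: filterS (fl p 1 ltr01) => t; exact: pA.
Qed.

Lemma hausdorff_sn0 x : hausdorff_space E -> (forall p, p x = 0) -> x = 0.
Proof.
move=> hE px; apply: hE => A B /nbhs_singleton Ax /nbhs_snP[p pB].
exists x; split => //; apply: pB.
by rewrite subr0 px.
Qed.

End Seminorms.

(** * Powers of a space and directional derivatives *)

Section Powers.
Context (R : realType) (K : numFieldType) (S : real_scalars R K)
  (E F : tvsType K).
Local Notation csnE := (csn S E).
Local Notation csnF := (csn S F).

Lemma tpow_proj_continuous k (i : 'I_k) :
  continuous (fun y : tpow k E => y i).
Proof. exact: (@proj_continuous _ (fun=> E) i). Qed.

Lemma tpow_nbhs_box k (y : tpow k E) (N : 'I_k -> set E) :
  (forall i, nbhs (y i) (N i)) -> nbhs y [set z : tpow k E | forall i, N i (z i)].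
Proof.
move=> yN; apply: (@filter_forall _ _ (fun i (z : tpow k E) => N i (z i)) (nbhs y)).
by move=> i; exact: (@tpow_proj_continuous k i y (N i) (yN i)).
Qed.

Lemma tpow_nbhs_snP k (y : tpow k E) (A : set (tpow k E)) :
  nbhs y A <-> exists q : csnE, forall z, (forall i, q (z i - y i) < 1) -> A z.
Proof.
split=> [yA|[q qA]]; last first.
  have yN := @tpow_nbhs_box k y (fun i => [set x | q (x - y i) < 1])
    (fun i => sn_ball q (y i) ltr01).
  exact: filterS yN.
(* [G] is the filter of sup-balls around [y]. It converges to [y] in each coordinate, hence in the
   product topology, so every neighbourhood of [y] contains such a ball. *)
pose G := filter_from [set: csnE]
  (fun q => [set z : tpow k E | forall i, q (z i - y i) < 1]).
have FG : Filter G.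
  apply: filter_from_filter.
    by have [q _] := gauge S (@filterT _ (nbhs (0 : E)) _); exists q.
  move=> p q _ _; have [s sP] := csn_max p q; exists s => // z zs.
  by split=> i; have [] := sP (z i - y i); have := zs i; move=> /[swap]/[swap]; lra.
suff /(_ A yA) : G --> y by case=> q _ qA; exists q.
apply/(@cvg_sup _ _ _ G y) => i; apply/cvg_image => //.
  apply/seteqP; split => // x _; exists (fun=> x) => //.
move=> B /(nbhs_snP S)[q qB].
exists [set z | B (z i)]; last first.
  apply/seteqP; split=> [_ [z Bz <-]//|x Bx].
  exists (fun=> x) => //.
by exists q => // z zq; apply: qB; exact: zq.
Qed.

Lemma tpow_cvg (T : Type) (G : set_system T) (FG : Filter G) k
    (f : T -> tpow k E) (y : tpow k E) :
  (forall i, (fun t => f t i) @ G --> y i) -> f @ G --> y.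
Proof.
move=> fy A /tpow_nbhs_snP[q qA].
have : \forall t \near G, forall i, q (f t i - y i) < 1.
  apply: filter_forall => i; exact: (fy i) (sn_ball q (y i) ltr01).
by apply: filterS => t /qA.
Qed.

Lemma continuous_snP (f : E -> F) x : {for x, continuous f} <->
  forall (p : csnF) e, 0 < e -> exists q : csnE,
    forall x', q (x' - x) < 1 -> p (f x' - f x) < e.
Proof.
split=> [/(cvg_snP S) cf p e e0|cf]; first by have /(nbhs_snP S) := cf p e e0.
by apply/(cvg_snP S) => p e e0; apply/(nbhs_snP S); exact: cf.
Qed.

Lemma joint_continuous_snP j (f : E * tpow j E -> F) x y :
  {for (x, y), continuous f} <->
  forall (p : csnF) e, 0 < e -> exists q : csnE, forall x' (y' : tpow j E),
    q (x' - x) < 1 -> (forall i, q (y' i - y i) < 1) ->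
    p (f (x', y') - f (x, y)) < e.
Proof.
split=> [/(cvg_snP S) cf p e e0|cf].
  have [[A B] /= [/(nbhs_snP S)[q1 q1A] /tpow_nbhs_snP[q2 q2B]] AB] := cf p e e0.
  have [q qP] := csn_max q1 q2; exists q => x' y' qx qy; apply: (AB (x', y')).
  split; first by apply: q1A; apply: le_lt_trans qx; case: (qP (x' - x)).
  by apply: q2B => i; apply: le_lt_trans (qy i); case: (qP (y' i - y i)).
apply/(cvg_snP S) => p e e0; have [q qP] := cf p e e0.
exists ([set x' | q (x' - x) < 1], [set y' : tpow j E | forall i, q (y' i - y i) < 1]).
  split; first exact: sn_ball.
  by apply/tpow_nbhs_snP; exists q.
by move=> [x' y'] [/= ? ?]; exact: qP.
Qed.

End Powers.

Section Tseq.
Context (E : Type).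

Definition tseq k (y : tpow k E) : seq E := [seq y i | i <- enum 'I_k].

Lemma size_tseq k (y : tpow k E) : size (tseq y) = k.
Proof. by rewrite size_map size_enum_ord. Qed.

Lemma nth_tseq (x0 : E) k (y : tpow k E) (i : 'I_k) : nth x0 (tseq y) i = y i.
Proof. by rewrite (nth_map i) ?size_enum_ord// nth_ord_enum. Qed.

Lemma tseq_nth (x0 : E) (ys : seq E) : tseq (fun i : 'I_(size ys) => nth x0 ys i) = ys.
Proof.
apply: (@eq_from_nth _ x0); rewrite size_tseq// => i si.
by rewrite (nth_tseq _ _ (Ordinal si)).
Qed.

Lemma tseq_tcat m n (v : tpow m E) (w : tpow n E) :
  tseq (tcat v w) = tseq v ++ tseq w.
Proof.
case: m v => [|m] v.
  have -> : tseq v = [::] by apply: size0nil; rewrite size_tseq.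
  case: n w => [|n] w; first by rewrite /tseq /= !enum_ord0.
  apply: (@eq_from_nth _ (w ord0)); rewrite !size_tseq// => i si /=.
  rewrite (nth_tseq _ _ (Ordinal si)) (nth_tseq _ _ (Ordinal si)) /tcat.
  by case: fintype.splitP => [[]//|k /= ik]; congr w; apply/val_inj.
apply: (@eq_from_nth _ (v ord0)); rewrite ?size_cat !size_tseq// => i si.
rewrite nth_cat size_tseq (nth_tseq _ _ (Ordinal si)) /tcat.
case: fintype.splitP => /= k ik.
  by rewrite ik ltn_ord (nth_tseq _ _ k).
by rewrite ik ltnNge leq_addr/= addKn (nth_tseq _ _ k).
Qed.

Lemma tseq_tset (x0 : E) k (y : tpow k E) i u :
  tseq (tset y i u) = take i (tseq y) ++ u :: drop i.+1 (tseq y).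
Proof.
apply: (@eq_from_nth _ x0).
  rewrite size_tseq size_cat /= size_take size_drop !size_tseq ltn_ord.
  by rewrite -addSnnS subnKC.
rewrite size_tseq => j jk; rewrite (nth_tseq _ _ (Ordinal jk)) /tset.
rewrite nth_cat size_take size_tseq ltn_ord -val_eqE /=.
have [ji|ij|->] := ltngtP j i; last by rewrite subnn.
- by rewrite nth_take// (nth_tseq _ _ (Ordinal jk)).
- rewrite -(subnSK ij) /= nth_drop addnBA// addnC addnK.
  by rewrite (nth_tseq _ _ (Ordinal jk)).
Qed.

End Tseq.

(** * Directional derivatives and the mean value inequality *)

Section Derivatives.
Context (R : realType) (K : numFieldType) (S : real_scalars R K)
  (E F : tvsType K).
Local Notation nm := (nm S).
Local Notation emb := (emb S).
Local Notation csnF := (csn S F).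
Implicit Types (f g : E -> F) (x v h : E) (U : set E).

Lemma has_ddirP f x v l : has_ddir f x v l <->
  forall (p : csnF) e, 0 < e -> exists2 d, 0 < d &
    forall t, nm t < d -> p (f (x + t *: v) - f x - t *: l) <= e * nm t.
Proof.
have quotE (p : csnF) t : t != 0 ->
    p (f (x + t *: v) - f x - t *: l) =
    nm t * p (t^-1 *: (f (x + t *: v) - f x) - l).
  by move=> t0; rewrite -snZ scalerBr scalerA divff// scale1r.
split=> [/(cvg_snP S) fl p e e0|fl].
  have /(dnbhs0_nmP S)[d d0 dP] := fl p e e0; exists d => // t td.
  have [->|t0] := eqVneq t 0.
    by rewrite !scale0r addr0 subrr subr0 sn0 nm0 mulr0.
  by rewrite quotE// mulrC ler_pM2r ?nm_gt0//; apply: ltW; exact: dP.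
apply/(cvg_snP S) => p e e0; apply/(dnbhs0_nmP S).
have [|d d0 dP] := fl p (e / 2); first by lra.
exists d => // t t0 td; have := dP t td.
rewrite quotE// mulrC ler_pM2r ?nm_gt0// => h; lra.
Qed.

Lemma has_ddir_unique : hausdorff_space F -> forall f x v l1 l2,
  has_ddir f x v l1 -> has_ddir f x v l2 -> l1 = l2.
Proof.
move=> hF f x v l1 l2 h1 h2; exact: (cvg_unique hF h1 h2).
Qed.

Lemma ddirE : hausdorff_space F -> forall f x v l,
  has_ddir f x v l -> ddir v f x = l.
Proof.
move=> hF f x v l fl; rewrite /ddir; case: xgetP => [l' _ fl'|/(_ l)//].
exact: has_ddir_unique fl.
Qed.

Lemma ddirP f x v : (exists l, has_ddir f x v l) ->
  has_ddir f x v (ddir v f x).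
Proof. by move=> fl; rewrite /ddir; case: xgetP => [//|]; case: fl => l ? /(_ l). Qed.

Lemma has_ddir_ext U f g x v l : open U -> U x -> {in U, f =1 g} ->
  has_ddir f x v l -> has_ddir g x v l.
Proof.
move=> oU Ux fg /has_ddirP fl; apply/has_ddirP => p e e0.
have [d d0 dP] := fl p e e0.
have /(nbhs_snP S)[q qU] : nbhs x U by exact: open_nbhs_nbhs.
(* For [t] below this bound [x + t *: v] stays in the [q]-ball inside [U]; the summand 1 covers the
   case [q v = 0]. *)
have c0 : 0 < (q v + 1)^-1 by rewrite invr_gt0; have := sn_ge0 q v; lra.
exists (Num.min d (q v + 1)^-1); first by rewrite lt_min d0.
move=> t; rewrite lt_min => /andP[td tq]; rewrite -!fg; first exact: dP.
  exact/mem_set.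
apply/mem_set/qU; rewrite addrAC subrr add0r snZ.
apply: (@le_lt_trans _ _ (nm t * (q v + 1))).
  by rewrite ler_wpM2l ?nm_ge0//; lra.
rewrite -ltr_pdivlMr ?div1r//; have := sn_ge0 q v; lra.
Qed.

Lemma has_ddir_scale f x v l a : has_ddir f x v l -> has_ddir f x (a *: v) (a *: l).
Proof.
move=> /has_ddirP fl; apply/has_ddirP => p e e0.
have na0 : 0 < nm a + 1 by have := nm_ge0 S a; lra.
have [|d d0 dP] := fl p (e / (nm a + 1)); first by rewrite divr_gt0.
exists (d / (nm a + 1)); first by rewrite divr_gt0.
have ta t : nm t * nm a <= nm t * (nm a + 1).
  by rewrite ler_wpM2l ?nm_ge0//; lra.
move=> t td; rewrite !scalerA; apply: le_trans (dP _ _) _.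
  by rewrite nmM; apply: le_lt_trans (ta t) _; rewrite -ltr_pdivlMr.
rewrite nmM mulrAC ler_pdivrMr// -mulrA ler_wpM2l//; lra.
Qed.

Lemma has_ddir_lin f g x v l m a : has_ddir f x v l -> has_ddir g x v m ->
  has_ddir (fun y => a *: f y + g y) x v (a *: l + m).
Proof.
move=> /has_ddirP fl /has_ddirP gm; apply/has_ddirP => p e e0.
have na0 : 0 < nm a + 1 by have := nm_ge0 S a; lra.
have [|d d0 dP] := fl p (e / 2 / (nm a + 1)); first by rewrite !divr_gt0.
have [|d' d'0 d'P] := gm p (e / 2); first by rewrite !divr_gt0.
exists (Num.min d d'); first by rewrite lt_min d0.
move=> t; rewrite lt_min => /andP[/dP h /d'P h'].
have -> : a *: f (x + t *: v) + g (x + t *: v) - (a *: f x + g x) - t *: (a *: l + m)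
   = a *: (f (x + t *: v) - f x - t *: l) + (g (x + t *: v) - g x - t *: m).
  rewrite scalerDr !scalerBr !scalerA [t * a]mulrC !opprD.
  by rewrite [RHS]addrACA; congr (_ + _); rewrite addrACA.
apply: le_trans (snD _ _ _) _; rewrite snZ.
have : nm a * p (f (x + t *: v) - f x - t *: l) <= e / 2 * nm t; last by lra.
apply: le_trans (_ : (nm a + 1) * (e / 2 / (nm a + 1) * nm t) <= _).
  by apply: ler_pM => //; rewrite ?nm_ge0 ?sn_ge0//; lra.
by rewrite mulrA mulrCA divff ?mulr1// gt_eqF.
Qed.

(** Let [c] be the supremum of the points that satisfy the bound. The local estimate at [c], used to
    the left, shows that [c] satisfies it too; used to the right, it would yield a larger such point
    if [c < 1]. *)
Lemma real_mvt (p : csnF) (phi : R -> F) (M : R) :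
  (forall c, 0 <= c <= 1 -> exists2 d, 0 < d & forall s, 0 <= s <= 1 ->
     `|s - c| < d -> p (phi s - phi c) <= M * `|s - c|) ->
  p (phi 1 - phi 0) <= M.
Proof.
move=> loc; pose A := [set s : R | 0 <= s <= 1 /\ p (phi s - phi 0) <= M * s].
have A0 : A 0 by split; rewrite ?lexx ?ler01// subrr sn0 mulr0.
have A1 : ubound A 1 by move=> s [/andP[]].
have hA : has_sup A by split; [exists 0|exists 1].
set c := sup A.
have c0 : 0 <= c by apply: ub_le_sup => //; exists 1.
have c1 : c <= 1 by apply: ge_sup => //; exists 0.
have [d d0 dP] := loc c ltac:(by rewrite c0 c1).
have Ac : A c.
  split; first by rewrite c0 c1.
  have [s As cs] := sup_adherent d0 hA.
  have sc : s <= c by apply: ub_le_sup => //; exists 1.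
  have sc' : `|s - c| = c - s by rewrite ler0_norm; lra.
  have := dP s (proj1 As); rewrite sc' (snBC p (phi s)) => h.
  have : p (phi c - phi s) <= M * (c - s) by apply: h; rewrite /c; lra.
  have := sn_tri p (phi c) (phi s) (phi 0); have := proj2 As; lra.
have [c1'|c1'] := ltP c 1; last first.
  by have <- : c = 1; [lra|have := proj2 Ac; rewrite (_ : c = 1); lra].
pose s := Num.min 1 (c + d / 2).
have sc : c < s by rewrite lt_min c1'/=; lra.
have s1 : s <= 1 by rewrite ge_min lexx.
have sd : s <= c + d / 2 by rewrite ge_min lexx orbT.
have : A s.
  split; first by lra.
  have sc' : `|s - c| = s - c by rewrite ger0_norm; lra.
  have := dP s; rewrite sc' => h.
  have : p (phi s - phi c) <= M * (s - c) by apply: h; lra.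
  have := sn_tri p (phi s) (phi c) (phi 0); have := proj2 Ac; lra.
move=> As; have : s <= c by apply: ub_le_sup => //; exists 1.
lra.
Qed.

(** [real_mvt] is applied to the curve [s |-> f (x + s h) - s l0]. The reference value [l0] is free:
    the derivative at one end gives a first-order remainder, and [l0 = 0] gives a Lipschitz
    bound. *)
Lemma mvt (p : csnF) f x h (l : R -> F) (l0 : F) (M : R) :
  (forall s, 0 <= s <= 1 -> has_ddir f (x + emb s *: h) h (l s)) ->
  (forall s, 0 <= s <= 1 -> p (l s - l0) <= M) ->
  p (f (x + h) - f x - l0) <= M.
Proof.
move=> fl lM; apply/ler_addgt0Pr => e e0.
have := @real_mvt p (fun s => f (x + emb s *: h) - emb s *: l0) (M + e).
rewrite rmorph0 rmorph1 !scale0r !scale1r addr0 subr0 addrAC; apply.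
move=> c c01; have /has_ddirP/(_ p e e0)[d d0 dP] := fl c c01.
exists d => // s s01 sc.
have := dP (emb (s - c)); rewrite nm_emb => /(_ sc).
have -> : x + emb c *: h + emb (s - c) *: h = x + emb s *: h.
  by rewrite -addrA -scalerDl -rmorphD (addrC c) subrK.
move=> hs.
have -> : f (x + emb s *: h) - emb s *: l0 - (f (x + emb c *: h) - emb c *: l0)
  = (f (x + emb s *: h) - f (x + emb c *: h) - emb (s - c) *: l c)
    + emb (s - c) *: (l c - l0).
  by rewrite rmorphB; module K.
apply: le_trans (snD _ _ _) _; rewrite snZ nm_emb mulrDl.
have : `|s - c| * p (l c - l0) <= M * `|s - c| by rewrite mulrC ler_wpM2r ?lM.
lra.
Qed.

End Derivatives.

(** * Iterated derivatives *)

Section IteratedDerivatives.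
Context (R : realType) (K : numFieldType) (S : real_scalars R K)
  (E F : tvsType K) (hF : hausdorff_space F) (U : set E) (oU : open U).
Local Notation nm := (nm S).
Local Notation emb := (emb S).
Local Notation csnE := (csn S E).
Local Notation csnF := (csn S F).
Implicit Types (f g : E -> F) (x v h : E).

(** Lists of directions instead of tuples: [rcons] is one more differentiation, and concatenation
    separates the arguments of f^(k) from those of its derivatives. *)
Definition dd f (ys : seq E) : E -> F := foldl (fun g v => ddir v g) f ys.

Lemma dmapE j f x (y : tpow j E) : dmap f x y = dd f (tseq y) x.
Proof. by []. Qed.

Lemma dd_rcons f ys v : dd f (rcons ys v) = ddir v (dd f ys).
Proof. by rewrite /dd -cats1 foldl_cat. Qed.

Lemma dd_cat f ys zs : dd f (ys ++ zs) = dd (dd f ys) zs.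
Proof. by rewrite /dd foldl_cat. Qed.

Definition has_derivs f n := forall ys, (size ys < n)%N -> forall x, U x ->
  forall v, has_ddir (dd f ys) x v (dd f (rcons ys v) x).

Definition linear_derivs f n := forall ys, (size ys < n)%N -> forall x, U x ->
  forall a u v, dd f (rcons ys (a *: u + v)) x =
    a *: dd f (rcons ys u) x + dd f (rcons ys v) x.

Definition cont_derivs f n := forall j, (j <= n)%N -> forall x, U x ->
  forall y : tpow j E,
  {for (x, y), continuous (fun p : E * tpow j E => dmap f p.1 p.2)}.

(** This is weaker than joint continuity ([cont_locbd]). For complex analytic maps it is what
    Cauchy's estimate yields, and [locbd_cont] then recovers joint continuity. *)
Definition locbd_derivs f n := forall x, U x -> forall p : csnF,
  exists (q : csnE) (C : R), forall u, q u < 1 -> forall y : tpow n E,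
    (forall i, q (y i) < 1) -> p (dmap f (x + u) y) <= C.

Definition Cr f n := [/\ has_derivs f n, linear_derivs f n & cont_derivs f n].

Lemma ddir_exist_rcons f ys v : ddir_exist U f (rcons ys v) <->
  ddir_exist U f ys /\ forall x, U x -> exists l, has_ddir (dd f ys) x v l.
Proof.
elim: ys f => [|w ys IH] f /=; first by split=> [[? _]|[_ ?]].
by split=> [[fl /IH[? ?]]|[[fl ?] ?]]; [|split=> //; apply/IH].
Qed.

Lemma has_derivsP f n :
  has_derivs f n <-> (forall ys, (size ys <= n)%N -> ddir_exist U f ys).
Proof.
split=> [fn ys|fn ys yn x Ux v].
  elim/last_ind: ys => [//|ys v IH]; rewrite size_rcons => yn.
  apply/ddir_exist_rcons; split=> [|x Ux]; first by apply: IH; exact: ltnW.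
  by exists (dd f (rcons ys v) x); exact: fn.
rewrite dd_rcons; apply: ddirP.
have /ddir_exist_rcons[_] : ddir_exist U f (rcons ys v) by apply: fn; rewrite size_rcons.
exact.
Qed.

(** Linearity in the last direction is the hypothesis. A further derivative in direction [w]
    preserves a linear relation that holds on the open set [U], by uniqueness of limits. *)
Lemma dd_linear f n l1 l2 x a u v : has_derivs f n -> linear_derivs f n -> U x ->
  (size l1 + size l2 < n)%N ->
  dd f (l1 ++ (a *: u + v) :: l2) x =
  a *: dd f (l1 ++ u :: l2) x + dd f (l1 ++ v :: l2) x.
Proof.
move=> fn ln; elim/last_ind: l2 x => [|l2 w IH] x Ux.
  by rewrite addn0 !cats1 => ?; exact: ln.
rewrite size_rcons addnS => sn; rewrite -!rcons_cons -!rcons_cat.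
have h t : has_ddir (dd f (l1 ++ t :: l2)) x w (dd f (rcons (l1 ++ t :: l2) w) x).
  by apply: fn => //; rewrite size_cat /= addnS.
have := has_ddir_lin S (a := a) (h u) (h v).
move=> /(has_ddir_ext S oU Ux (g := dd f (l1 ++ (a *: u + v) :: l2))) h'.
apply: (has_ddir_unique hF (h (a *: u + v))); apply: h' => y /set_mem Uy.
by rewrite IH//; exact: ltnW.
Qed.

Lemma dmap_multilinear f n x : has_derivs f n -> linear_derivs f n -> U x ->
  multilinear (@dmap K E F n f x).
Proof.
move=> fn ln Ux i y a u v; rewrite !dmapE !(tseq_tset 0).
apply: dd_linear fn ln Ux _.
rewrite size_take size_drop !size_tseq ltn_ord.
by rewrite -ltnS -addSn subnKC.
Qed.

Lemma dd_continuous f n ys x : cont_derivs f n -> (size ys <= n)%N -> U x ->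
  {for x, continuous (dd f ys)}.
Proof.
move=> cf yn Ux; have h := cf _ yn x Ux (fun i => nth 0 ys i).
apply/(continuous_snP S) => p e e0.
have /joint_continuous_snP/(_ p e e0)[q qP] := h.
exists q => x' xq; have := qP x' (fun i => nth 0 ys i) xq.
rewrite /= !dmapE tseq_nth; apply => i.
by rewrite subrr sn0.
Qed.

(** Homogeneity is a rescaling of [t]. For additivity, the step along [t (u + v)] is split into a
    step along [t u] from [x] and a step along [t v] from [x + t u]; the mean value inequality and
    continuity of the derivative in direction [v] compare the second with a step starting at [x]. *)
Lemma linear_derivs_cont f n : has_derivs f n -> cont_derivs f n ->
  linear_derivs f n.
Proof.
move=> fn cf ys yn x Ux a u v.
set g := dd f ys; have gd z w : U z -> has_ddir g z w (ddir w g z).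
  by move=> Uz; have := fn ys yn z Uz w; rewrite dd_rcons.
rewrite !dd_rcons -/g.
apply: (has_ddir_unique hF (gd _ _ Ux)).
have := has_ddir_scale S (a := a) (gd x u Ux); move: (a *: ddir u g x) => l.
move: (a *: u) => {}u /(has_ddirP S) ul; apply/(has_ddirP S) => p e e0.
have e2 : 0 < e / 2 by lra.
have [d d0 dP] := ul p (e / 2) e2.
have := @dd_continuous f n (rcons ys v) x cf; rewrite size_rcons => /(_ yn Ux).
move=> /(continuous_snP S)/(_ p (e / 2) e2)[q1 q1P].
have /(nbhs_snP S)[q2 q2U] : nbhs x U by exact: open_nbhs_nbhs.
have [q qP] := csn_max q1 q2.
(* On the segment from [t u] to [t u + t v] the seminorm [q] is at most [nm t * (q u + q v)], so
   [nm t < c^-1] keeps it below 1. *)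
pose c := q u + q v + 1; have c0 : 0 < c.
  by have := sn_ge0 q u; have := sn_ge0 q v; rewrite /c; lra.
exists (Num.min d c^-1); first by rewrite lt_min d0 invr_gt0.
move=> t; rewrite lt_min => /andP[td tc].
have {}tc : nm t * c < 1 by rewrite -ltr_pdivlMr// div1r.
have seg s : 0 <= s <= 1 -> q (t *: u + emb s *: (t *: v)) < 1.
  move=> s01; apply: le_lt_trans tc; apply: le_trans (snD _ _ _) _.
  rewrite !snZ nm_emb ger0_norm; last by lra.
  have tv := mulr_ge0 (nm_ge0 S t) (sn_ge0 q v).
  have : s * (nm t * q v) <= nm t * q v by rewrite ler_piMl//; lra.
  by rewrite /c !mulrDr mulr1; have := nm_ge0 S t; lra.
have Useg s : 0 <= s <= 1 -> U (x + t *: u + emb s *: (t *: v)).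
  move=> s01; apply: q2U; rewrite -(addrA x) addrAC subrr add0r.
  by have [_] := qP (t *: u + emb s *: (t *: v)); have := seg s s01; lra.
have h1 : p (g (x + t *: u + t *: v) - g (x + t *: u) - t *: ddir v g x)
    <= e / 2 * nm t.
  apply: (@mvt _ _ S E F p g (x + t *: u) (t *: v)
    (fun s => t *: ddir v g (x + t *: u + emb s *: (t *: v)))) => s s01.
    exact: (has_ddir_scale S (a := t) (gd _ v (Useg s s01))).
  rewrite -scalerBr snZ mulrC ler_wpM2r ?nm_ge0//; apply: ltW.
  rewrite -dd_rcons; apply: q1P; rewrite -(addrA x) addrAC subrr add0r.
  by have [+ _] := qP (t *: u + emb s *: (t *: v)); have := seg s s01; lra.
have -> : g (x + t *: (u + v)) - g x - t *: (l + ddir v g x) =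
    (g (x + t *: u + t *: v) - g (x + t *: u) - t *: ddir v g x)
    + (g (x + t *: u) - g x - t *: l).
  rewrite (_ : x + t *: (u + v) = x + t *: u + t *: v); last by module K.
  by module K.
apply: le_trans (snD _ _ _) _; have := dP t td; lra.
Qed.

Lemma cont_locbd f n : cont_derivs f n -> locbd_derivs f n.
Proof.
move=> cf x Ux p; have := cf n (leqnn n) x Ux (fun=> 0).
move=> /joint_continuous_snP/(_ p 1 ltr01)[q qP].
pose z : tpow n E := fun=> 0.
exists q, (1 + p (dmap f x z)) => u qu y qy.
have := qP (x + u) y; rewrite addrAC subrr add0r => /(_ qu) h.
have {}h : p (dmap f (x + u) y - dmap f x z) < 1.
  by apply: h => i; rewrite subr0.
by have := sn_leD p (dmap f (x + u) y) (dmap f x z); lra.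
Qed.

End IteratedDerivatives.

(** * Uniform continuity of derivatives *)

Section MultilinearBounds.
Context (R : realType) (K : numFieldType) (S : real_scalars R K)
  (E F : tvsType K).
Local Notation emb := (emb S).
Variables (q : csn S E) (p : csn S F) (n : nat) (M : tpow n E -> F) (C : R).
Hypotheses (mM : multilinear M)
  (MC : forall v, (forall i, q (v i) < 1) -> p (M v) <= C).

Lemma multilinear_bound_scale (r : R) (v : tpow n E) : 0 < r ->
  (forall i, q (v i) < r) -> p (M v) <= C * r ^+ n.
Proof.
move=> r0 vr; have -> : v = emb r *: (emb r^-1 *: v).
  by rewrite scalerA -rmorphM divff ?gt_eqF// rmorph1 scale1r.
rewrite multilinear_scale// snZ nmX nm_emb gtr0_norm// mulrC.
apply: ler_wpM2r; first by rewrite exprn_ge0// ltW.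
apply: MC => i.
rewrite [X in q X](_ : _ = emb r^-1 *: v i)// snZ nm_emb gtr0_norm ?invr_gt0//.
by rewrite mulrC ltr_pdivrMr// mul1r.
Qed.

Lemma multilinear_bound_coord (r d : R) (v : tpow n E) i : 0 < r -> 0 < d ->
  (forall j, q (v j) < r) -> q (v i) < d * r -> p (M v) <= d * (C * r ^+ n).
Proof.
move=> r0 d0 vr vi; have -> : v = tset v i (emb d *: (emb d^-1 *: v i) + 0).
  apply/funext => j; rewrite /tset; case: eqP => [->|//].
  by rewrite scalerA -rmorphM divff ?gt_eqF// rmorph1 scale1r addr0.
rewrite mM; have -> : M (tset v i 0) = 0.
  by have := mM i v (-1) 0 0; rewrite scaler0 addr0 scaleN1r addNr.
rewrite addr0 snZ nm_emb gtr0_norm// ler_pM2l//.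
apply: multilinear_bound_scale => // j; rewrite /tset; case: eqP => // _.
by rewrite snZ nm_emb gtr0_norm ?invr_gt0// mulrC ltr_pdivrMr// mulrC.
Qed.

(** The coordinates of [w] are replaced by those of [v] one at a time; each replacement changes [M]
    by its value with [v i - w i] in slot [i]. As [d <= 1 <= r], this entry is below both [r] and
    [d * r], as [multilinear_bound_coord] demands. *)
Lemma multilinear_diff_bound (r d : R) (v w : tpow n E) : 1 <= r -> 0 < d <= 1 ->
  (forall i, q (v i) < r) -> (forall i, q (w i) < r) ->
  (forall i, q (v i - w i) < d) -> p (M v - M w) <= n%:R * (d * (C * r ^+ n)).
Proof.
move=> r1 /andP[d0 d1] vr wr vw.
pose z m : tpow n E := fun i => if (i < m)%N then v i else w i.
have zr m i : q (z m i) < r by rewrite /z; case: ifP.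
have h m : (m <= n)%N -> p (M (z m) - M w) <= m%:R * (d * (C * r ^+ n)).
  elim: m => [_|m IH mn].
    by rewrite mul0r (_ : z 0%N = w) ?subrr ?sn0.
  pose i := Ordinal mn.
  have zS : z m.+1 = tset (z m) i (1 *: (v i - w i) + w i).
    apply/funext => j; rewrite /tset /z ltnS leq_eqVlt -val_eqE /=.
    by case: eqP => //= jm; rewrite scale1r subrK; congr v; exact: val_inj.
  have zm : tset (z m) i (w i) = z m.
    by apply/funext => j; rewrite /tset /z; case: eqP => [->|//]; rewrite ltnn.
  have -> : M (z m.+1) - M w = M (tset (z m) i (v i - w i)) + (M (z m) - M w).
    by rewrite zS mM zm scale1r addrA.
  apply: le_trans (snD _ _ _) _; rewrite mulrSr mulrDl mul1r addrC lerD//.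
    by rewrite IH// ltnW.
  have dr : d <= d * r by rewrite ler_peMr// ltW.
  apply: (@multilinear_bound_coord _ _ _ i) => //; first by lra.
    move=> j; rewrite /tset; case: eqP => _; last exact: zr.
    by apply: lt_le_trans (vw i) _; lra.
  by rewrite /tset eqxx; apply: lt_le_trans dr.
have <- : z n = v by apply/funext => i; rewrite /z ltn_ord.
exact: h.
Qed.

End MultilinearBounds.

Section UniformContinuity.
Context (R : realType) (K : numFieldType) (S : real_scalars R K)
  (E F : tvsType K) (hF : hausdorff_space F) (U : set E) (oU : open U).
Local Notation emb := (emb S).
Local Notation csnE := (csn S E).
Local Notation csnF := (csn S F).
Implicit Types (f g : E -> F) (x v h : E).

(** Only local bounds of d^n f and d^(n+1) f enter. It matters that [q] and [C] are fixed before [r]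
    and [d]: the size [r] of a bounded set is measured by [q], and [d] is chosen last to make the
    right-hand side small. *)
Lemma dmap_diff_bound f n x (p : csnF) :
  has_derivs U f n.+1 -> linear_derivs U f n.+1 ->
  locbd_derivs S U f n -> locbd_derivs S U f n.+1 -> U x ->
  exists (q : csnE) (C : R), forall (r d : R) x' (w w' : tpow n E),
    1 <= r -> 0 < d <= 1 -> q (x' - x) < d ->
    (forall i, q (w i) < r) -> (forall i, q (w' i) < r) ->
    (forall i, q (w i - w' i) < d) ->
    p (dmap f x' w - dmap f x w') <= d * (C * r ^+ n.+1).
Proof.
move=> fn ln bn bn1 Ux.
have [q1 [C1 C1P]] := bn x Ux p; have [q2 [C2 C2P]] := bn1 x Ux p.
have /(nbhs_snP S)[q3 q3U] : nbhs x U by exact: open_nbhs_nbhs.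
have [q4 q4P] := csn_max q1 q2; have [q q5P] := csn_max q4 q3.
have qq1 z : q z < 1 -> q1 z < 1.
  by move=> h; have [+ _] := q4P z; have [+ _] := q5P z; lra.
have qq2 z : q z < 1 -> q2 z < 1.
  by move=> h; have [_ +] := q4P z; have [+ _] := q5P z; lra.
have qU z : q (z - x) < 1 -> U z.
  by move=> h; apply: q3U; have [_ +] := q5P (z - x); lra.
(* [C2] pays for moving the base point and [C1] for each of the [n] arguments. Absolute values make
   the constants nonnegative, so that [r ^+ n] may be enlarged to [r ^+ n.+1]. *)
exists q, (`|C2| + n%:R * `|C1|) => r d x' w w' r1 /andP[d0 d1] xx' wr w'r ww'.
have r0 : 0 < r by lra.
set h := x' - x; have x'E : x' = x + h by rewrite /h addrC subrK.
have hs s : 0 <= s <= 1 -> q (emb s *: h) < 1.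
  move=> s01; rewrite snZ nm_emb ger0_norm; last by lra.
  apply: le_lt_trans (_ : q h < 1); last by lra.
  by rewrite ler_piMl ?sn_ge0//; lra.
have Us s : 0 <= s <= 1 -> U (x + emb s *: h).
  by move=> s01; apply: qU; rewrite addrAC subrr add0r; exact: hs.
(* mean value inequality in x, then telescoping in the other arguments *)
have step1 : p (dmap f x' w - dmap f x w) <= d * (`|C2| * r ^+ n.+1).
  rewrite -[dmap f x' w - _]subr0 x'E !dmapE.
  apply: (@mvt _ _ S E F p (dd f (tseq w)) x h
    (fun s => dd f (rcons (tseq w) h) (x + emb s *: h))) => s s01.
    by apply: fn; [rewrite size_tseq|exact: Us].
  rewrite subr0; pose wh : tpow n.+1 E := fun i => nth 0 (rcons (tseq w) h) i.
  have sz : size (rcons (tseq w) h) = n.+1 by rewrite size_rcons size_tseq.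
  have -> : rcons (tseq w) h = tseq wh.
    apply: (@eq_from_nth _ 0); rewrite sz ?size_tseq// => i si.
    by rewrite (nth_tseq 0 wh (Ordinal si)).
  rewrite -dmapE.
  apply: (@multilinear_bound_coord _ _ S E F q p _ _ _ _ _ r d _ ord_max) => //.
  - exact: (dmap_multilinear S hF oU fn ln (Us s s01)).
  - move=> v v1; apply: le_trans (ler_norm _); apply: C2P => [|i]; last exact/qq2/v1.
    exact/qq2/hs.
  - move=> i; rewrite /wh nth_rcons size_tseq; case: ltnP => ni.
      by rewrite (nth_tseq 0 w (Ordinal ni)).
    by case: eqP => _; [|rewrite sn0]; lra.
  - rewrite /wh nth_rcons size_tseq ltnn eqxx.
    by apply: lt_le_trans xx' _; rewrite ler_peMr// ltW.
have step2 : p (dmap f x w - dmap f x w') <= n%:R * (d * (`|C1| * r ^+ n)).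
  apply: (@multilinear_diff_bound _ _ S E F q) => //; last by rewrite d0.
    apply: (dmap_multilinear S hF oU _ _ Ux).
      by move=> ys ysn; apply: fn; exact: ltnW.
    by move=> ys ysn; apply: ln; exact: ltnW.
  move=> v v1; apply: le_trans (ler_norm _).
  have := C1P 0; rewrite addr0 sn0 => /(_ ltr01); apply => i.
  exact/qq1/v1.
apply: le_trans (sn_tri p _ (dmap f x w) _) _; apply: le_trans (lerD step1 step2) _.
have : n%:R * (d * (`|C1| * r ^+ n)) <= n%:R * (d * (`|C1| * r ^+ n.+1)).
  apply: ler_wpM2l => //; apply: ler_wpM2l; first exact: ltW.
  by apply: ler_wpM2l => //; rewrite exprS ler_peMl// exprn_ge0// ltW.
by move: (r ^+ n.+1) (r ^+ n) => a b; lra.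
Qed.

(* Continuity of [(x, y) |-> f^(k+j)(x, -, y)] for the topology of uniform
   convergence on the sets of the bornology. *)
Definition unif_cont_derivs (b : bornology) f k j := forall x, U x ->
  forall (y : tpow j E) (B : set (tpow k E)), in_bornology b B ->
  forall (p : csnF) e, 0 < e -> exists q : csnE, forall x' (y' : tpow j E),
    q (x' - x) < 1 -> (forall i, q (y' i - y i) < 1) ->
    forall v : tpow k E, B v -> p (dmap f x' (tcat v y') - dmap f x (tcat v y)) < e.

(** A bounded set lies in a multiple of the [q]-ball, so its elements and the arguments near [y]
    have a common size [r]; it remains to choose [d] in [dmap_diff_bound]. *)
Lemma unif_cont_bounded f k j :
  has_derivs U f (k + j).+1 -> linear_derivs U f (k + j).+1 ->
  locbd_derivs S U f (k + j) -> locbd_derivs S U f (k + j).+1 ->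
  unif_cont_derivs OnBounded f k j.
Proof.
move=> fn ln bn bn1 x Ux y B Bb p e e0.
have [q [C qC]] := dmap_diff_bound p fn ln bn bn1 Ux.
have B0 : nbhs (0 : tpow k E) [set v : tpow k E | forall i, q (v i) < 1].
  apply: (@tpow_nbhs_box _ _ k 0 (fun i => [set z | q z < 1])) => i.
  exact: sn_ball0.
have [r0 r00 Br] := Bb _ B0.
have [r1 r10 r1E] := emb_pos S r00.
(* [r1] bounds the entries coming from [B], the sum bounds those of [y], and the summand 2 leaves
   room for [1 <= r] and for [y'], which is within [d <= 1] of [y]. *)
pose r := r1 + 2 + \sum_i q (y i).
have sy : 0 <= \sum_i q (y i) by apply: sumr_ge0 => i _; exact: sn_ge0.
have qy i : q (y i) <= \sum_i q (y i).
  by rewrite (bigD1 i)//= lerDl; apply: sumr_ge0 => l _; exact: sn_ge0.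
have qB (v : tpow k E) i : B v -> q (v i) < r1.
  move=> Bv; have [|z z1 <-] := Br (emb r1) _ v Bv.
    by rewrite -(emb_nm S) nm_emb gtr0_norm// r1E.
  rewrite [X in q X](_ : _ = emb r1 *: z i)// snZ nm_emb gtr0_norm//.
  by rewrite -[ltRHS]mulr1 ltr_pM2l.
pose D := `|C * r ^+ (k + j).+1| + 1.
have D0 : 0 < D by rewrite /D; have := normr_ge0 (C * r ^+ (k + j).+1); lra.
pose d := Num.min 1 (e / 2 / D).
have d0 : 0 < d by rewrite lt_min ltr01 !divr_gt0.
have d1 : d <= 1 by rewrite ge_min lexx.
have dD : d * D <= e / 2.
  by rewrite -ler_pdivlMr// ge_min lexx orbT.
have dV0 : 0 < d^-1 by rewrite invr_gt0.
have [q' q'E] := csn_scale q dV0.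
have q'd z : q' z < 1 -> q z < d.
  by rewrite q'E mulrC ltr_pdivrMr// mul1r.
exists q' => x' y' xx' yy' v Bv.
apply: (@le_lt_trans _ _ (d * (C * r ^+ (k + j).+1))).
  apply: (qC r); rewrite ?d0 ?d1//; first by rewrite /r; lra.
  - exact: q'd.
  - move=> i; rewrite /tcat; case: fintype.split => l.
      by have := qB v l Bv; rewrite /r; lra.
    have := q'd _ (yy' l); have := sn_leD q (y' l) (y l).
    by have := qy l; rewrite /r; lra.
  - move=> i; rewrite /tcat; case: fintype.split => l.
      by have := qB v l Bv; rewrite /r; lra.
    by have := qy l; rewrite /r; lra.
  - move=> i; rewrite /tcat; case: fintype.split => l.
      by rewrite subrr sn0.
    exact: q'd.
apply: le_lt_trans (_ : e / 2 < e); last by lra.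
apply: le_trans dD; rewrite ler_wpM2l ?(ltW d0)//.
by apply: le_trans (ler_norm _) _; rewrite /D lerDl.
Qed.

(** Joint continuity at each [v] of the compact set is made uniform by a covering argument. For [v']
    near [v], both terms of the difference are compared with the value at [(x, (v, y))], each at the
    cost of [e / 2]. *)
Lemma unif_cont_compact f k j : cont_derivs U f (k + j) ->
  unif_cont_derivs OnCompact f k j.
Proof.
move=> cf x Ux y B /= /compact_near_coveringP cB p e e0.
pose G := filter_from [set: csnE] (fun q => [set z : E * tpow j E |
  q (z.1 - x) < 1 /\ forall i, q (z.2 i - y i) < 1]).
have FG : Filter G.
  apply: filter_from_filter.
    by have [q _] := gauge S (@filterT _ (nbhs (0 : E)) _); exists q.
  move=> p1 p2 _ _; have [s sP] := csn_max p1 p2; exists s => // z [zx zy].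
  split; split=> [|i].
  - by have [+ _] := sP (z.1 - x); lra.
  - by have [+ _] := sP (z.2 i - y i); have := zy i; lra.
  - by have [_ +] := sP (z.1 - x); lra.
  - by have [_ +] := sP (z.2 i - y i); have := zy i; lra.
have [|q _ qP] := cB _ G (fun z (v : tpow k E) =>
    p (dmap f z.1 (tcat v z.2) - dmap f x (tcat v y)) < e) FG.
  move=> v Bv; have e2 : 0 < e / 2 by lra.
  have /(joint_continuous_snP S)/(_ p _ e2)[q qP] := cf _ (leqnn _) x Ux (tcat v y).
  exists ([set v' : tpow k E | forall i, q (v' i - v i) < 1],
    [set z : E * tpow j E | q (z.1 - x) < 1 /\ forall i, q (z.2 i - y i) < 1]).
    by split; [apply/(tpow_nbhs_snP S); exists q|exists q].
  move=> [v' z] [/= v'v [zx zy]].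
  apply: le_lt_trans (sn_tri p _ (dmap f x (tcat v y)) _) _.
  have h1 : p (dmap f z.1 (tcat v' z.2) - dmap f x (tcat v y)) < e / 2.
    apply: (qP z.1 (tcat v' z.2)) => // i.
    by rewrite /tcat; case: fintype.split => l.
  have h2 : p (dmap f x (tcat v' y) - dmap f x (tcat v y)) < e / 2.
    apply: (qP x (tcat v' y)) => [|i]; first by rewrite subrr sn0.
    by rewrite /tcat; case: fintype.split => l //; rewrite subrr sn0.
  by move: h2; rewrite snBC; lra.
by exists q => x' y' xx' yy' v Bv; exact: (qP (x', y')).
Qed.

(** The case [k = 0] of [unif_cont_bounded]: when no argument is left to range over a bounded set,
    uniform continuity is joint continuity. *)
Lemma locbd_cont f n :
  has_derivs U f n.+1 -> linear_derivs U f n.+1 ->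
  (forall j, (j <= n.+1)%N -> locbd_derivs S U f j) -> cont_derivs U f n.
Proof.
move=> fn ln bn j jn x Ux y; apply/(joint_continuous_snP S) => p e e0.
have bj : unif_cont_derivs OnBounded f 0 j.
  apply: unif_cont_bounded.
  - by move=> ys h; apply: fn; apply: leq_trans h _.
  - by move=> ys h; apply: ln; apply: leq_trans h _.
  - by apply: bn; exact: leqW.
  - exact: bn.
pose v : tpow 0 E := fun=> 0.
have vE x' (z : tpow j E) : @dmap K E F (0 + j) f x' (tcat v z) = dmap f x' z.
  by rewrite !dmapE tseq_tcat (size0nil (size_tseq v)).
have [|q qP] := bj x Ux y [set v] _ p e e0; last 1 first.
  exists q => x' y' xx' yy'; have := qP x' y' xx' yy' v erefl.
  by rewrite !vE.
(* [tpow 0 E] has a single point, which is trivially absorbed. *)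
move=> V V0; exists 1 => // t t1 _ ->; exists v; first exact: nbhs_singleton.
by apply/funext => -[].
Qed.

End UniformContinuity.

(** * The derivative as a map into a space of multilinear maps *)

Section ClinConvergence.
Context (R : realType) (K : numFieldType) (S : real_scalars R K)
  (b : bornology) (k : nat) (E F : tvsType K).
Local Notation L := (clin b k E F).

Lemma clin_nbhsP (l : L) (A : set L) : nbhs l A <->
  exists B (p : csn S F), in_bornology b B /\
    forall h : L, (forall v, B v -> p (h v - l v) < 1) -> A h.
Proof.
split=> [[B [V [bB /(nbhs_snP S)[p pV] BA]]]|[B [p [bB pA]]]].
  exists B, p; split=> // h hB; apply: BA => v Bv; apply: pV.
  by rewrite subr0; exact: hB.
exists B, [set z | p z < 1]; split => //; exact: sn_ball0.
Qed.

Lemma clin_cvgP (T : Type) (G : set_system T) (FG : Filter G) (phi : T -> L) (l : L) :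
  phi @ G --> l <-> forall B : set (tpow k E), in_bornology b B ->
    forall (p : csn S F) e, 0 < e ->
    \forall t \near G, forall v, B v -> p (phi t v - l v) < e.
Proof.
split=> [pl B bB p e e0|pl A /clin_nbhsP[B [p [bB pA]]]].
  have [q qE] := csn_scale p (etrans (invr_gt0 e) e0).
  have lA : nbhs l [set h : L | forall v, B v -> p (h v - l v) < e].
    apply/clin_nbhsP; exists B, q; split=> // h hB v /hB.
    by rewrite qE mulrC ltr_pdivrMr// mul1r.
  exact: pl _ lA.
by have := pl B bB p 1 ltr01; apply: filterS => t; exact: pA.
Qed.

(** Makes evaluation at [v] continuous in either topology, from which the Hausdorff property of
    [clin] follows. *)
Lemma singleton_bornology (v : tpow k E) : in_bornology b [set v].
Proof.
case: b => /=; first exact: compact_set1.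
move=> V /(tpow_nbhs_snP S)[q qV].
pose r := 1 + \sum_i q (v i).
have sv i : q (v i) < r.
  rewrite /r (bigD1 i)//= addrCA ltrDl ltr_pwDl//.
  by apply: sumr_ge0 => l _; exact: sn_ge0.
have r0 : 0 < r.
  by rewrite /r ltr_pwDl//; apply: sumr_ge0 => l _; exact: sn_ge0.
exists (emb S r); first by rewrite emb_gt0.
move=> t; rewrite -(emb_nm S) emb_le => rt _ ->.
have t0 : t != 0 by rewrite -(nm_gt0 S); exact: lt_le_trans rt.
exists (t^-1 *: v); last by rewrite scalerA divff// scale1r.
apply: qV => i; rewrite [X in q X](_ : _ = t^-1 *: v i); last first.
  by rewrite subr0.
rewrite snZ nmV mulrC ltr_pdivrMr ?nm_gt0// mul1r.
exact: lt_le_trans rt.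
Qed.

Lemma clin_eval_continuous (v : tpow k E) : continuous (fun h : L => h v).
Proof.
move=> h.
apply/(@cvg_snP _ _ S F L (nbhs h) (nbhs_filter h)) => p e e0.
have [/(_ (@cvg_id _ _)) + _] := @clin_cvgP L (nbhs h) (nbhs_filter h) idfun h.
move=> /(_ [set v] (singleton_bornology v) p e e0).
by apply: filterS => h'; exact.
Qed.

Lemma clin_hausdorff : hausdorff_space F -> hausdorff_space L.
Proof.
move=> hF h h' hh'; apply/val_inj/funext => v; apply: hF => A B hA hB.
have [l [lA lB]] := hh' _ _ (@clin_eval_continuous v h A hA)
  (@clin_eval_continuous v h' B hB).
by exists (l v).
Qed.

End ClinConvergence.

Section DerivativeMap.
Context (R : realType) (K : numFieldType) (S : real_scalars R K)
  (E F : tvsType K) (hF : hausdorff_space F) (U : set E) (oU : open U)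
  (b : bornology) (k m : nat) (f : E -> F).
Hypotheses (cf : Cr U f (k + m))
  (uf : forall j, (j <= m)%N -> unif_cont_derivs S U b f k j).
Local Notation L := (clin b k E F).
Local Notation nm := (nm S).
Local Notation emb := (emb S).
Implicit Types (x z : E) (v : tpow k E) (ys : seq E).

Let fn : has_derivs U f (k + m). Proof. by case: cf. Qed.
Let ln : linear_derivs U f (k + m). Proof. by case: cf. Qed.
Let kf : cont_derivs U f (k + m). Proof. by case: cf. Qed.

(* f^(k) with the last arguments of its derivatives fixed to [ys] *)
Let H ys x : L := insubd 0 (fun v => dd f (tseq v ++ ys) x).

(** Ensures that on [U] the default value 0 of [insubd] is never taken. *)
Let HE ys x : (size ys <= m)%N -> U x ->
  H ys x = (fun v => dd f (tseq v ++ ys) x) :> (tpow k E -> F).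
Proof.
move=> ym Ux; rewrite /H val_insubd ifT//; apply/asboolP; split.
  move=> v; pose y : tpow (size ys) E := fun i => nth 0 ys i.
  have -> : (fun v => dd f (tseq v ++ ys) x) = (fun v => dmap f x (tcat v y)).
    by apply/funext => w; rewrite dmapE tseq_tcat tseq_nth.
  apply/(@cvg_snP _ _ S F _ (nbhs v) (nbhs_filter v)) => p e e0.
  have kym : (k + size ys <= k + m)%N by rewrite leq_add2l.
  have /(joint_continuous_snP S)/(_ p e e0)[q qP] := @kf _ kym x Ux (tcat v y).
  apply/(tpow_nbhs_snP S); exists q => w wv.
  apply: (qP x (tcat w y)) => [|i]; first by rewrite subrr sn0.
  by rewrite /tcat; case: fintype.split => l//; rewrite subrr sn0.
move=> i v a u w /=; rewrite !(tseq_tset 0) -!catA !cat_cons.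
apply: (dd_linear S hF oU a u w fn ln Ux).
rewrite size_cat size_take size_drop !size_tseq ltn_ord addnA.
by rewrite -addSn -addSn subnKC// leq_add2l.
Qed.

Let unif ys x B (p : csn S F) e : (size ys <= m)%N -> U x -> in_bornology b B ->
  0 < e -> exists q : csn S E, forall x', q (x' - x) < 1 -> forall v, B v ->
    p (dd f (tseq v ++ ys) x' - dd f (tseq v ++ ys) x) < e.
Proof.
move=> ym Ux bB e0; pose y : tpow (size ys) E := fun i => nth 0 ys i.
have [q qP] := uf ym Ux y bB p e0; exists q => x' xx' v Bv.
have := qP x' y xx' _ v Bv; rewrite !dmapE tseq_tcat tseq_nth; apply => i.
by rewrite subrr sn0.
Qed.

(** The mean value inequality is applied separately for each [v] in [B]. Since [unif] supplies one
    [q] for all of them, the error [e / 2 * nm t] is uniform on [B], which is convergence of the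
    quotients in [clin]. *)
Let H_ddir ys x z : (size ys < m)%N -> U x ->
  has_ddir (H ys) x z (H (rcons ys z) x).
Proof.
move=> ym Ux; apply/(clin_cvgP S) => B bB p e e0.
have e2 : 0 < e / 2 by lra.
have yzm : (size (rcons ys z) <= m)%N by rewrite size_rcons.
have [q1 q1P] := unif p yzm Ux bB e2.
have /(nbhs_snP S)[q2 q2U] : nbhs x U by exact: open_nbhs_nbhs.
have [q qP] := csn_max q1 q2.
have c0 : 0 < q z + 1 by have := sn_ge0 q z; lra.
apply/(dnbhs0_nmP S); exists (q z + 1)^-1; first by rewrite invr_gt0.
move=> t t0 tc; have nt : 0 < nm t by rewrite nm_gt0.
have {}tc : nm t * (q z + 1) < 1 by rewrite -ltr_pdivlMr// div1r.
have seg s : 0 <= s <= 1 -> q (x + emb s *: (t *: z) - x) < 1.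
  move=> s01; rewrite addrAC subrr add0r !snZ nm_emb ger0_norm; last by lra.
  apply: le_lt_trans tc; rewrite mulrDr mulr1.
  have tz := mulr_ge0 (nm_ge0 S t) (sn_ge0 q z).
  have : s * (nm t * q z) <= nm t * q z by rewrite ler_piMl//; lra.
  lra.
have Us s : 0 <= s <= 1 -> U (x + emb s *: (t *: z)).
  by move=> /seg h; apply: q2U; have [_ +] := qP (x + emb s *: (t *: z) - x); lra.
have Utz : U (x + t *: z) by have := Us 1; rewrite rmorph1 scale1r; apply; lra.
move=> v Bv; set g := dd f (tseq v ++ ys).
set l := dd f (tseq v ++ rcons ys z) x.
have gd y : U y -> has_ddir g y z (dd f (tseq v ++ rcons ys z) y).
  move=> Uy; rewrite -rcons_cat; apply: fn => //.
  by rewrite size_cat size_tseq ltn_add2l.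
have h : p (g (x + t *: z) - g x - t *: l) <= e / 2 * nm t.
  apply: (@mvt _ _ S E F p g x (t *: z)
    (fun s => t *: dd f (tseq v ++ rcons ys z) (x + emb s *: (t *: z)))) => s s01.
    exact: (has_ddir_scale S (a := t) (gd _ (Us s s01))).
  rewrite -scalerBr snZ mulrC ler_wpM2r ?nm_ge0//; apply: ltW.
  by apply: q1P => //; have [+ _] := qP (x + emb s *: (t *: z) - x); have := seg s s01; lra.
have -> : (t^-1 *: (H ys (x + t *: z) - H ys x)) v - H (rcons ys z) x v =
    t^-1 *: (g (x + t *: z) - g x - t *: l).
  rewrite [RHS]scalerBr scalerA mulVf// scale1r.
  rewrite [LHS](_ : _ = t^-1 *: (H ys (x + t *: z) v - H ys x v) - H (rcons ys z) x v)//.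
  by rewrite !HE//; exact: ltnW.
rewrite snZ nmV mulrC ltr_pdivrMr//.
by apply: le_lt_trans h _; rewrite ltr_pM2r//; lra.
Qed.

Let hL : hausdorff_space L := clin_hausdorff S hF.

(** The two sides agree only on [U], so each induction step transports the derivative by
    [has_ddir_ext]; uniqueness of limits in [clin] then determines the value chosen by [ddir]. *)
Let dd_fder ys : (size ys <= m)%N -> {in U, dd (fder b k f) ys =1 H ys}.
Proof.
elim/last_ind: ys => [_ x Ux|ys z IH].
  by rewrite /H /= /fder; congr insubd; apply/funext => v; rewrite cats0 dmapE.
rewrite size_rcons => ym x Ux; rewrite dd_rcons.
have fH : {in U, H ys =1 dd (fder b k f) ys}.
  by move=> y Uy; rewrite IH// ltnW.
apply: (ddirE hL).
exact: (has_ddir_ext S oU (set_mem Ux) fH (@H_ddir ys x z ym (set_mem Ux))).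
Qed.

Lemma dd_fderE ys x v : (size ys <= m)%N -> U x ->
  dd (fder b k f) ys x v = dd f (tseq v ++ ys) x.
Proof. by move=> ym Ux; rewrite dd_fder ?inE// HE. Qed.

Lemma fderE x : U x -> fder b k f x = @dmap K E F k f x :> (tpow k E -> F).
Proof.
move=> Ux; apply/funext => v.
by have := @dd_fderE [::] x v (leq0n _) Ux; rewrite cats0.
Qed.

Lemma fder_dmapE j x (y : tpow j E) v : (j <= m)%N -> U x ->
  dmap (fder b k f) x y v = dmap f x (tcat v y).
Proof.
by move=> jm Ux; rewrite dmapE dd_fderE ?size_tseq// dmapE tseq_tcat.
Qed.

Lemma fder_Cr : Cr U (fder b k f) m.
Proof.
have fd : has_derivs U (fder b k f) m.
  move=> ys ym x Ux z; rewrite dd_fder ?size_rcons ?inE//.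
  have fH : {in U, H ys =1 dd (fder b k f) ys}.
    by move=> y Uy; rewrite dd_fder// ltnW.
  exact: (has_ddir_ext S oU Ux fH (@H_ddir ys x z ym Ux)).
have fc : cont_derivs U (fder b k f) m.
  move=> j jm x Ux y; apply/(clin_cvgP S) => B bB p e e0.
  have [q qP] := uf jm Ux y bB p e0.
  have /(nbhs_snP S)[q2 q2U] : nbhs x U by exact: open_nbhs_nbhs.
  exists ([set x' | q (x' - x) < 1 /\ q2 (x' - x) < 1],
    [set y' : tpow j E | forall i, q (y' i - y i) < 1]).
    split; first by apply: filterI; exact: sn_ball.
    by apply/(tpow_nbhs_snP S); exists q.
  move=> [x' y'] [/= [xx' /q2U Ux'] yy'] v Bv.
  by rewrite !fder_dmapE//; exact: qP.
by split => //; exact: (linear_derivs_cont S hL oU fd fc).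
Qed.

End DerivativeMap.

(** * Maps of finite order *)

Definition real_scalars_real (R : realType) : real_scalars R R.
Proof.
exists (@idfun R : {rmorphism R -> R}) (@Num.norm R R) => //.
Defined.

Definition real_scalars_complex (R : realType) : real_scalars R R[i].
Proof.
exists (@real_complex R : {rmorphism R -> R[i]}) (fun z : R[i] => complex.Re `|z|).
- by move=> a b; rewrite lecR.
- by case=> x y; rewrite normc_def.
Defined.

Definition scalars_of (R : realType) (K : numFieldType) (s : scalar_field R K) :
    real_scalars R K :=
  match s in scalar_field _ K0 return real_scalars R K0 with
  | RealScalars => real_scalars_real R
  | ComplexScalars => real_scalars_complex R
  end.

Section SmoothMaps.
Context (R : realType) (K : numFieldType) (s : scalar_field R K)
  (E F : tvsType K) (hF : hausdorff_space F) (U : set E) (oU : open U).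
Local Notation S := (scalars_of s).
Implicit Types (f : E -> F) (r : smoothness).

Lemma within_openP (X Y : topologicalType) (A : set X) (g : X -> Y) : open A ->
  {within A, continuous g} <-> forall x, A x -> {for x, continuous g}.
Proof.
move=> oA; rewrite continuous_open_subspace//; split=> h x.
  by move=> Ax; apply: h; exact/mem_set.
by move=> /set_mem; exact: h.
Qed.

Lemma within_prodP (X Y Z : topologicalType) (A : set X) (g : X * Y -> Z) :
  open A -> {within A `*` setT, continuous g} <->
  forall x, A x -> forall y, {for (x, y), continuous g}.
Proof.
move=> oA; have oAT : open (A `*` [set: Y]).
  rewrite openE => -[x y] [/= Ax _]; exists (A, setT) => //=.
  by split; [exact: open_nbhs_nbhs|exact: filterT].
rewrite within_openP//; split=> [h x Ax y|h [x y] [/= Ax _]]; exact: h.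
Qed.

(** In [Cr] the continuity of [f] is the case [j = 0], where [tpow 0 E] is a point. Linearity in the
    directions is not part of [Cmap] and is supplied by [linear_derivs_cont]. *)
Lemma CmapP r f : r <> Analytic ->
  Cmap s r U f <-> forall n, leS n r -> Cr U f n.
Proof.
move=> rA.
have -> : Cmap s r U f = ({within U, continuous f} /\
    forall j : nat, (0 < j)%N -> leS j r ->
      (forall y : tpow j E, dmap_exists U f y) /\
      {within U `*` setT,
        continuous (fun p : E * tpow j E => dmap f p.1 p.2)}).
  by case: r rA.
rewrite within_openP//; split=> [[cf fr] n nr|fr]; last first.
  have r0 : leS 0 r by case: r {fr rA}.
  split=> [x Ux|j j0 jr].
    have [_ _ /(_ _ (leqnn _) x Ux (fun=> 0))] := fr _ r0.
    move=> /(joint_continuous_snP S) h.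
    apply/(continuous_snP S) => p e e0; have [q qP] := h p e e0.
    exists q => x' xx'; have := qP x' (fun=> 0) xx'.
    by rewrite /= !dmapE !(size0nil (size_tseq _)); apply => -[].
  have [fd _ fc] := fr _ jr; split.
    by move=> y; apply: (proj1 (has_derivsP U f j) fd); rewrite size_tseq.
  by apply/within_prodP => // x Ux y; exact: fc.
have nE m : (m <= n)%N -> leS m r.
  by case: r nr {rA fr} => //= l nl ml; exact: leq_trans nl.
have fd : has_derivs U f n.
  apply/has_derivsP => ys yn; have [y0|y0] := posnP (size ys).
    by rewrite (size0nil y0).
  have [/(_ (fun i => nth 0 ys i)) h _] := fr _ y0 (nE _ yn).
  by move: h; rewrite /dmap_exists -/(tseq _) tseq_nth.
have fc : cont_derivs U f n.
  move=> j jn x Ux y; have [j0|j0] := posnP j; last first.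
    have [_ /within_prodP] := fr _ j0 (nE _ jn).
    by apply.
  move: j0 jn y => -> _ y; apply/(joint_continuous_snP S) => p e e0.
  have [q qP] := proj1 (continuous_snP S f x) (cf x Ux) p e e0.
  exists q => x' y' xx' _ /=; rewrite !dmapE !(size0nil (size_tseq _)).
  exact: qP.
by split => //; exact: (linear_derivs_cont S hF oU fd fc).
Qed.

Definition order_in (b : bornology) r :=
  if b is OnCompact then r else subS r 1.

Lemma leSW n m r : (n <= m)%N -> leS m r -> leS n r.
Proof. by case: r => //= l nm; exact: leq_trans. Qed.

(** The hypothesis [leS 1 r] excludes the truncated difference [0 - 1 = 0], for which
    [k + m <= r - 1] would not give [k + m + 1 <= r]. *)
Lemma order_in_unif_cont b r f k m : leS 1 r ->
  (forall n, leS n r -> Cr U f n) -> leS (k + m) (order_in b r) ->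
  Cr U f (k + m) /\ forall j, (j <= m)%N -> unif_cont_derivs S U b f k j.
Proof.
move=> r1 fr; case: b => /= kmr.
  split=> [|j jm]; first exact: fr.
  apply: unif_cont_compact; have [_ _ fc] := fr _ kmr => l lj.
  by apply: fc; apply: leq_trans lj _; rewrite leq_add2l.
have kmr1 : leS (k + m).+1 r.
  by case: r r1 kmr {fr} => //= l l0; rewrite -(leq_add2r 1) addn1 subnK.
split=> [|j jm]; first by apply: fr; apply: leSW kmr1.
have kj : leS (k + j).+1 r by apply: leSW kmr1; rewrite ltnS leq_add2l.
have [fd fl fc] := fr _ kj.
have [_ _ fc'] := fr (k + j)%N ltac:(by apply: leSW kj).
apply: unif_cont_bounded => //; exact: cont_locbd.
Qed.

Section FderSmooth.
Variables (b : bornology) (r : smoothness) (f : E -> F) (k m : nat).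
Hypotheses (r1 : leS 1 r) (fr : forall n, leS n r -> Cr U f n).
Hypothesis kmr : leS (k + m) (order_in b r).

Lemma fder_smooth_val x : U x ->
  fder b k f x = @dmap K E F k f x :> (tpow k E -> F).
Proof.
have [fC fu] := order_in_unif_cont r1 fr kmr; exact: (fderE hF oU fC fu).
Qed.

Lemma fder_smooth_Cr : Cr U (fder b k f) m.
Proof.
have [fC fu] := order_in_unif_cont r1 fr kmr; exact: (fder_Cr hF oU fC fu).
Qed.

Lemma fder_smooth_dmap (y : tpow m E) : dmap_exists U (fder b k f) y /\
  forall x, U x -> forall v : tpow k E,
    dmap (fder b k f) x y v = dmap f x (tcat v y).
Proof.
have [fC fu] := order_in_unif_cont r1 fr kmr; split.
  have [fd _ _] := fder_smooth_Cr.
  by apply: (proj1 (has_derivsP U (fder b k f) m) fd); rewrite size_tseq.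
move=> x Ux v; exact: (fder_dmapE hF oU fC fu).
Qed.

End FderSmooth.
End SmoothMaps.

(** * Cauchy estimates *)

Section ClosedFieldRoots.
Context (C : closedFieldType).

Lemma prim_root_exists n : (0 < n)%N -> n%:R != 0 :> C ->
  exists z : C, n.-primitive_root z.
Proof.
move=> n0 nC; pose p : {poly C} := 'X^n - 1.
have [r Dp] := closed_field_poly_normal p.
rewrite (monicP _) ?monicXnsubC // scale1r in Dp.
have rn1 : all n.-unity_root r by apply/allP=> z; rewrite -root_prod_XsubC -Dp.
have sz_r : (n < (size r).+1)%N.
  by rewrite -(size_prod_XsubC r id) -Dp size_XnsubC.
have [|z _ zn] := hasP (has_prim_root n0 rn1 _ sz_r); last by exists z.
by rewrite -separable_prod_XsubC -Dp separable_Xn_sub_1.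
Qed.

End ClosedFieldRoots.

Lemma sum_prim_root (K : fieldType) N (w : K) m : N.-primitive_root w ->
  \sum_(j < N) (w ^+ j) ^+ m = if (N %| m)%N then N%:R else 0.
Proof.
move=> wN; have wm j : (w ^+ j) ^+ m = (w ^+ m) ^+ j by rewrite exprAC.
under eq_bigr do rewrite wm.
have := prim_order_dvd wN m => ->; case: eqP => [->|/eqP wm1].
  under eq_bigr do rewrite expr1n.
  by rewrite sumr_const card_ord.
have := subrX1 (w ^+ m) N; rewrite -exprM mulnC exprM (prim_expr_order wN) expr1n subrr.
by move=> /esym/eqP; rewrite mulf_eq0 subr_eq0 (negPf wm1) => /eqP.
Qed.

(** Discrete Fourier inversion. The exponent [N - k] stands for [- k], and for [i, k < N] the number
    [N - k + i] is a multiple of [N] only if [i = k]. *)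
Lemma coef_average (K : fieldType) (V : lmodType K) N (w : K) (a : nat -> V) k :
  N.-primitive_root w -> (k < N)%N ->
  \sum_(j < N) (w ^+ j) ^+ (N - k) *: \sum_(i < N) (w ^+ j) ^+ i *: a i
    = N%:R *: a k.
Proof.
move=> wN kN; under eq_bigr do rewrite scaler_sumr.
rewrite exchange_big /= (bigD1 (Ordinal kN)) //= [X in _ + X]big1 ?addr0.
  under eq_bigr do rewrite scalerA -exprD subnK 1?ltnW//.
  by rewrite -scaler_suml (sum_prim_root _ wN) dvdnn.
move=> i; rewrite -val_eqE /= => ik.
under eq_bigr do rewrite scalerA -exprD.
rewrite -scaler_suml (sum_prim_root _ wN) ifF ?scale0r//.
apply/negP => /dvdnP[q qE].
have iN := ltn_ord i.
have q1 : q = 1%N.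
  apply/eqP; rewrite eqn_leq; apply/andP; split.
    by rewrite -ltnS -(ltn_pmul2r (leq_ltn_trans (leq0n _) kN)) -qE; lia.
  by rewrite lt0n; apply/eqP => q0; move: qE; rewrite q0; lia.
by move: ik qE; rewrite q1; lia.
Qed.

Section CauchyEstimates.
Context (R : realType) (F : tvsType R[i]).
Local Notation S := (real_scalars_complex R).
Local Notation nm := (nm S).
Local Notation emb := (emb S).
Variable p : csn S F.

Lemma coef_bound N (a : nat -> F) (M : R) :
  (forall z, nm z = 1 -> p (\sum_(i < N) z ^+ i *: a i) <= M) ->
  forall k, (k < N)%N -> p (a k) <= M.
Proof.
move=> aM k kN; have N0 : (0 < N)%N by exact: leq_ltn_trans kN.
have NC : N%:R != 0 :> R[i] by rewrite pnatr_eq0 -lt0n.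
have [w wN] := prim_root_exists N0 NC.
have nw j m : nm ((w ^+ j) ^+ m) = 1.
  rewrite !nmX; suff -> : nm w = 1 by rewrite !expr1n.
  have : nm w ^+ N = 1 by rewrite -nmX (prim_expr_order wN) nm1.
  by move/eqP; rewrite pexpr_eq1 ?nm_ge0// => /eqP.
have NR : 0 < N%:R :> R by rewrite ltr0n.
rewrite -(ler_pM2l NR) -(nm_nat S) -snZ -(coef_average a wN kN).
apply: le_trans (sn_sum _ _ _ _) _.
apply: le_trans (_ : \sum_(j < N) M <= _).
  by apply: ler_sum => j _; rewrite snZ nw mul1r aM// -[w ^+ j]expr1 nw.
by rewrite sumr_const card_ord nm_nat mulr_natl.
Qed.

Lemma geom_half m n (a : nat -> F) (M : R) : 0 <= M -> (m <= n)%N ->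
  (forall i, (i < n)%N -> p (a i) <= M / 2 ^+ i) ->
  p (\sum_(i < n) a i - \sum_(i < m) a i) <= 2 * M / 2 ^+ m.
Proof.
move=> M0 mn aM.
(* The exact value of the geometric sum is needed for the induction on [n] to close. *)
suff : p (\sum_(i < n) a i - \sum_(i < m) a i) <= 2 * M / 2 ^+ m - 2 * M / 2 ^+ n.
  by have : 0 <= 2 * M / 2 ^+ n; [rewrite divr_ge0 ?mulr_ge0 ?exprn_ge0|lra].
elim: n mn aM => [|n IH] mn aM.
  by move: mn; rewrite leqn0 => /eqP ->; rewrite !subrr sn0.
move: mn; rewrite leq_eqVlt => /predU1P[->|]; first by rewrite !subrr sn0.
rewrite ltnS => /IH /(_ (fun i h => aM i (leqW h))) h; rewrite big_ord_recr /= addrAC.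
apply: le_trans (snD _ _ _) _; apply: le_trans (lerD h (aM n (ltnSn n))) _.
have -> : 2 * M / 2 ^+ n.+1 = M / 2 ^+ n.
  by rewrite exprS; field; rewrite gt_eqF// exprn_gt0.
by lra.
Qed.

Lemma half_pow_lt (M e : R) : 0 < e -> exists m, M / 2 ^+ m < e.
Proof.
move=> e0; exists (Num.bound (`|M| / e)).
have h := @archi_boundP R (`|M| / e) ltac:(by rewrite divr_ge0// ltW).
set n := Num.bound _ in h *.
have n2 : n%:R <= 2 ^+ n :> R.
  by rewrite -natrX ler_nat ltnW// ltn_expl.
rewrite ltr_pdivrMr ?exprn_gt0//.
apply: le_lt_trans (ler_norm M) _.
by move: h; rewrite ltr_pdivrMr// mulrC => h; apply: lt_le_trans h _; rewrite ler_pM2l.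
Qed.

Lemma half_pow_le (M : R) m n : (m <= n)%N -> `|M| / 2 ^+ n <= `|M| / 2 ^+ m.
Proof.
move=> mn; rewrite ler_wpM2l// lef_pV2 ?posrE ?exprn_gt0//.
by apply: ler_weXn2l => //; lra.
Qed.

Lemma cvg_sn_le (u : nat -> F) l c (M : R) : u @ \oo --> l ->
  (exists n0, forall n, (n0 <= n)%N -> p (u n - c) <= M) -> p (l - c) <= M.
Proof.
move=> /(cvg_snP S) ul [n0 uM]; apply/ler_addgt0Pr => e e0.
have [n1 _ n1P] := ul p e e0.
have := uM (maxn n0 n1) (leq_maxl _ _); have := n1P _ (leq_maxr n0 n1) => /=.
by have := sn_tri p l (u (maxn n0 n1)) c; rewrite (snBC p l (u _)); lra.
Qed.

(** Convergence on the unit circle is only pointwise, so partial sums need not be bounded by [M]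
    there, even approximately. On the circle of radius 1/2 the tails are geometrically small and
    [coef_bound] applies up to an error; this radius is the origin of the factor [2 ^+ k]. *)
Lemma power_series_bound (a : nat -> F) (phi : R[i] -> F) (M : R) :
  (forall z, nm z <= 1 -> series (fun n => z ^+ n *: a n) @ \oo --> phi z) ->
  (forall z, nm z <= 1 -> p (phi z) <= M) ->
  forall k, p (a k) <= 2 ^+ k * M.
Proof.
move=> aphi phiM k.
(* The terms of the series at [z = 1] are bounded: from [n0] on they are differences of two partial
   sums within 1 of the limit. *)
have [C C0 aC] : exists2 C : R, 0 <= C & forall n, p (a n) <= C.
  have := aphi 1; rewrite nm1 lexx => /(_ isT) /(cvg_snP S)/(_ p 1 ltr01)[n0 _ n0P].
  exists (2 + \sum_(i < n0) p (a i)).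
    by rewrite addr_ge0// sumr_ge0// => i _; exact: sn_ge0.
  move=> n; have [nn0|n0n] := ltnP n n0.
    rewrite (bigD1 (Ordinal nn0)) //= addrCA lerDl addr_ge0// sumr_ge0// => i _.
    exact: sn_ge0.
  have -> : a n = series (fun n => 1 ^+ n *: a n) n.+1 - phi 1
      - (series (fun n => 1 ^+ n *: a n) n - phi 1).
    rewrite opprB addrA subrK seriesS expr1n scale1r.
    by rewrite addrK.
  have := snB p (series (fun n => 1 ^+ n *: a n) n.+1 - phi 1)
     (series (fun n => 1 ^+ n *: a n) n - phi 1).
  have := n0P n n0n; have := n0P n.+1 (leqW n0n) => /=.
  have : 0 <= \sum_(i < n0) p (a i) by rewrite sumr_ge0// => i _; exact: sn_ge0.
  lra.
pose h : R := 2^-1; have h01 : 0 <= h <= 1 by rewrite /h; lra.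
have partM n z : nm z = 1 ->
    p (\sum_(i < n) z ^+ i *: (emb h ^+ i *: a i)) <= M + 2 * C / 2 ^+ n.
  move=> z1; have nzh : nm (emb h * z) = h by rewrite nmM z1 mulr1 nm_emb ger0_norm; lra.
  have zh1 : nm (emb h * z) <= 1 by rewrite nzh; lra.
  have E i : z ^+ i *: (emb h ^+ i *: a i) = (emb h * z) ^+ i *: a i.
    by rewrite scalerA exprMn mulrC.
  under eq_bigr do rewrite E.
  set s := \sum_(i < n) _.
  have : p (phi (emb h * z) - s) <= 2 * C / 2 ^+ n.
    apply: (cvg_sn_le (aphi _ zh1)); exists n => m lenm.
    rewrite /series /= big_mkord.
    apply: (@geom_half n m (fun i => (emb h * z) ^+ i *: a i)) => // i _.
    by rewrite snZ nmX nzh /h exprVn mulrC ler_wpM2r// invr_ge0 exprn_ge0.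
  have := phiM _ zh1; have := sn_leD p s (phi (emb h * z)).
  by rewrite snBC; lra.
have hk : p (emb h ^+ k *: a k) <= M.
  apply/ler_addgt0Pr => e e0; have [m mP] := half_pow_lt (2 * C) e0.
  (* Large enough for the truncation error to be below [e] and for [a k] to occur in the partial
     sum. *)
  pose N := (maxn m k.+1).
  have := @coef_bound N (fun i => emb h ^+ i *: a i) _ (partM N) k (leq_maxr _ _).
  have : 2 * C / 2 ^+ N <= 2 * C / 2 ^+ m.
    rewrite ler_wpM2l ?mulr_ge0// lef_pV2 ?posrE ?exprn_gt0//.
    by rewrite ler_eXn2l ?leq_maxl//; lra.
  lra.
move: hk; rewrite snZ nmX nm_emb ger0_norm; last by lra.
by rewrite /h exprVn mulrC ler_pdivrMr ?exprn_gt0// mulrC.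
Qed.

End CauchyEstimates.

(** * Homogeneous polynomials *)

Section TvsContinuity.
Context (K : numFieldType) (T : topologicalType) (F : tvsType K).
Implicit Types (f g : T -> F) (x : T).

Lemma tvs_continuousD f g x : {for x, continuous f} -> {for x, continuous g} ->
  {for x, continuous (fun y => f y + g y)}.
Proof.
move=> cf cg; apply: (@continuous2_cvg _ F F F (nbhs x) _ f g (fun u v => u + v)) => //.
exact: (@add_continuous F (f x, g x)).
Qed.

Lemma tvs_continuousZ (a : K) f x : {for x, continuous f} ->
  {for x, continuous (fun y => a *: f y)}.
Proof.
move=> cf; apply: (@continuous2_cvg _ K^o F F (nbhs x) _ (fun=> a) f
    (fun u v => u *: v)) => //.
  exact: (@scale_continuous K F (a, f x)).
exact: cvg_cst.
Qed.

Lemma tvs_continuous_sum (I : Type) (r : seq I) (h : I -> T -> F) x :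
  (forall i, {for x, continuous (h i)}) ->
  {for x, continuous (fun y => \sum_(i <- r) h i y)}.
Proof.
move=> ch; elim: r => [|i r IH].
  rewrite (_ : (fun y => _) = fun=> 0); first exact: cvg_cst.
  by apply/funext => y; rewrite big_nil.
rewrite (_ : (fun y => _) = fun y => h i y + \sum_(j <- r) h j y).
  exact: tvs_continuousD.
by apply/funext => y; rewrite big_cons.
Qed.

End TvsContinuity.

Section MultilinearExpansion.
Context (K : numFieldType) (E F : tvsType K).

(** Induction on the number [m] of coordinates already equal to [u + t w], the others being those of
    [y]. Splitting coordinate [m] leaves two instances of the hypothesis, one with [u] there and one
    with [w] and a factor [t]. The coefficients [c] must not depend on [t]. *)
Lemma multilinear_expand n (g : tpow n E -> F) (u w : E) : multilinear g ->
  exists c : nat -> F, forall t : K, g (fun=> u + t *: w) =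
    g (fun=> u) + t *: (\sum_i g (tset (fun=> u) i w))
    + t ^+ 2 *: \sum_(k < n) t ^+ k *: c k.
Proof.
move=> mg; pose z t m (y : tpow n E) : tpow n E :=
  fun i => if (i < m)%N then u + t *: w else y i.
have tz t m y (i : 'I_n) a : ~~ (i < m)%N -> tset (z t m y) i a = z t m (tset y i a).
  move=> im; apply/funext => j; rewrite /tset /z.
  by case: (eqVneq j i) => [->|//]; rewrite (negPf im).
have zS t m y (mn : (m < n)%N) :
    z t m.+1 y = tset (z t m y) (Ordinal mn) (t *: w + u).
  apply/funext => j; rewrite /tset /z ltnS leq_eqVlt -val_eqE /=.
  by case: eqP => [_|//]; rewrite addrC.
suff h m : (m <= n)%N -> forall y, exists c : nat -> F, forall t : K,
    g (z t m y) = g (z 0 m y)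
      + t *: (\sum_(i < n | (i < m)%N) g (tset (z 0 m y) i w))
      + t ^+ 2 *: \sum_(k < m) t ^+ k *: c k.
  have [c cP] := h n (leqnn n) (fun=> 0); exists c => t.
  have zn s : z s n (fun=> 0) = (fun=> u + s *: w).
    by apply/funext => i; rewrite /z ltn_ord.
  have := cP t; rewrite !zn scale0r addr0 => ->.
  congr (_ + _ *: _ + _); apply: eq_bigl => i.
  by rewrite ltn_ord.
elim: m => [|m IH] mn y.
  exists (fun=> 0) => t; rewrite big_pred0// big_ord0.
  by rewrite !scaler0 !addr0; congr g; apply/funext => i; rewrite /z !ltn0.
pose i0 := Ordinal mn.
have [cw cwP] := IH (ltnW mn) (tset y i0 w).
have [cu cuP] := IH (ltnW mn) (tset y i0 u).
have i0m : ~~ (i0 < m)%N by rewrite ltnn.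
have z0S : z 0 m.+1 y = z 0 m (tset y i0 u).
  by rewrite (zS 0 m y mn) scale0r add0r tz.
(* The extra factor [t] shifts the [w] instance by one degree: its linear term becomes the
   coefficient of [t ^+ 2], and its [cw k'] moves to index [k'.+1]. *)
exists (fun k => (if (k < m)%N then cu k else 0)
  + (if k is k'.+1 then cw k'
     else \sum_(i < n | (i < m)%N) g (tset (z 0 m (tset y i0 w)) i w))) => t.
rewrite {1}(zS t m y mn) mg !tz// cwP cuP z0S.
rewrite [in RHS](bigD1 i0) /=; last by rewrite ltnS leqnn.
have -> : tset (z 0 m (tset y i0 u)) i0 w = z 0 m (tset y i0 w).
  rewrite tz//; congr (z _ _ _); apply/funext => j; rewrite /tset.
  by case: eqP.
rewrite [X in _ = _ + _ *: (_ + X) + _](eq_bigl (fun i : 'I_n => (i < m)%N)); last first.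
  by move=> i; rewrite -val_eqE /= ltnS ltn_neqAle andbC.
have -> : \sum_(k < m.+1) t ^+ k *: ((if (k < m)%N then cu k else 0) +
      match (k : nat) with
      | 0%N => \sum_(i < n | (i < m)%N) g (tset (z 0 m (tset y i0 w)) i w)
      | k'.+1 => cw k' end) =
    \sum_(k < m) t ^+ k *: cu k
    + (\sum_(i < n | (i < m)%N) g (tset (z 0 m (tset y i0 w)) i w)
    + t *: \sum_(k < m) t ^+ k *: cw k).
  under eq_bigr do rewrite scalerDr.
  rewrite big_split /=; congr (_ + _).
    rewrite big_ord_recr /= ltnn scaler0 addr0.
    by apply: eq_bigr => k _; rewrite ltn_ord.
  rewrite big_ord_recl /= expr0 scale1r; congr (_ + _).
  by rewrite scaler_sumr; apply: eq_bigr => k _; rewrite scalerA exprS.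
set Bw := \sum_(i < n | _) g (tset (z 0 m (tset y i0 w)) i w).
set Bu := \sum_(i < n | _) g (tset (z 0 m (tset y i0 u)) i w).
set Cw := \sum_(k < m) _ *: cw _; set Cu := \sum_(k < m) _ *: cu _.
module K.
Qed.

Lemma homogeneous_derivative_poly n (g : tpow n E -> F) (v : E) : multilinear g ->
  homogeneous_poly n.-1 (fun u => \sum_i g (tset (fun=> u) i v)).
Proof.
case: n g => [|n] g mg.
  exists (fun=> 0) => [[]//|y]; by rewrite big_ord0.
pose ins (i : 'I_n.+1) (y : tpow n E) : tpow n.+1 E :=
  fun j => if unlift i j is Some j' then y j' else v.
have insE i y j a : ins i (tset y j a) = tset (ins i y) (lift i j) a.
  apply/funext => l; rewrite /ins /tset; case: unliftP => [l' ->|->].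
    by rewrite (inj_eq lift_inj).
  by rewrite (negPf (neq_lift _ _)).
exists (fun y => \sum_i g (ins i y)).
  move=> j y a b c; rewrite scaler_sumr -big_split; apply: eq_bigr => i _ /=.
  by rewrite !insE mg.
move=> u; apply: eq_bigr => i _; congr g; apply/funext => j; rewrite /ins /tset.
by case: unliftP => [l ->|->]; rewrite ?eqxx// eq_sym (negPf (neq_lift _ _)).
Qed.

Lemma homogeneousZ n (h : E -> F) c y : homogeneous_poly n h ->
  h (c *: y) = c ^+ n *: h y.
Proof.
by move=> [g mg hg]; rewrite !hg; exact: (multilinear_scale c (fun=> y) mg).
Qed.

End MultilinearExpansion.

Section HomogeneousDerivative.
Context (R : realType) (E F : tvsType R[i]).

(* The coefficients of a polynomial curve, in the shape produced by
   [multilinear_expand]. *)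
Definition taylor_coef (a0 a1 : F) (c : nat -> F) (k : nat) : F :=
  match k with 0%N => a0 | 1%N => a1 | k'.+2 => c k' end.

Lemma taylor_coefE n a0 a1 c (t : R[i]) :
  \sum_(k < n.+2) t ^+ k *: taylor_coef a0 a1 c k =
  a0 + t *: a1 + t ^+ 2 *: \sum_(k < n) t ^+ k *: c k.
Proof.
rewrite !big_ord_recl /= expr0 scale1r expr1 addrA; congr (_ + _).
by rewrite scaler_sumr; apply: eq_bigr => k _; rewrite scalerA -exprD.
Qed.

(** [D u v] is the derivative of [h] at [u] in direction [v]. The multilinear map behind [h] is not
    assumed continuous; continuity of [D^~ v] is inherited from [h], since [D u v] is the
    coefficient of [t] in [h (u + t v)] and thus an average of values of [h] over roots of unity. *)
Lemma homogeneous_derivative n (h : E -> F) : continuous h ->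
  homogeneous_poly n h -> exists D : E -> E -> F,
  [/\ (forall u v, exists c : nat -> F, forall t : R[i],
        h (u + t *: v) = \sum_(k < n.+2) t ^+ k *: taylor_coef (h u) (D u v) c k),
      (forall v, continuous (D^~ v) /\ homogeneous_poly n.-1 (D^~ v)),
      (forall u a v w, D u (a *: v + w) = a *: D u v + D u w),
      (forall u, D u u = n%:R *: h u) &
      (n = 0%N -> forall u v, D u v = 0)].
Proof.
move=> ch [g mg hg]; pose D u v := \sum_i g (tset (fun=> u) i v).
have Dexp u v : exists c : nat -> F, forall t : R[i],
    h (u + t *: v) = \sum_(k < n.+2) t ^+ k *: taylor_coef (h u) (D u v) c k.
  have [c cP] := multilinear_expand u v mg; exists c => t.
  by rewrite taylor_coefE !hg cP.
exists D; split => //.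
- move=> v; split; last exact: homogeneous_derivative_poly.
  have NC : n.+2%:R != 0 :> R[i] by rewrite pnatr_eq0.
  have [w wN] := prim_root_exists (ltn0Sn n.+1) NC.
  have DE u : D u v = n.+2%:R^-1 *:
      \sum_(j < n.+2) (w ^+ j) ^+ (n.+2 - 1) *: h (u + w ^+ j *: v).
    have [c cP] := Dexp u v.
    under eq_bigr do rewrite cP.
    by rewrite (coef_average _ wN)// scalerA mulVf// scale1r.
  move=> u; rewrite /continuous_at DE.
  rewrite (_ : D^~ v = fun u => n.+2%:R^-1 *:
      \sum_(j < n.+2) (w ^+ j) ^+ (n.+2 - 1) *: h (u + w ^+ j *: v)); last first.
    by apply/funext => u'; exact: DE.
  apply: tvs_continuousZ; apply: tvs_continuous_sum => j; apply: tvs_continuousZ.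
  apply: (@continuous_comp _ _ _ (fun u => u + w ^+ j *: v) h); last exact: ch.
  apply: tvs_continuousD; first exact: cvg_id.
  exact: cvg_cst.
- move=> u a v w; rewrite /D scaler_sumr -big_split; apply: eq_bigr => i _ /=.
  by rewrite mg.
- move=> u; rewrite /D hg; under eq_bigr => i _.
    rewrite (_ : tset (fun=> u) i u = (fun=> u)); last first.
      by apply/funext => j; rewrite /tset; case: eqP.
    over.
  by rewrite sumr_const card_ord scaler_nat.
- move=> n0 u v; rewrite /D big1// => i; have := ltn_ord i.
  by rewrite [X in (_ < X)%N]n0.
Qed.

End HomogeneousDerivative.

(** * Power series *)

Section Disc.
Context (R : realType).
Local Notation S := (real_scalars_complex R).
Local Notation nm := (nm S).
Local Notation emb := (emb S).

Lemma nm_i : nm 'i%C = 1.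
Proof.
apply: (@emb_inj _ _ S).
by rewrite emb_nm rmorph1 normc_def /= expr0n expr1n add0r sqrtr1.
Qed.

Lemma complex_split (z : R[i]) :
  z = emb (complex.Re z) + 'i%C * emb (complex.Im z).
Proof. exact: complexE. Qed.

Lemma nm_ReIm (a b : R) : nm (emb a + 'i%C * emb b) <= `|a| + `|b|.
Proof.
by apply: le_trans (nmD _ _ _) _; rewrite nmM nm_i mul1r !nm_emb.
Qed.

Lemma Re_le_nm (z : R[i]) : `|complex.Re z| <= nm z.
Proof. by rewrite -lecR; have := normc_ge_Re z; rewrite -(emb_nm S). Qed.

Lemma Im_le_nm (z : R[i]) : `|complex.Im z| <= nm z.
Proof. by rewrite -lecR; have := normc_ge_Im z; rewrite -(emb_nm S). Qed.

(** The compactness used is that of the square with half-side [r]. It contains the disc of radius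
    [r] and lies in that of radius [2 * r], hence the two radii. *)
Lemma disc_near (I : Type) (G : set_system I) (FG : Filter G)
    (P : I -> R[i] -> Prop) (r : R) :
  (forall z, nm z <= 2 * r -> exists2 d, 0 < d &
     \forall i \near G, forall z', nm (z' - z) < d -> P i z') ->
  \forall i \near G, forall z, nm z <= r -> P i z.
Proof.
move=> loc.
have /compact_near_coveringP cA : compact (`[-r, r] `*` `[-r, r] : set (R * R)).
  by apply: compact_setX; exact: segment_compact.
have H : \forall i \near G,
    `[-r, r] `*` `[-r, r] `<=` (fun ab : R * R => P i (emb ab.1 + 'i%C * emb ab.2)).
  apply: (cA I G (fun i ab => P i (emb ab.1 + 'i%C * emb ab.2)) FG).
  move=> [a b] [/= ha hb].
  have ar : `|a| <= r by move: ha; rewrite in_itv /= ler_norml.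
  have br : `|b| <= r by move: hb; rewrite in_itv /= ler_norml.
  have [|d d0 dP] := loc (emb a + 'i%C * emb b).
    by apply: le_trans (nm_ReIm _ _) _; lra.
  have d2 : 0 < d / 2 by lra.
  exists ([set ab : R * R | `|ab.1 - a| < d / 2 /\ `|ab.2 - b| < d / 2],
     [set i | forall z', nm (z' - (emb a + 'i%C * emb b)) < d -> P i z']).
    split => //=; exists ([set a' | `|a' - a| < d / 2], [set b' | `|b' - b| < d / 2]).
      split; apply/nbhs_ballP; exists (d / 2) => // y.
        by rewrite /ball /= /ball_ distrC.
      by rewrite /ball /= /ball_ distrC.
    by move=> [a' b'].
  move=> [[a' b'] i] [/= [aa' bb'] iP]; apply: iP.
  have -> : emb a' + 'i%C * emb b' - (emb a + 'i%C * emb b) =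
      emb (a' - a) + 'i%C * emb (b' - b) by rewrite !rmorphB; ring.
  by apply: le_lt_trans (nm_ReIm _ _) _; lra.
apply: filterS H => i H z zr.
rewrite [z]complex_split; apply: (H (complex.Re z, complex.Im z)).
split; rewrite /= in_itv /= -ler_norml; first exact: le_trans (Re_le_nm z) _.
exact: le_trans (Im_le_nm z) _.
Qed.

End Disc.

Lemma tvs_cvgB (K : numFieldType) (F : tvsType K) (u v : nat -> F) a b :
  u @ \oo --> a -> v @ \oo --> b -> (fun n => u n - v n) @ \oo --> a - b.
Proof.
move=> ua vb; apply: (@continuous2_cvg _ F F F \oo _ u v (fun u v => u - v)) => //.
exact: (@sub_continuous F (a, b)).
Qed.

Section PowerSeries.
Context (R : realType) (E F : tvsType R[i]).
Local Notation S := (real_scalars_complex R).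
Local Notation nm := (nm S).
Local Notation emb := (emb S).
Local Notation csnE := (csn S E).
Local Notation csnF := (csn S F).
Implicit Types (f : E -> F) (x u v : E) (q : csnE) (h : nat -> E -> F)
  (D : nat -> E -> E -> F).

Definition expansion f x q h :=
  (forall n, continuous (h n) /\ homogeneous_poly n (h n)) /\
  (forall y, q y < 1 -> series (fun n => h n y) @ \oo --> f (x + y)).

Definition derivative_seq h D := forall n,
  [/\ (forall u v, exists c : nat -> F, forall t : R[i],
        h n (u + t *: v) =
        \sum_(k < n.+2) t ^+ k *: taylor_coef (h n u) (D n u v) c k),
      (forall v, continuous (D n ^~ v) /\ homogeneous_poly n.-1 (D n ^~ v)),
      (forall u a v w, D n u (a *: v + w) = a *: D n u v + D n u w),
      (forall u, D n u u = n%:R *: h n u) &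
      (n = 0%N -> forall u v, D n u v = 0)].

Lemma derivative_seq_exists f x q h : expansion f x q h ->
  exists D, derivative_seq h D.
Proof.
move=> [hh _].
have H n := homogeneous_derivative (proj1 (hh n)) (proj2 (hh n)).
by have [D DP] := choice H; exists D => n; exact: DP.
Qed.

Section Estimates.
Variables (f : E -> F) (x : E) (q : csnE) (h : nat -> E -> F)
  (D : nat -> E -> E -> F) (p : csnF) (u v : E) (M : R).
Hypotheses (fh : expansion f x q h) (hD : derivative_seq h D)
  (quv : q u + q v < 4^-1)
  (fM : forall z t, nm z <= 4 -> nm t <= 4 ->
    p (f (x + (z *: u + t *: v))) <= M).

Let M0 : 0 <= M.
Proof.
by apply: le_trans (sn_ge0 p _) (fM (z := 0) (t := 0) _ _); rewrite nm0.
Qed.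

Let quvt t : nm t <= 1 -> q (u + t *: v) < 4^-1.
Proof.
move=> t1; apply: le_lt_trans (snD _ _ _) _; rewrite snZ.
have : nm t * q v <= q v by rewrite ler_piMl ?sn_ge0.
by have := sn_ge0 q u; have := quv; lra.
Qed.

(** [power_series_bound] at [4 (u + t v)] loses a factor [2 ^+ n], while homogeneity gains [4 ^+ n].
    The dilation by 4 explains the bound [4^-1] for [q u + q v] and the radii 4 in the hypothesis on
    [f]. *)
Lemma term_bound n t : nm t <= 1 -> p (h n (u + t *: v)) <= M / 2 ^+ n.
Proof.
move=> t1; have [hh fcv] := fh; have [_ hom] := hh n.
have n4 : nm (4%:R : R[i]) = 4 by rewrite nm_nat.
pose y := 4%:R *: (u + t *: v).
have qy : q y < 1 by rewrite /y snZ n4; have := quvt t1; lra.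
have := @power_series_bound _ F p (fun n => h n y) (fun z => f (x + z *: y)) M.
move=> /(_ _ _ n) H.
have {H} : p (h n y) <= 2 ^+ n * M.
  apply: H => z z1.
    rewrite [X in series X](_ : _ = fun n => h n (z *: y)); last first.
      by apply/funext => m; have [_ hm] := hh m; rewrite (homogeneousZ z y hm).
    apply: fcv; rewrite snZ; apply: le_lt_trans qy.
    by rewrite ler_piMl ?sn_ge0.
  have -> : z *: y = (z * 4%:R) *: u + (z * (4%:R * t)) *: v.
    by rewrite /y; module R[i].
  have nz := nm_ge0 S z; have nt := nm_ge0 S t.
  apply: fM; rewrite !nmM n4; first by lra.
  have : nm z * nm t <= 1 by apply: mulr_ile1.
  by move=> ?; rewrite mulrCA; lra.
rewrite (homogeneousZ _ _ hom) snZ nmX n4 (_ : 4 = 2 * 2 :> R); last by lra.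
rewrite exprMn -mulrA ler_pM2l ?exprn_gt0// => H.
by rewrite ler_pdivlMr ?exprn_gt0// mulrC.
Qed.

Lemma coef_bounds n (c : nat -> F) (k : nat) : (k < n.+2)%N ->
  (forall t : R[i], h n (u + t *: v) =
     \sum_(k < n.+2) t ^+ k *: taylor_coef (h n u) (D n u v) c k) ->
  p (taylor_coef (h n u) (D n u v) c k) <= M / 2 ^+ n.
Proof.
move=> kn cP; apply: (@coef_bound _ F p n.+2) => // z z1.
by rewrite -cP; apply: term_bound; rewrite z1.
Qed.

Lemma derivative_term_bound n : p (D n u v) <= M / 2 ^+ n.
Proof.
have [/(_ u v)[c cP] _ _ _ _] := hD n.
exact: (@coef_bounds n c 1).
Qed.

Lemma remainder_bound n t : nm t <= 2^-1 ->
  p (h n (u + t *: v) - h n u - t *: D n u v) <= 2 * nm t ^+ 2 * M / 2 ^+ n.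
Proof.
move=> t2; have [/(_ u v)[c cP] _ _ _ _] := hD n.
rewrite cP taylor_coefE; set C := \sum_(k < n) _.
have -> : h n u + t *: D n u v + t ^+ 2 *: C - h n u - t *: D n u v = t ^+ 2 *: C.
  by module R[i].
rewrite /C {C}.
rewrite snZ nmX.
have Mn0 : 0 <= M / 2 ^+ n by rewrite divr_ge0// exprn_ge0.
have := @geom_half _ F p 0 n (fun k => t ^+ k *: c k) (M / 2 ^+ n) Mn0 (leq0n n).
rewrite big_ord0 subr0 expr0 divr1 => H.
have {}H : p (\sum_(k < n) t ^+ k *: c k) <= 2 * (M / 2 ^+ n).
  apply: H => k kn; rewrite snZ nmX.
  have ck := @coef_bounds n c k.+2 kn cP.
  have tk : nm t ^+ k <= (2 ^+ k)^-1.
    by rewrite -exprVn; apply: lerXn2r; rewrite ?nnegrE ?nm_ge0.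
  rewrite mulrC; apply: ler_pM => //; first exact: sn_ge0.
  by rewrite exprn_ge0 ?nm_ge0.
rewrite -[leRHS](_ : nm t ^+ 2 * (2 * (M / 2 ^+ n)) = _); last by ring.
by rewrite ler_wpM2l// exprn_ge0// nm_ge0.
Qed.

(* Summing [remainder_bound] over n, and the tail by [derivative_term_bound]. *)
Lemma expansion_remainder t m : nm t <= 2^-1 ->
  p (f (x + (u + t *: v)) - f (x + u) - t *: \sum_(n < m) D n u v) <=
  4 * M * nm t ^+ 2 + nm t * (2 * M / 2 ^+ m).
Proof.
move=> t2; have [_ fcv] := fh.
have qu : q u < 1 by have := sn_ge0 q v; have := quv; lra.
have qut : q (u + t *: v) < 1 by have := @quvt t; lra.
have cv := tvs_cvgB (fcv _ qut) (fcv _ qu).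
apply: (cvg_sn_le cv); exists m => n mn.
rewrite /series /= !big_mkord -sumrB.
have -> : \sum_(i < n) (h i (u + t *: v) - h i u) - t *: \sum_(i < m) D i u v =
    \sum_(i < n) (h i (u + t *: v) - h i u - t *: D i u v)
    + t *: (\sum_(i < n) D i u v - \sum_(i < m) D i u v).
  by rewrite [in RHS]sumrB -scaler_sumr; module R[i].
apply: le_trans (snD _ _ _) _; apply: lerD.
  have M20 : 0 <= 2 * nm t ^+ 2 * M.
    by apply: mulr_ge0 => //; apply: mulr_ge0 => //; rewrite exprn_ge0// nm_ge0.
  have := @geom_half _ F p 0 n
    (fun i => h i (u + t *: v) - h i u - t *: D i u v) _ M20 (leq0n n).
  rewrite big_ord0 subr0 expr0 divr1 => H.
  rewrite [leRHS](_ : _ = 2 * (2 * nm t ^+ 2 * M)); last by ring.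
  by apply: H => i _; exact: remainder_bound.
rewrite snZ ler_wpM2l ?nm_ge0//.
apply: (@geom_half _ F p m n (fun i => D i u v)) => // i _.
exact: derivative_term_bound.
Qed.

(** The derivative [l] is assumed to exist. The increment of [f] over one small real step [r] is
    compared with [l] and with the partial sum; after division by [r] only the tail and an
    arbitrarily small error remain. *)
Lemma derivative_series_bound m l : has_ddir f (x + u) v l ->
  p (l - \sum_(n < m) D n u v) <= 2 * M / 2 ^+ m.
Proof.
move=> /(has_ddirP S) fl; apply/ler_addgt0Pr => e e0.
have e2 : 0 < e / 2 by lra.
have [d d0 dP] := fl p (e / 2) e2.
have M41 : 0 < 4 * M + 1 by have := M0; lra.
(* The three bounds serve the definition of [l], the condition of [expansion_remainder], and the
   quadratic error, which becomes at most [r * (e / 2)]. *)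
pose r := Num.min (d / 2) (Num.min 2^-1 (e / 2 / (4 * M + 1))).
have r0 : 0 < r by rewrite !lt_min !divr_gt0 ?invr_gt0 ?ltr0n.
have rd : r < d by apply: (@le_lt_trans _ _ (d / 2)); [rewrite ge_min lexx|lra].
have r2 : r <= 2^-1 by rewrite !ge_min lexx orbT.
have rM : r * (4 * M + 1) <= e / 2 by rewrite -ler_pdivlMr// !ge_min lexx !orbT.
have nr : nm (emb r) = r by rewrite nm_emb gtr0_norm.
have h1 := dP (emb r); rewrite nr in h1; have {}h1 := h1 rd.
have h2 := @expansion_remainder (emb r) m; rewrite nr in h2; have {}h2 := h2 r2.
rewrite -(ler_pM2l r0) -{1}nr -snZ.
have -> : emb r *: (l - \sum_(n < m) D n u v) =
  (f (x + (u + emb r *: v)) - f (x + u) - emb r *: \sum_(n < m) D n u v)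
  - (f (x + u + emb r *: v) - f (x + u) - emb r *: l).
  by rewrite -(addrA x u); module R[i].
apply: le_trans (snB _ _ _) _; apply: le_trans (lerD h2 h1) _.
have -> : 4 * M * r ^+ 2 = r * (r * (4 * M)) by ring.
have : r * (r * (4 * M)) <= r * (e / 2).
  by rewrite ler_pM2l//; apply: le_trans rM; rewrite ler_pM2l//; lra.
move: (2 * M / 2 ^+ m) => A; rewrite mulrDr; lra.
Qed.

End Estimates.
End PowerSeries.

(** * Local expansions of complex analytic maps and derivatives at their centres *)

Section ComplexAnalytic.
Context (R : realType) (E F : tvsType R[i]) (hF : hausdorff_space F)
  (U : set E) (oU : open U).
Local Notation S := (real_scalars_complex R).
Local Notation nm := (nm S).
Local Notation emb := (emb S).
Local Notation csnE := (csn S E).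
Local Notation csnF := (csn S F).
Implicit Types (f : E -> F) (x u v : E) (q : csnE) (h : nat -> E -> F)
  (D : nat -> E -> E -> F).

Definition expands_at f x q h :=
  (forall y, q y < 1 -> U (x + y)) /\ expansion f x q h.

Definition locally_expandable f := (forall x, U x -> {for x, continuous f}) /\
  forall x, U x -> exists q h, expands_at f x q h.

Lemma complex_analyticP f : complex_analytic U f <-> locally_expandable f.
Proof.
rewrite /complex_analytic within_openP//; split=> -[cf fU]; split=> // x Ux.
  have [Y [/(nbhs_snP S)[q qY] YU [h [hh fh]]]] := fU x Ux.
  exists q, h; split=> [y qy|]; first by apply/YU/qY; rewrite subr0.
  by split => // y qy; apply/fh/qY; rewrite subr0.
have [q [h [qU [hh fh]]]] := fU x Ux; exists [set y | q y < 1]; split => //.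
  exact: sn_ball0.
by exists h.
Qed.

(** The disc of multiples of [u] is compact. The natural number in the product filter plays the part
    of the bound [M]. As [disc_near] inspects the radius 8, the points remain in [U] by
    [8 * q u < 1], which [16^-1] guarantees. *)
Lemma near_disc_bound f x q u (p : csnF) :
  (forall z, U z -> {for z, continuous f}) ->
  (forall y, q y < 1 -> U (x + y)) -> q u < 16^-1 ->
  exists (M : R) q', forall w, q' w < 1 -> forall z, nm z <= 4 ->
    p (f (x + (z *: u + w))) <= M.
Proof.
move=> cf qU qu; pose G := filter_prod (nbhs (0 : E)) (nbhs \oo).
have FG : Filter G by exact: filter_prod_filter.
have [|[A N] [/= /(nbhs_snP S)[q' q'A] [n0 _ n0N]] AN] :=
    @disc_near R _ G FG (fun wn z => p (f (x + (z *: u + wn.1))) <= wn.2%:R) 4.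
  move=> z z8.
  have Uz : U (x + z *: u).
    apply: qU; rewrite snZ.
    have : nm z * q u <= 2 * 4 * q u by rewrite ler_wpM2r ?sn_ge0.
    lra.
  have /(continuous_snP S)/(_ p 1 ltr01)[q1 q1P] := cf _ Uz.
  have c0 : 0 < 2 * (q1 u + 1) by have := sn_ge0 q1 u; lra.
  exists (2 * (q1 u + 1))^-1; first by rewrite invr_gt0.
  pose B := p (f (x + z *: u)) + 1.
  have B0 : 0 <= B by have := sn_ge0 p (f (x + z *: u)); rewrite /B; lra.
  exists ([set w | q1 w < 2^-1], [set n | (Num.bound B <= n)%N]).
    split => /=; first by apply: sn_ball0; lra.
    by exists (Num.bound B).
  move=> [w n] [/= qw nB] z' z'z.
  have {}z'z : nm (z' - z) * (2 * (q1 u + 1)) < 1 by rewrite -ltr_pdivlMr// div1r.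
  have Bn : B <= n%:R.
    by apply: le_trans (ltW (archi_boundP B0)) _; rewrite ler_nat.
  apply: le_trans Bn.
  have : p (f (x + (z' *: u + w)) - f (x + z *: u)) < 1.
    apply: q1P; have -> : x + (z' *: u + w) - (x + z *: u) = (z' - z) *: u + w.
      by module R[i].
    apply: le_lt_trans (snD _ _ _) _; rewrite snZ.
    by have := nm_ge0 S (z' - z); lra.
  by have := sn_leD p (f (x + (z' *: u + w))) (f (x + z *: u)); rewrite /B; lra.
exists n0%:R, q' => w qw z z4.
by apply: (AN (w, n0)) => //; split; [apply: q'A; rewrite subr0|apply: n0N => /=].
Qed.

Lemma derivative_seqZ h D n u (a : R[i]) v : derivative_seq h D ->
  D n u (a *: v) = a *: D n u v.
Proof.
move=> /(_ n)[_ _ Dl _ _]; have := Dl u (-1) 0 0.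
rewrite scaler0 addr0 scaleN1r addNr => D0.
by have := Dl u a v 0; rewrite D0 !addr0.
Qed.

Lemma derivative_sum0 h D m v : derivative_seq h D -> (1 < m)%N ->
  \sum_(n < m) D n 0 v = D 1%N 0 v.
Proof.
move=> hD; case: m => [|[|m]]// _; rewrite !big_ord_recl /=.
have [_ _ _ _ ->//] := hD 0%N; rewrite add0r big1 ?addr0// => i _.
have [_ /(_ v)[_ hom] _ _ _] := hD i.+2.
have /= := homogeneousZ 0 (0 : E) hom.
by rewrite scaler0 expr0n scale0r.
Qed.

Section Expansion.
Variables (f : E -> F) (x : E) (q : csnE) (h : nat -> E -> F)
  (D : nat -> E -> E -> F).
Hypotheses (cf : forall z, U z -> {for z, continuous f}) (Ux : U x)
  (fh : expands_at f x q h) (hD : derivative_seq h D).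

Let qU y : q y < 1 -> U (x + y). Proof. by case: fh => + _; exact. Qed.
Let fx : expansion f x q h. Proof. by case: fh. Qed.

Lemma near_center_bound (p : csnF) :
  exists q', (forall y, q y <= q' y) /\ forall w, q' w < 1 ->
    p (f (x + w)) <= p (f x) + 1.
Proof.
have /(continuous_snP S)/(_ p 1 ltr01)[q1 q1P] := cf Ux.
have [q' q'P] := csn_max q q1; exists q'; split=> [y|w qw]; first by case: (q'P y).
have := q1P (x + w); rewrite addrAC subrr add0r => H.
have {H} : p (f (x + w) - f x) < 1 by apply: H; have [_] := q'P w; lra.
by have := sn_leD p (f (x + w)) (f x); lra.
Qed.

Lemma derivative_approx_scaled (p : csnF) q' u v (r M : R) l m : 0 < r ->
  (forall y, q y <= q' y) -> q u + q (emb r *: v) < 4^-1 ->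
  (forall z t, nm z <= 4 -> nm t <= 4 ->
    p (f (x + (z *: u + t *: (emb r *: v)))) <= M) ->
  has_ddir f (x + u) v l ->
  p (l - \sum_(n < m) D n u v) <= 2 * M / r / 2 ^+ m.
Proof.
move=> r0 qq' quv fM fl.
have := derivative_series_bound fx hD quv fM m (has_ddir_scale S (a := emb r) fl).
under eq_bigr do rewrite (derivative_seqZ _ _ _ _ hD).
rewrite -scaler_sumr -scalerBr snZ nm_emb gtr0_norm// => H.
by rewrite mulrAC ler_pdivlMr// mulrC.
Qed.

(** At the centre all terms [D n 0 v] vanish except for [n = 1], so the limit is available without
    completeness of F, and letting the number of terms grow in [expansion_remainder] leaves a
    quadratic error. *)
Lemma has_ddir_center v : has_ddir f x v (D 1%N 0 v).
Proof.
apply/(has_ddirP S) => p e e0.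
have [q' [qq' q'M]] := near_center_bound p.
set M := p (f x) + 1 in q'M.
have M0 : 0 < M by have := sn_ge0 p (f x); rewrite /M; lra.
have qv := sn_ge0 q' v.
pose r := (8 * (q' v + 1))^-1; have r0 : 0 < r by rewrite invr_gt0; lra.
have rv : r * q' v < 8^-1.
  rewrite /r invfM -mulrA gtr_pMr ?invr_gt0// mulrC ltr_pdivrMr; lra.
have q'r : q' (emb r *: v) < 8^-1 by rewrite snZ nm_emb gtr0_norm.
have quv : q 0 + q (emb r *: v) < 4^-1.
  by rewrite sn0; have := qq' (emb r *: v); lra.
have fM z t : nm z <= 4 -> nm t <= 4 ->
    p (f (x + (z *: (0 : E) + t *: (emb r *: v)))) <= M.
  move=> _ t4; rewrite scaler0 add0r; apply: q'M; rewrite snZ.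
  have : nm t * q' (emb r *: v) <= 4 * q' (emb r *: v).
    by rewrite ler_wpM2r ?sn_ge0.
  lra.
have key t : nm t <= 2^-1 ->
    p (f (x + t *: (emb r *: v)) - f x - t *: (emb r *: D 1%N 0 v))
    <= 4 * M * nm t ^+ 2.
  move=> t2; apply/ler_addgt0Pr => e' e'0.
  have [m mP] := half_pow_lt (2 * M) e'0.
  have := expansion_remainder fx hD quv fM m.+2 t2.
  rewrite add0r addr0 (derivative_sum0 _ hD)// (derivative_seqZ _ _ _ _ hD) => H.
  apply: le_trans H _; rewrite lerD2l.
  have : 2 * M / 2 ^+ m.+2 <= 2 * M / 2 ^+ m.
    rewrite ler_wpM2l//; first by lra.
    rewrite lef_pV2 ?posrE ?exprn_gt0//; apply: ler_weXn2l; first by lra.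
    by apply: leqW; exact: leqnSn.
  have : 0 <= 2 * M / 2 ^+ m.+2 by rewrite divr_ge0 ?exprn_ge0//; lra.
  move: (2 * M / 2 ^+ m.+2) => A A0 AB; have := nm_ge0 S t.
  have : nm t * A <= A by rewrite ler_piMl//; lra.
  lra.
(* The estimate [key] is used at [t / emb r]: the first bound makes this at most 1/2 in absolute
   value, the second turns the quadratic error into at most [e * nm t]. *)
exists (Num.min (r / 2) (e * r ^+ 2 / (4 * M))).
  by rewrite lt_min !divr_gt0 ?mulr_gt0 ?exprn_gt0.
move=> t; rewrite lt_min => /andP[tr te].
have er : emb r != 0 by rewrite fmorph_eq0 gt_eqF.
have nt : nm (t / emb r) = nm t / r by rewrite nmM nmV nm_emb gtr0_norm.
have := key (t / emb r); rewrite nt !scalerA divfK// => H.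
have {}H := H _; apply: le_trans (H _) _.
  by rewrite ler_pdivrMr//; lra.
have -> : 4 * M * (nm t / r) ^+ 2 = nm t * (4 * M) / r ^+ 2 * nm t.
  by field; rewrite gt_eqF.
rewrite ler_wpM2r ?nm_ge0// ler_pdivrMr ?exprn_gt0//.
by apply: ltW; rewrite -ltr_pdivlMr// mulr_gt0.
Qed.

End Expansion.
End ComplexAnalytic.

(** * Complex analytic maps are smooth *)

Section AnalyticDerivatives.
Context (R : realType) (E F : tvsType R[i]) (hF : hausdorff_space F)
  (U : set E) (oU : open U).
Local Notation S := (real_scalars_complex R).
Local Notation nm := (nm S).
Local Notation emb := (emb S).
Local Notation csnE := (csn S E).
Local Notation csnF := (csn S F).
Implicit Types (f : E -> F) (x u v : E) (q : csnE) (h : nat -> E -> F)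
  (D : nat -> E -> E -> F).

Lemma expandable_has_ddir f x v : locally_expandable U f -> U x ->
  has_ddir f x v (ddir v f x).
Proof.
move=> [cf fU] Ux; have [q [h fh]] := fU x Ux.
have [D hD] := derivative_seq_exists (proj2 fh).
apply: ddirP; exists (D 1%N 0 v); exact: (has_ddir_center cf Ux fh hD).
Qed.

Lemma expandable_linear f x a u v : locally_expandable U f -> U x ->
  ddir (a *: u + v) f x = a *: ddir u f x + ddir v f x.
Proof.
move=> [cf fU] Ux; have [q [h fh]] := fU x Ux.
have [D hD] := derivative_seq_exists (proj2 fh).
have DE w : ddir w f x = D 1%N 0 w.
  by apply: (ddirE hF); exact: (has_ddir_center cf Ux fh hD).
by rewrite !DE; have [_ _ ->] := hD 1%N.
Qed.

Section Approximation.
Variables (f : E -> F) (x : E) (q : csnE) (h : nat -> E -> F)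
  (D : nat -> E -> E -> F).
Hypotheses (fU : locally_expandable U f) (Ux : U x)
  (fh : expands_at U f x q h) (hD : derivative_seq h D).

Let cf z : U z -> {for z, continuous f}. Proof. by case: fU => + _; exact. Qed.
Let qU y : q y < 1 -> U (x + y). Proof. by case: fh => + _; exact. Qed.

Let fd v u : q u < 16^-1 -> has_ddir f (x + u) v (ddir v f (x + u)).
Proof. by move=> qu; apply: expandable_has_ddir => //; apply: qU; lra. Qed.

Let small q' v : exists2 r : R, 0 < r & q' (emb r *: v) < 8^-1.
Proof.
have qv := sn_ge0 q' v.
exists (8 * (q' v + 1))^-1; first by rewrite invr_gt0; lra.
rewrite snZ nm_emb gtr0_norm; last by rewrite invr_gt0; lra.
by rewrite invfM -mulrA gtr_pMr ?invr_gt0// mulrC ltr_pdivrMr; lra.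
Qed.

(** The condition on [u] involves [q] alone, neither [p] nor [v]; only the constant [C] depends on
    them. This gives pointwise convergence on a fixed ball. *)
Lemma ddir_approx u v (p : csnF) : q u < 16^-1 ->
  exists C : R, forall m,
    p (ddir v f (x + u) - \sum_(n < m) D n u v) <= C / 2 ^+ m.
Proof.
move=> qu; have [M [q1 q1M]] := near_disc_bound p cf qU qu.
have [q' q'P] := csn_max q q1; have [r r0 rv] := small q' v.
exists (2 * M / r) => m.
have fl : has_ddir f (x + u) v (ddir v f (x + u)) := @fd v u qu.
have qq' y : q y <= q' y by case: (q'P y).
apply: (derivative_approx_scaled fh hD m r0 qq') fl.
- by have [+ _] := q'P (emb r *: v); lra.
- move=> z t z4 t4; apply: q1M => //; rewrite snZ.
  have : nm t * q1 (emb r *: v) <= 4 * q1 (emb r *: v).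
    by rewrite ler_wpM2r ?sn_ge0.
  by have [_] := q'P (emb r *: v); lra.
Qed.

(** Complementary to [ddir_approx]: one constant for all [u] in a ball that depends on [p]. This
    uniformity is what continuity of D_v f at [x] requires. *)
Lemma ddir_approx_center v (p : csnF) : exists (q' : csnE) (C : R),
  forall u, q' u < 1 -> forall m,
    p (ddir v f (x + u) - \sum_(n < m) D n u v) <= C / 2 ^+ m.
Proof.
have [q' [qq' q'M]] := near_center_bound q cf Ux p.
have [r r0 rv] := small q' v.
have [q2 q2E] := csn_scale q' (ltr0Sn R 15).
exists q2, (2 * (p (f x) + 1) / r) => u; rewrite q2E => qu m.
have {}qu : q' u < 16^-1 by lra.
have fl : has_ddir f (x + u) v (ddir v f (x + u)).
  by apply: fd; have := qq' u; lra.
apply: (derivative_approx_scaled fh hD m r0 qq') fl.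
- by have := qq' u; have := qq' (emb r *: v); lra.
- move=> z t z4 t4; apply: q'M; apply: le_lt_trans (snD _ _ _) _; rewrite !snZ.
  have : nm t * q' (emb r *: v) <= 4 * q' (emb r *: v).
    by rewrite ler_wpM2r ?sn_ge0.
  have : nm z * q' u <= 4 * q' u by rewrite ler_wpM2r ?sn_ge0.
  by move: rv; rewrite snZ; lra.
Qed.

Lemma ddir_bound_center (p : csnF) q' (M : R) u v : (forall y, q y <= q' y) ->
  (forall w, q' w < 1 -> p (f (x + w)) <= M) ->
  q' u < 16^-1 -> q' v < 16^-1 -> p (ddir v f (x + u)) <= 2 * M.
Proof.
move=> qq' q'M qu qv.
have := @derivative_approx_scaled R E F U f x q h D fh hD p q' u v 1 M
  (ddir v f (x + u)) 0 ltr01 qq'.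
rewrite big_ord0 subr0 !divr1 rmorph1 !scale1r; apply.
- by have := qq' u; have := qq' v; lra.
- move=> z t z4 t4; apply: q'M; apply: le_lt_trans (snD _ _ _) _; rewrite !snZ.
  have : nm t * q' v <= 4 * q' v by rewrite ler_wpM2r ?sn_ge0.
  have : nm z * q' u <= 4 * q' u by rewrite ler_wpM2r ?sn_ge0.
  lra.
- by apply: fd; have := qq' u; lra.
Qed.

Lemma expands_at_ddir v : exists2 q16 : csnE, (forall y, q16 y = 16 * q y) &
  expands_at U (ddir v f) x q16 (fun n u => D n.+1 u v).
Proof.
have [q16 q16E] := csn_scale q (ltr0Sn R 15); exists q16 => //.
have q16q y : q16 y < 1 -> q y < 16^-1 by rewrite q16E; lra.
split=> [y /q16q qy|]; first by apply: qU; lra.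
split=> [n|y /q16q qy].
  by have [_ /(_ v) + _ _ _] := hD n.+1.
apply/(cvg_snP S) => p e e0.
have [C CP] := ddir_approx v p qy.
have [m mP] := half_pow_lt `|C| e0.
exists m => // n mn; rewrite /= snBC.
(* Since [D 0] vanishes, [n] terms of the shifted series are [n.+1] terms of the original one. *)
have -> : series (fun n => D n.+1 y v) n = \sum_(i < n.+1) D i y v.
  rewrite big_ord_recl; have [_ _ _ _ ->//] := hD 0%N.
  by rewrite add0r /series /= big_mkord.
apply: le_lt_trans mP; apply: le_trans (half_pow_le C (leqW mn)).
apply: le_trans (CP n.+1) _.
by rewrite ler_pM2r ?ler_norm// invr_gt0 exprn_gt0.
Qed.

Lemma ddir_continuous v : {for x, continuous (ddir v f)}.
Proof.
apply/(continuous_snP S) => p e e0; have e3 : 0 < e / 3 by lra.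
have [q' [C CP]] := ddir_approx_center v p.
have [m mP] := half_pow_lt C e3.
have /(continuous_snP S)/(_ p (e / 3) e3)[q1 q1P] :
    {for 0, continuous (fun u => \sum_(n < m) D n u v)}.
  apply: tvs_continuous_sum => n; have [_ /(_ v)[+ _] _ _ _] := hD n.
  exact.
have [q2 q2P] := csn_max q' q1; exists q2 => x' xx'.
have x'E : x' = x + (x' - x) by rewrite addrC subrK.
have h1 : p (ddir v f x' - \sum_(n < m) D n (x' - x) v) <= C / 2 ^+ m.
  by rewrite {1}x'E; apply: CP; have [+ _] := q2P (x' - x); lra.
have h2 : p (ddir v f x - \sum_(n < m) D n 0 v) <= C / 2 ^+ m.
  by have := CP 0; rewrite addr0 sn0; apply.
have h3 := q1P (x' - x); rewrite subr0 in h3.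
have {}h3 : p (\sum_(n < m) D n (x' - x) v - \sum_(n < m) D n 0 v) < e / 3.
  by apply: h3; have [_] := q2P (x' - x); lra.
have := sn_tri p (ddir v f x') (\sum_(n < m) D n (x' - x) v) (ddir v f x).
have := sn_tri p (\sum_(n < m) D n (x' - x) v) (\sum_(n < m) D n 0 v) (ddir v f x).
by rewrite [p (\sum_(n < m) D n 0 v - _)]snBC; lra.
Qed.

End Approximation.

Lemma locally_expandable_ddir f v : locally_expandable U f ->
  locally_expandable U (ddir v f).
Proof.
move=> fU; split=> x Ux; have [q [h fh]] := proj2 fU x Ux;
  have [D hD] := derivative_seq_exists (proj2 fh).
  exact: (ddir_continuous fU Ux fh hD).
have [q16 _ h16] := expands_at_ddir fU fh hD v.
by exists q16, (fun n u => D n.+1 u v).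
Qed.

Lemma locally_expandable_dd f ys : locally_expandable U f ->
  locally_expandable U (dd f ys).
Proof.
elim: ys f => [//|v ys IH] f fU; apply: (IH (ddir v f)).
exact: locally_expandable_ddir.
Qed.

(** The seminorm [q'] is chosen before the map and the directions, so the derivatives in all
    directions [v] from a bounded set expand on one ball. *)
Lemma expands_at_dd n q : exists q' : csnE, forall f x h ys,
  locally_expandable U f -> expands_at U f x q h -> size ys = n ->
  exists h', expands_at U (dd f ys) x q' h'.
Proof.
elim: n q => [|n IH] q.
  by exists q => f x h [|//] fU fh _; exists h.
have [q16 q16E] := csn_scale q (ltr0Sn R 15).
have [q' q'P] := IH q16; exists q' => f x h [//|v ys] fU fh [ysn].
have [D hD] := derivative_seq_exists (proj2 fh).
have [q2 q2E h2] := expands_at_ddir fU fh hD v.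
apply: (q'P (ddir v f) x (fun n u => D n.+1 u v) ys) => //.
  exact: locally_expandable_ddir.
case: h2 => qU [hh fcv]; split=> [y qy|]; first by apply: qU; rewrite q2E -q16E.
by split=> // y qy; apply: fcv; rewrite q2E -q16E.
Qed.

Lemma expansion_center f x q h y : expansion f x q h -> f x = h 0%N y.
Proof.
move=> [hh fcv]; apply/eqP; rewrite -subr_eq0; apply/eqP.
apply: (hausdorff_sn0 (S := S) hF) => p; apply/le_anti; rewrite sn_ge0 andbT.
have := fcv 0; rewrite sn0 addr0 => /(_ ltr01) cv.
apply: (cvg_sn_le cv); exists 1%N => -[//|n] _.
rewrite /series /= big_nat_recl//= big1 ?addr0.
  have [_ hom] := hh 0%N; have := homogeneousZ 0 y hom.
  by rewrite scale0r expr0 scale1r => ->; rewrite subrr sn0.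
move=> i _; have [_ hom] := hh i.+1; have := homogeneousZ 0 (0 : E) hom.
by rewrite scaler0 expr0n scale0r.
Qed.

(** The derivative in direction [y] has the homogeneous parts [D n.+1 u y]; at [u = y], Euler's
    relation [D n u u = n h n u] contributes one factor of the factorial at each step. *)
Lemma dd_expansion f x q h k y : locally_expandable U f -> U x ->
  expands_at U f x q h -> dd f (nseq k y) x = k`!%:R *: h k y.
Proof.
elim: k f q h => [|k IH] f q h fU Ux fh.
  by rewrite /= scale1r; apply: expansion_center (proj2 fh).
have [D hD] := derivative_seq_exists (proj2 fh).
have [q2 _ h2] := expands_at_ddir fU fh hD y.
rewrite [LHS](IH (ddir y f) q2 _ (locally_expandable_ddir y fU) Ux h2).
have [_ _ _ -> _] := hD k.+1.
by rewrite scalerA -natrM factS mulnC.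
Qed.

(** Iterates [ddir_bound_center]: each derivative doubles the bound and divides the admissible
    radius by 16. *)
Lemma dd_bound n f x q h (p : csnF) q' (M : R) ys u :
  locally_expandable U f -> U x -> expands_at U f x q h ->
  (forall y, q y <= q' y) -> (forall w, q' w < 1 -> p (f (x + w)) <= M) ->
  size ys = n -> (forall y, y \in ys -> q' y < (16 ^+ n)^-1) ->
  q' u < (16 ^+ n)^-1 -> p (dd f ys (x + u)) <= 2 ^+ n * M.
Proof.
elim: n f q h q' M ys => [|n IH] f q h q' M ys fU Ux fh qq' q'M.
  by move=> /size0nil -> _; rewrite expr0 invr1 mul1r => /q'M.
case: ys => [//|v ys] [ysn] ysq qu.
have [D hD] := derivative_seq_exists (proj2 fh).
have [q16 q16E h16] := expands_at_ddir fU fh hD v.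
have [q'16 q'16E] := csn_scale q' (ltr0Sn R 15).
have p16 : (16 ^+ n.+1)^-1 = 16^-1 * (16 ^+ n)^-1 :> R by rewrite exprS invfM.
have p1 : (16 ^+ n)^-1 <= 1 :> R.
  by rewrite invf_le1 ?exprn_gt0// exprn_ege1//; lra.
rewrite exprSr -mulrA.
apply: (IH (ddir v f) q16 _ q'16 (2 * M) ys _ Ux h16) => //.
- exact: locally_expandable_ddir.
- by move=> y; rewrite q16E q'16E; have := qq' y; lra.
- move=> w; rewrite q'16E => qw.
  apply: (ddir_bound_center fU fh hD qq' q'M); first by lra.
  by have := ysq v (mem_head _ _); rewrite p16; lra.
- move=> y yys; have := ysq y; rewrite inE yys orbT p16 q'16E => /(_ isT).
  by lra.
- by rewrite q'16E; move: qu; rewrite p16; lra.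
Qed.

Lemma locally_expandable_Cr f n : locally_expandable U f -> Cr U f n.
Proof.
move=> fU.
have fd m : has_derivs U f m.
  move=> ys _ x Ux v; rewrite dd_rcons; apply: expandable_has_ddir => //.
  exact: locally_expandable_dd.
have fl m : linear_derivs U f m.
  move=> ys _ x Ux a u v; rewrite !dd_rcons; apply: expandable_linear => //.
  exact: locally_expandable_dd.
have fb m : locbd_derivs S U f m.
  move=> x Ux p; have [q [h fh]] := proj2 fU x Ux.
  have [q' [qq' q'M]] := near_center_bound q (proj1 fU) Ux p.
  have c0 : 0 < 16 ^+ m :> R by rewrite exprn_gt0.
  have [q2 q2E] := csn_scale q' c0.
  have q2q y : q2 y < 1 -> q' y < (16 ^+ m)^-1.
    by rewrite q2E mulrC -ltr_pdivlMr// div1r.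
  exists q2, (2 ^+ m * (p (f x) + 1)) => u /q2q qu y qy.
  rewrite dmapE; apply: (dd_bound fU Ux fh qq' q'M) => //.
    exact: size_tseq.
  by move=> _ /mapP[i _ ->]; exact: q2q.
by split => //; apply: (locbd_cont hF oU (fd _) (fl _)) => j _; exact: fb.
Qed.

End AnalyticDerivatives.

(** * Derivatives of complex analytic maps *)

Section ComplexDerivativeMap.
Context (R : realType) (E F : tvsType R[i]) (hF : hausdorff_space F)
  (U : set E) (oU : open U) (b : bornology) (k : nat) (f : E -> F)
  (fU : locally_expandable U f).
Local Notation S := (real_scalars_complex R).
Local Notation nm := (nm S).
Local Notation emb := (emb S).
Local Notation L := (clin b k E F).
Local Notation g := (fder b k f).

Let sc := ComplexScalars R.

Let smooth n : leS n Smooth -> Cr U f n.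
Proof. by move=> _; exact: locally_expandable_Cr. Qed.

Let one_le_smooth : leS 1 Smooth := isT.

Let kmS m : leS (k + m) (order_in b Smooth). Proof. by case: b. Qed.

Let gC m : Cr U g m.
Proof. exact: (fder_smooth_Cr sc hF oU one_le_smooth smooth (kmS m)). Qed.

Let g_dmap m x (y : tpow m E) (v : tpow k E) : U x ->
  dmap g x y v = dd f (tseq v ++ tseq y) x.
Proof.
move=> Ux.
have [_ ->//] := fder_smooth_dmap sc hF oU one_le_smooth smooth (kmS m) y.
by rewrite dmapE tseq_tcat.
Qed.

Lemma fder_expandableE x v : U x -> g x v = dd f (tseq v) x.
Proof.
by move=> Ux; rewrite (fder_smooth_val sc hF oU one_le_smooth smooth (kmS 0) Ux) dmapE.
Qed.

Lemma fder_continuous x : U x -> {for x, continuous g}.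
Proof.
move=> Ux; have [_ _ gc] := gC 0.
exact: (@dd_continuous _ _ S _ _ _ g 0 [::] x gc isT Ux).
Qed.

Lemma clin_sumE I (r : seq I) (a : I -> L) v :
  (\sum_(i <- r) a i : L) v = \sum_(i <- r) a i v.
Proof.
by elim: r => [|i r IH]; rewrite ?big_nil ?big_cons// -IH.
Qed.

Lemma clin_bounded (l : L) (B : set (tpow k E)) (p : csn S F) :
  in_bornology b B -> exists M : R, forall v, B v -> p (l v) <= M.
Proof.
move=> bB; have /(nbhs_nmP S)[d d0 dP] := clin_absorbed l bB (sn_nbhs p).
have d2 : 0 < d / 2 by lra.
exists (d / 2)^-1 => v Bv.
have := dP (emb (d / 2)); rewrite subr0 nm_emb gtr0_norm// => /(_ ltac:(lra) v Bv).
rewrite /= snZ nm_emb gtr0_norm// => H.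
by rewrite -[leRHS]div1r ler_pdivlMr// mulrC ltW.
Qed.

(** Near each point of the disc, continuity of f^(k) into [clin] bounds it uniformly on [B];
    compactness of the disc gives one bound. The index of the filter [\oo] serves as that bound. *)
Lemma fder_disc_bound x (q : csn S E) y (B : set (tpow k E)) (p : csn S F) :
  (forall y, q y < 1 -> U (x + y)) -> q y < 16^-1 -> in_bornology b B ->
  exists M : R, forall z, nm z <= 4 -> forall v, B v -> p (g (x + z *: y) v) <= M.
Proof.
move=> qU qy bB.
have [|n0 _ n0P] := @disc_near R _ (nbhs \oo) _
    (fun n z => forall v, B v -> p (g (x + z *: y) v) <= n%:R) 4.
  move=> z z8; have Uz : U (x + z *: y).
    apply: qU; rewrite snZ.
    have : nm z * q y <= 2 * 4 * q y by rewrite ler_wpM2r ?sn_ge0.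
    lra.
  have [M MP] := clin_bounded (g (x + z *: y)) p bB.
  pose A := [set l : L | forall v, B v -> p (l v - g (x + z *: y) v) < 1].
  have gA : nbhs (g (x + z *: y)) A by apply/(clin_nbhsP S); exists B, p.
  have /(nbhs_snP S)[q1 q1A] := fder_continuous Uz gA.
  have c0 : 0 < q1 y + 1 by have := sn_ge0 q1 y; lra.
  exists (q1 y + 1)^-1; first by rewrite invr_gt0.
  exists (Num.bound (`|M| + 1)) => // n /= Mn z' z'z v Bv.
  have {}Mn : `|M| + 1 <= n%:R.
    apply: le_trans (ltW (archi_boundP _)) _; last by rewrite ler_nat.
    by rewrite addr_ge0.
  have {}z'z : nm (z' - z) * (q1 y + 1) < 1 by rewrite -ltr_pdivlMr// div1r.
  have /(_ v Bv) : A (g (x + z' *: y)).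
    apply: q1A; have -> : x + z' *: y - (x + z *: y) = (z' - z) *: y.
      by module R[i].
    by rewrite snZ; have := nm_ge0 S (z' - z); lra.
  have := sn_leD p (g (x + z' *: y) v) (g (x + z *: y) v).
  by have := MP v Bv; have := ler_norm M; lra.
exists n0%:R => z z4 v Bv; exact: (n0P n0 (leqnn n0)).
Qed.

(** For fixed [v] the series of f^(k) is the expansion of the map [dd f (tseq v)]. These expansions
    share a ball by [expands_at_dd] and a bound by [fder_disc_bound], so their tails are small
    uniformly in [v]. *)
Lemma fder_locally_expandable : locally_expandable U g.
Proof.
split=> x Ux; first exact: fder_continuous.
have [q [h fh]] := proj2 fU x Ux; have [q' q'P] := expands_at_dd F U k q.
have dfh ys : size ys = k -> exists h', expands_at U (dd f ys) x q' h'.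
  exact: q'P fh.
have q'U y : q' y < 1 -> U (x + y).
  by have [h' [+ _]] := dfh (nseq k 0) (size_nseq _ _); exact.
have [q16 q16E] := csn_scale q' (ltr0Sn R 15).
have q16q y : q16 y < 1 -> q' y < 16^-1 by rewrite q16E; lra.
(* Taylor terms of f^(k), defined by its own derivatives in [clin], so that continuity and
   homogeneity are inherited from [gC]. *)
pose beta n y : L := n`!%:R^-1 *: dmap g x (fun _ : 'I_n => y).
exists q16, beta; split=> [y /q16q qy|]; first by apply: q'U; lra.
split=> [n|y /q16q qy].
  have [gd gl gc] := gC n; split.
    move=> y; apply: (@tvs_continuousZ _ E L n`!%:R^-1
      (fun y => dmap g x (fun _ : 'I_n => y))).
    apply/(continuous_snP S) => p e e0.
    have /(joint_continuous_snP S)/(_ p e e0)[q1 q1P] :=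
      gc n (leqnn n) x Ux (fun=> y).
    exists q1 => y' yy'; apply: (q1P x (fun=> y')) => //.
    by rewrite subrr sn0.
  exists (fun w => n`!%:R^-1 *: dmap g x w) => // i w a u v.
  rewrite (dmap_multilinear S (clin_hausdorff S hF) oU gd gl Ux).
  by rewrite scalerDr !scalerA [_^-1 * a]mulrC.
apply/(clin_cvgP S) => B bB p e e0.
have [M MP] := fder_disc_bound p q'U qy bB.
have [m mP] := half_pow_lt (2 * `|M|) e0.
exists m => // n /= mn v Bv.
have [h' vh'] := dfh (tseq v) (size_tseq v).
have beta_v i : beta i y v = h' i y.
  rewrite [LHS](_ : _ = i`!%:R^-1 *: dmap g x (fun _ : 'I_i => y) v)//.
  rewrite g_dmap// (_ : tseq (fun=> y) = nseq i y); last first.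
    by apply: (@eq_from_nth _ 0); rewrite size_tseq ?size_nseq// => j ji;
      rewrite (nth_tseq 0 _ (Ordinal ji)) nth_nseq ji.
  rewrite dd_cat (dd_expansion hF i y (locally_expandable_dd (tseq v) fU) Ux vh').
  by rewrite scalerA mulVf ?scale1r// pnatr_eq0 -lt0n fact_gt0.
have h'M i : p (h' i y) <= `|M| / 2 ^+ i.
  (* [term_bound] is used with second direction 0, so that a bound on the single disc through [y]
     suffices. *)
  have qy0 : q' y + q' 0 < 4^-1 by rewrite sn0; lra.
  have := @term_bound R E F (dd f (tseq v)) x q' h' p y 0 `|M| (proj2 vh') qy0 _ i 0.
  rewrite scaler0 addr0 nm0; apply => //.
  move=> z t z4 _; rewrite scaler0 addr0 -fder_expandableE.
    by apply: le_trans (ler_norm _); exact: MP.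
  apply: q'U; rewrite snZ.
  by have : nm z * q' y <= 4 * q' y; [rewrite ler_wpM2r ?sn_ge0|lra].
rewrite snBC; apply: le_lt_trans mP.
rewrite /series /= clin_sumE big_mkord; under eq_bigr do rewrite beta_v.
have Uxy : U (x + y) by apply: q'U; lra.
rewrite fder_expandableE//; have [_ [_ h'cv]] := vh'.
have qy1 : q' y < 1 by lra.
apply: (cvg_sn_le (h'cv y qy1)); exists n => l nl.
have H := @geom_half R F p n l (fun i => h' i y) `|M| (normr_ge0 _) nl
  (fun i _ => h'M i).
rewrite /series /= big_mkord; apply: le_trans H _.
have -> : 2 * `|M| = `|2 * `|M| | by rewrite normrM normr_id normr_nat.
exact: half_pow_le.
Qed.

End ComplexDerivativeMap.

(** * Real analytic maps *)

Section Complexify.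
Context (R : realType) (E : tvsType R).
Local Notation EC := (complexification E).

Definition complexify (x : E) : EC := (x, 0).

Lemma complexify_continuous : continuous complexify.
Proof.
move=> x; have c1 : (fun z : E => z) @ x --> x by exact: cvg_id.
have c2 : (fun _ : E => 0 : E) @ x --> (0 : E) by exact: cvg_cst.
exact: (cvg_pair c1 c2).
Qed.

Lemma complexifyP (a : R) (u v : E) :
  complexify (a *: u + v) = a%:C%C *: complexify u + complexify v.
Proof.
transitivity ((a *: u - 0 *: 0 + v, 0 *: u + a *: 0 + 0) : EC) => //.
by rewrite !scaler0 scale0r subr0 !addr0.
Qed.

Lemma complexification_hausdorff : hausdorff_space E -> hausdorff_space EC.
Proof.
move=> hE [x y] [x' y'] h; congr (_, _); apply: hE => A B xA xB.
  have [||[z w] [/= Az Bz]] := h (A `*` setT) (B `*` setT).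
  - by exists (A, setT) => //; split => //; exact: filterT.
  - by exists (B, setT) => //; split => //; exact: filterT.
  by exists z; move: Az Bz => [? _] [? _].
have [||[z w] [/= Az Bz]] := h (setT `*` A) (setT `*` B).
- by exists (setT, A) => //; split => //; exact: filterT.
- by exists (setT, B) => //; split => //; exact: filterT.
by exists w; move: Az Bz => [_ ?] [_ ?].
Qed.

End Complexify.
Arguments complexify {R E} x.

Section RealDerivative.
Context (R : realType) (E F : tvsType R).
Local Notation EC := (complexification E).
Local Notation FC := (complexification F).
Local Notation SR := (real_scalars_real R).
Local Notation SC := (real_scalars_complex R).

Lemma real_scalar_fst (t : R) (w : FC) : (t%:C%C *: w).1 = t *: w.1.
Proof. by transitivity (t *: w.1 - 0 *: w.2) => //; rewrite scale0r subr0. Qed.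

Lemma real_scalar_snd (t : R) (w : FC) : (t%:C%C *: w).2 = t *: w.2.
Proof. by transitivity (0 *: w.1 + t *: w.2) => //; rewrite scale0r add0r. Qed.

Lemma real_ddir (G : EC -> FC) (x v : E) (l : FC) :
  has_ddir G (complexify x) (complexify v) l ->
  has_ddir (fun x' => (G (complexify x')).1) x v l.1 /\
  has_ddir (fun x' => (G (complexify x')).2) x v l.2.
Proof.
move=> Gl; pose Q (t : R[i]) :=
  t^-1 *: (G (complexify x + t *: complexify v) - G (complexify x)).
have Ql : (fun t : R^o => Q t%:C%C) @ (0 : R^o)^' --> l.
  move=> A /Gl /(dnbhs0_nmP SC)[d d0 dA]; apply/(dnbhs0_nmP SR).
  exists d => // t t0 td; apply: dA; first by rewrite fmorph_eq0.
  by rewrite (nm_emb SC).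
have E1 t : G (complexify x + t%:C%C *: complexify v) = G (complexify (x + t *: v)).
  by rewrite [x + _]addrC complexifyP addrC.
have QE t : Q t%:C%C = (t^-1%:C)%C *: (G (complexify (x + t *: v)) - G (complexify x)).
  by rewrite /Q E1 -fmorphV.
have c1 : (fun w : FC => w.1 : F) @ l --> l.1 by exact: cvg_fst.
have c2 : (fun w : FC => w.2 : F) @ l --> l.2 by exact: cvg_snd.
split.
  rewrite /has_ddir (_ : (fun t => _) = (fun t : R^o => (Q t%:C%C).1)).
    exact: (cvg_comp _ _ Ql c1).
  by apply/funext => t; rewrite QE real_scalar_fst.
rewrite /has_ddir (_ : (fun t => _) = (fun t : R^o => (Q t%:C%C).2)).
  exact: (cvg_comp _ _ Ql c2).
by apply/funext => t; rewrite QE real_scalar_snd.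
Qed.

Context (hF : hausdorff_space F) (U : set E) (oU : open U)
  (W : set EC) (oW : open W) (UW : forall x, U x -> W (complexify x))
  (f : E -> F) (g : EC -> FC) (gW : locally_expandable W g)
  (gf : forall x, U x -> g (complexify x) = complexify (f x)).

Let hFC : hausdorff_space FC := complexification_hausdorff hF.

(** On the real points of [U] the second component of the complex derivative is constantly 0, hence
    so is its directional derivative. Thus the next derivative is again real, and its first
    component is the derivative of [f]. *)
Let real_step ys : (forall x, U x ->
    dd g (map complexify ys) (complexify x) = complexify (dd f ys x)) ->
  forall x v, U x -> has_ddir (dd f ys) x v (dd f (rcons ys v) x) /\
    dd g (map complexify (rcons ys v)) (complexify x)
      = complexify (dd f (rcons ys v) x).
Proof.
move=> fg x v Ux; rewrite map_rcons !dd_rcons.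
set G := dd g (map complexify ys); set l := ddir (complexify v) G (complexify x).
have Gl : has_ddir G (complexify x) (complexify v) l.
  apply: expandable_has_ddir (UW Ux); exact: locally_expandable_dd.
have [l1 l2] := real_ddir Gl.
have fd : has_ddir (dd f ys) x v l.1.
  apply: (has_ddir_ext SR oU Ux _ l1).
  by move=> y /set_mem Uy; rewrite /G fg.
have d2 : has_ddir (fun=> 0 : F) x v l.2.
  apply: (has_ddir_ext SR oU Ux _ l2).
  by move=> y /set_mem Uy; rewrite /G fg.
rewrite (ddirE hF fd); split=> //.
have l20 : l.2 = 0.
  apply: (has_ddir_unique hF d2); apply/(has_ddirP SR) => p e e0.
  exists 1 => // t _; rewrite subr0 scaler0 subr0 sn0.
  by rewrite mulr_ge0 ?nm_ge0// ltW.
by rewrite /complexify -l20; case: (l).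
Qed.

Lemma dd_complexify ys x : U x ->
  dd g (map complexify ys) (complexify x) = complexify (dd f ys x).
Proof.
elim/last_ind: ys x => [|ys v IH] x Ux; first exact: gf.
by have [] := real_step IH v Ux.
Qed.

Lemma real_analytic_Cr n : Cr U f n.
Proof.
have fd : has_derivs U f n.
  move=> ys _ x Ux v.
  by have [] := real_step (fun y => @dd_complexify ys y) v Ux.
have fc : cont_derivs U f n.
  move=> j jn x Ux y.
  have [_ _ gc] := locally_expandable_Cr hFC oW n gW.
  have := gc j jn (complexify x) (UW Ux) (fun i => complexify (y i)).
  move=> gcxy.
  have c1 : (fun q : E * tpow j E => complexify q.1) @ (x, y) --> complexify x.
    apply: (@cvg_comp _ _ _ fst complexify _ (nbhs x)); first exact: cvg_fst.
    exact: complexify_continuous.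
  have c2 : (fun q : E * tpow j E => (fun i => complexify (q.2 i)) : tpow j EC)
      @ (x, y) --> ((fun i => complexify (y i)) : tpow j EC).
    apply: (@tpow_cvg _ _ SC EC _ _ (nbhs_filter (x, y))) => i.
    apply: (@cvg_comp _ _ _ snd (fun y : tpow j E => complexify (y i)) _ (nbhs y)).
      exact: cvg_snd.
    apply: (@cvg_comp _ _ _ (fun y : tpow j E => y i) complexify _ (nbhs (y i))).
      exact: tpow_proj_continuous.
    exact: complexify_continuous.
  pose cy : tpow j EC := fun i => complexify (y i).
  have c3 : (fun q : E * tpow j E => dmap g (complexify q.1)
      ((fun i => complexify (q.2 i)) : tpow j EC)) @ (x, y) -->
      dmap g (complexify x) cy.
    exact: (@cvg_comp _ _ _ (fun q : E * tpow j E =>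
      (complexify q.1, (fun i => complexify (q.2 i)) : tpow j EC))
      (fun p : EC * tpow j EC => dmap g p.1 p.2) _ (nbhs (complexify x, cy)) _
      (cvg_pair c1 c2) gcxy).
  have cfst : (fun w : FC => w.1 : F) @ dmap g (complexify x) cy
      --> (dmap g (complexify x) cy).1 by exact: cvg_fst.
  have c4 := cvg_comp _ _ c3 cfst.
  have E1 x' (y' : tpow j E) : U x' ->
      (dmap g (complexify x') (fun i => complexify (y' i))).1 = dmap f x' y'.
    move=> Ux'; rewrite !dmapE.
    have -> : tseq (fun i => complexify (y' i)) = map complexify (tseq y').
      by rewrite /tseq -map_comp.
    by rewrite dd_complexify.
  apply/(@cvg_snP _ _ SR F _ _ (nbhs_filter (x, y))) => p e e0.
  move/(@cvg_snP _ _ SR F _ _ (nbhs_filter (x, y)))/(_ p e e0) : c4.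
  have UT : nbhs (x, y) [set q : E * tpow j E | U q.1].
    exists (U, setT); last by move=> [a b] [].
    by split; [exact: open_nbhs_nbhs|exact: filterT].
  by apply: filterS2 UT => -[x' y'] /= Ux'; rewrite !E1.
split=> //; exact: (linear_derivs_cont SR hF oU fd fc).
Qed.

End RealDerivative.

(** * Restriction of complex multilinear maps to real arguments *)

Section Restriction.
Context (R : realType) (b : bornology) (k : nat) (E F : tvsType R).
Local Notation EC := (complexification E).
Local Notation FC := (complexification F).
Local Notation LC := (clin b k EC FC).
Local Notation L := (clin b k E F).
Local Notation SR := (real_scalars_real R).
Local Notation SC := (real_scalars_complex R).

Definition tcomplexify (v : tpow k E) : tpow k EC := fun i => complexify (v i).

Lemma tcomplexify_continuous : continuous tcomplexify.
Proof.
move=> v; apply: (@tpow_cvg _ _ SC EC _ _ (nbhs_filter v)) => i.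
apply: (@cvg_comp _ _ _ (fun y : tpow k E => y i) complexify _ (nbhs (v i))).
  exact: tpow_proj_continuous.
exact: complexify_continuous.
Qed.

Lemma tcomplexify_tset v i (u : E) :
  tcomplexify (tset v i u) = tset (tcomplexify v) i (complexify u).
Proof. by apply/funext => j; rewrite /tcomplexify /tset; case: eqP. Qed.

(** Yields continuity of [clin_restrict]: uniform closeness on the image of [B] is uniform closeness
    of the restrictions on [B]. *)
Lemma tcomplexify_bornology (B : set (tpow k E)) :
  in_bornology b B -> in_bornology b (tcomplexify @` B).
Proof.
case: b => /= [cB|bB].
  apply: continuous_compact cB; apply: continuous_subspaceT.
  exact: tcomplexify_continuous.
move=> V /(tpow_nbhs_snP SC)[q qV].
have V0 : nbhs (0 : tpow k E) [set v : tpow k E | forall i, q (complexify (v i)) < 1].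
  apply: (@tpow_nbhs_box _ _ k 0 (fun=> [set z | q (complexify z) < 1])) => i.
  exact: (@complexify_continuous _ E 0 _ (sn_ball0 q ltr01)).
have [r r0 rB] := bB _ V0.
exists r%:C%C; first by rewrite ltcR.
move=> t rt _ [v Bv <-].
have [|w w1 wv] := rB r _ v Bv; first by rewrite ger0_norm// ltW.
have {}rt : r <= nm SC t by rewrite -(emb_le SC) emb_nm.
have nt : 0 < nm SC t by apply: lt_le_trans rt.
have t0 : t != 0 by rewrite -(nm_gt0 SC).
exists (t^-1 *: tcomplexify v); last by rewrite scalerA divff// scale1r.
apply: qV => i; rewrite subr0 [X in q X](_ : _ = t^-1 *: complexify (v i))//.
have -> : complexify (v i) = r%:C%C *: complexify (w i) + complexify 0.
  by rewrite -complexifyP addr0 -wv.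
rewrite [complexify 0](_ : _ = 0)// addr0 !snZ nmV.
have -> : nm SC r%:C%C = r by rewrite (nm_emb SC) gtr0_norm.
rewrite mulrA; apply: le_lt_trans (w1 i).
by rewrite ler_piMl ?sn_ge0// mulrC ler_pdivrMr// mul1r.
Qed.

Definition restrict1 (A : LC) : L := insubd 0 (fun v => (A (tcomplexify v)).1).
Definition restrict2 (A : LC) : L := insubd 0 (fun v => (A (tcomplexify v)).2).
(** Real and imaginary part form one element of the complexification of [L], which makes the map
    complex linear; composition with it then preserves complex analyticity. *)
Definition clin_restrict (A : LC) : complexification L := (restrict1 A, restrict2 A).

Let restrict_val (A : LC) (pi : FC -> F) : continuous pi ->
  (forall (a : R) w w', pi (a%:C%C *: w + w') = a *: pi w + pi w') ->
  (fun v => pi (A (tcomplexify v))) \in @clin_pred R k E F.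
Proof.
move=> cpi lpi; apply/asboolP; split.
  move=> v; apply: (@cvg_comp _ _ _ (fun v => A (tcomplexify v)) pi _
    (nbhs (A (tcomplexify v)))); last exact: cpi.
  apply: (@cvg_comp _ _ _ tcomplexify A _ (nbhs (tcomplexify v))).
    exact: tcomplexify_continuous.
  exact: clin_continuous.
move=> i v a u w; rewrite !tcomplexify_tset complexifyP.
by rewrite (clin_multilinear A) lpi.
Qed.

Lemma restrict1E A v : restrict1 A v = (A (tcomplexify v)).1.
Proof.
rewrite /restrict1 val_insubd ifT//; apply: (@restrict_val A (fun w => w.1)).
  by move=> w; exact: cvg_fst.
move=> a w w'; transitivity ((a%:C%C *: w).1 + w'.1) => //.
by rewrite real_scalar_fst.
Qed.

Lemma restrict2E A v : restrict2 A v = (A (tcomplexify v)).2.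
Proof.
rewrite /restrict2 val_insubd ifT//; apply: (@restrict_val A (fun w => w.2)).
  by move=> w; exact: cvg_snd.
move=> a w w'; transitivity ((a%:C%C *: w).2 + w'.2) => //.
by rewrite real_scalar_snd.
Qed.

Lemma restrict_linear (a : R[i]) (A B : LC) :
  clin_restrict (a *: A + B) = a *: clin_restrict A + clin_restrict B.
Proof.
transitivity ((complex.Re a *: restrict1 A - complex.Im a *: restrict2 A + restrict1 B,
  complex.Im a *: restrict1 A + complex.Re a *: restrict2 A + restrict2 B)
  : complexification L) => //.
congr (_, _); apply/val_inj/funext => v.
  transitivity (complex.Re a *: restrict1 A v - complex.Im a *: restrict2 A v
    + restrict1 B v) => //.
  by rewrite [LHS]restrict1E !restrict1E restrict2E.
transitivity (complex.Im a *: restrict1 A v + complex.Re a *: restrict2 A v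
  + restrict2 B v) => //.
by rewrite [LHS]restrict2E !restrict2E restrict1E.
Qed.

Lemma restrict_continuous : continuous clin_restrict.
Proof.
have near_le (A : LC) (B : set (tpow k E)) (p : csn SR F) e : in_bornology b B ->
    0 < e -> nbhs A [set A' : LC | forall v, B v ->
      p (A' (tcomplexify v) - A (tcomplexify v)).1 < e /\
      p (A' (tcomplexify v) - A (tcomplexify v)).2 < e].
  move=> bB e0; exists (tcomplexify @` B), [set w : FC | p w.1 < e /\ p w.2 < e].
  split; first exact: tcomplexify_bornology.
    exists ([set z | p z < e], [set z | p z < e]); last by move=> [].
    by split; exact: sn_ball0.
  by move=> A' hA' v Bv; apply: hA'; exists v.
move=> A.
have c1 : restrict1 A' @[A' --> A] --> restrict1 A.
  apply/(@clin_cvgP _ _ SR _ _ _ _ _ _ (nbhs_filter A)) => B bB p e e0.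
  have := near_le A B p e bB e0; apply: filterS => A' hA' v Bv.
  by rewrite !restrict1E; have [] := hA' v Bv.
have c2 : restrict2 A' @[A' --> A] --> restrict2 A.
  apply/(@clin_cvgP _ _ SR _ _ _ _ _ _ (nbhs_filter A)) => B bB p e e0.
  have := near_le A B p e bB e0; apply: filterS => A' hA' v Bv.
  by rewrite !restrict2E; have [] := hA' v Bv.
exact: (cvg_pair c1 c2).
Qed.

End Restriction.

Lemma complex_analytic_comp (R : realType) (E M N : tvsType R[i]) (W : set E)
    (g : E -> M) (phi : M -> N) : open W -> complex_analytic W g ->
  continuous phi -> (forall a u v, phi (a *: u + v) = a *: phi u + phi v) ->
  complex_analytic W (phi \o g).
Proof.
move=> oW [cg gW] cphi lphi; split.
  apply/(within_openP _ oW) => x Wx.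
  move/(within_openP _ oW)/(_ x Wx) : cg => cg.
  exact: (continuous_comp cg (cphi _)).
have phi0 : phi 0 = 0.
  by have := lphi (-1) 0 0; rewrite scaler0 addr0 scaleN1r addNr.
move=> x Wx; have [Y [Y0 YW [h [hh hcv]]]] := gW x Wx.
exists Y; split => //; exists (fun n => phi \o h n); split=> [n|y Yy].
  have [ch [l ml hl]] := hh n; split.
    by move=> y; apply: (continuous_comp (ch y)); exact: cphi.
  exists (phi \o l); last by move=> y; rewrite /= hl.
  by move=> i y a u v; rewrite /= ml lphi.
have -> : series (fun n => (phi \o h n) y) = phi \o series (fun n => h n y).
  apply/funext => n; rewrite /series /=; elim: n => [|n IH].
    by rewrite !big_geq// phi0.
  rewrite !big_nat_recr//= IH.
  by have := lphi 1 (\sum_(0 <= i < n) h i y) (h n y); rewrite !scale1r.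
exact: (cvg_comp _ _ (hcv y Yy) (cphi _)).
Qed.

(** * Derivatives of analytic maps *)

Section AnalyticFder.
Context (R : realType) (b : bornology) (k : nat).

Lemma real_analytic_smooth (E F : tvsType R) (hF : hausdorff_space F)
    (U : set E) (oU : open U) (f : E -> F) :
  real_analytic U f -> forall n, Cr U f n.
Proof.
move=> [W [g [oW UW cg gf]]] n.
exact: (real_analytic_Cr hF oU oW UW (proj1 (complex_analyticP oW g) cg) gf).
Qed.

Lemma fder_complex_analytic (E F : tvsType R[i]) (hF : hausdorff_space F)
    (U : set E) (oU : open U) (f : E -> F) :
  complex_analytic U f -> complex_analytic U (fder b k f).
Proof.
move=> /(complex_analyticP oU) fU; apply/(complex_analyticP oU).
exact: fder_locally_expandable.
Qed.

Lemma fder_real_analytic (E F : tvsType R) (hF : hausdorff_space F)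
    (U : set E) (oU : open U) (f : E -> F) :
  real_analytic U f -> real_analytic U (fder b k f).
Proof.
move=> fa; have fC := real_analytic_smooth hF oU fa.
case: fa => W [g [oW UW cg gf]].
have hFC := complexification_hausdorff hF.
have gW := proj1 (complex_analyticP oW g) cg.
exists W, (@clin_restrict R b k E F \o fder b k g); split => //.
  apply: complex_analytic_comp => //.
  - exact: fder_complex_analytic.
  - exact: restrict_continuous.
  - exact: restrict_linear.
move=> x Ux.
have gx v : fder b k g (complexify x) (tcomplexify v) = complexify (dd f (tseq v) x).
  rewrite (fder_expandableE hFC oW)//; last exact: UW.
  have -> : tseq (tcomplexify v) = map complexify (tseq v) by rewrite /tseq -map_comp.
  exact: (dd_complexify hF oU UW gW gf).
(* On real arguments the derivatives of [g] at [(x, 0)] are those of [f], with second component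
   0. *)
congr (_, _); apply/val_inj/funext => v.
  rewrite [LHS]restrict1E gx.
  have kS : leS (k + 0) (order_in b Smooth) by case: b.
  have one_le : leS 1 Smooth by [].
  have fx := fder_smooth_val (RealScalars R) hF oU one_le (fun n _ => fC n) kS Ux.
  exact: (esym (congr1 (fun l : tpow k E -> F => l v) fx)).
by rewrite [LHS]restrict2E gx.
Qed.

End AnalyticFder.

(** * All orders of smoothness and both scalar fields *)

Section Main.
Context (R : realType) (K : numFieldType) (s : scalar_field R K)
  (E F : tvsType K) (hF : hausdorff_space F) (U : set E) (oU : open U).

Lemma analytic_Cr (f : E -> F) : analytic s U f -> forall n, Cr U f n.
Proof.
case: K / s E F hF U oU f => E' F' hF' U' oU' f fa n; first exact: real_analytic_smooth.
by apply: locally_expandable_Cr => //; apply/complex_analyticP.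
Qed.

Lemma fder_analytic b k (f : E -> F) : analytic s U f -> analytic s U (fder b k f).
Proof.
case: K / s E F hF U oU f => E' F' hF' U' oU' f.
  exact: fder_real_analytic.
exact: fder_complex_analytic.
Qed.

Lemma Cmap_Cr r (f : E -> F) : Cmap s r U f -> forall n, leS n r -> Cr U f n.
Proof.
case: r => [m||] fr.
- by apply/(CmapP s hF oU).
- by apply/(CmapP s hF oU).
- by move=> n _; exact: analytic_Cr.
Qed.

Lemma fder_Cmap b r k (f : E -> F) : leS 1 r -> Cmap s r U f -> leS k (order_in b r) ->
  Cmap s (subS (order_in b r) k) U (fder b k f).
Proof.
move=> r1 fr kr; have fC := Cmap_Cr fr.
have kmr m : leS m (subS (order_in b r) k) -> leS (k + m) (order_in b r).
  by case: (order_in b r) kr => //= l kl ml; rewrite -(subnKC kl) leq_add2l.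
have hL := clin_hausdorff (b := b) (k := k) (E := E) (scalars_of s) hF.
have [rA|rA] := pselect (r = Analytic).
  have -> : subS (order_in b r) k = Analytic by rewrite rA; case: b {kmr kr hL}.
  by rewrite rA in fr; exact: fder_analytic.
apply/(CmapP s hL oU); first by case: r rA {r1 fr kr fC kmr} => //; case: b {hL}.
by move=> m /kmr mr; exact: (fder_smooth_Cr s hF oU r1 fC mr).
Qed.

End Main.

Theorem corollary2p2 (R : realType) (K : numFieldType) (s : scalar_field R K)
    (E F : tvsType K) (hE : hausdorff_space E) (hF : hausdorff_space F)
    (U : set E) (oU : open U) (r : smoothness) (r1 : leS 1 r)
    (f : E -> F) (fr : Cmap s r U f) :
  (* (a) *)
  (forall k : nat, (0 < k)%N -> leS k r ->
     (forall x, U x -> fder OnCompact k f x = @dmap K E F k f x :> (tpow k E -> F)) /\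
     Cmap s (subS r k) U (fder OnCompact k f)) /\
  (* (b) *)
  (forall k : nat, (0 < k)%N -> leS k (subS r 1) ->
     (forall x, U x -> fder OnBounded k f x = @dmap K E F k f x :> (tpow k E -> F)) /\
     Cmap s (subS (subS r k) 1) U (fder OnBounded k f)) /\
  (* derivatives of f^(k), for the topologies of (a) and of (b) *)
  (forall j k : nat, (0 < j)%N -> (0 < k)%N -> leS (j + k) r ->
     forall y : tpow j E, dmap_exists U (fder OnCompact k f) y /\
       forall x, U x -> forall v : tpow k E,
         dmap (fder OnCompact k f) x y v = dmap f x (tcat v y)) /\
  (forall j k : nat, (0 < j)%N -> (0 < k)%N -> leS (j + k) (subS r 1) ->
     forall y : tpow j E, dmap_exists U (fder OnBounded k f) y /\
       forall x, U x -> forall v : tpow k E,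
         dmap (fder OnBounded k f) x y v = dmap f x (tcat v y)).
Proof.
have fC := Cmap_Cr hF oU fr.
have ab b k : leS k (order_in b r) ->
    (forall x, U x -> fder b k f x = @dmap K E F k f x :> (tpow k E -> F)) /\
    Cmap s (subS (order_in b r) k) U (fder b k f).
  move=> kr; split; last exact: fder_Cmap.
  have kr0 : leS (k + 0) (order_in b r) by rewrite addn0.
  exact: (fder_smooth_val s hF oU r1 fC kr0).
have cd b j k : leS (j + k) (order_in b r) ->
    forall y : tpow j E, dmap_exists U (fder b k f) y /\
      forall x, U x -> forall v : tpow k E,
        dmap (fder b k f) x y v = dmap f x (tcat v y).
  rewrite addnC => jkr y; exact: (fder_smooth_dmap s hF oU r1 fC jkr).
split=> [k _ kr|]; first exact: (ab OnCompact).
split=> [k _ kr|]; last first.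
  by split=> j k _ _ jkr; [exact: (cd OnCompact)|exact: (cd OnBounded)].
have -> : subS (subS r k) 1 = subS (order_in OnBounded r) k.
  by case: r {r1 fr fC ab cd kr} => //= m; rewrite subnAC.
exact: (ab OnBounded).
Qed.
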